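(* Let $R$ be a Noetherian commutative ring of Krull dimension $\le 1$, and let $\operatorname{Spec}R=P_0\sqcup P_1$ and $S\subset R$ be as in the context. Let $\mathsf C_R$ denote the full subcategory of $S$-reduced cotorsion $R$-modules in the category $R\text{-Mod}$ of $R$-modules. Then: (a) The full subcategory $\mathsf C_R$ is closed under kernels, cokernels, extensions, and infinite products in $R\text{-Mod}$. In particular, $\mathsf C_R$ is an abelian category and its embedding $\mathsf C_R\to R\text{-Mod}$ is an exact functor. (b) The functor $(C_{(\mathfrak m)})_{\mathfrak m\in P_1}\longmapsto\prod_{\mathfrak m\in P_1} C_{(\mathfrak m)}$ establishes an equivalence between the Cartesian product, taken over the maximal ideals $\mathfrak m\in P_1$ of $R$, of the abelian categories of $\mathfrak m$-contramodule $R$-modules, and the category $\mathsf C_R$.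
   Context: Setting: $R$ is a Noetherian commutative ring of Krull dimension $\le 1$, so every prime ideal is minimal or maximal. Fix a decomposition $\operatorname{Spec}R=P_0\sqcup P_1$ into disjoint subsets such that all prime ideals in $P_0$ are minimal and all prime ideals in $P_1$ are maximal (a prime that is both minimal and maximal is put arbitrarily in exactly one of the two sets). Set $S=R\setminus\bigcup_{\mathfrak q\in P_0}\mathfrak q$, a multiplicative subset of $R$. An $R$-module $C$ is cotorsion if $\operatorname{Ext}^1_R(F,C)=0$ for every flat $R$-module $F$. An $R$-module $B$ is $S$-divisible if $sB=B$ for every $s\in S$, and $S$-reduced if it has no nonzero $S$-divisible submodules. For $s\in R$, an $R$-module $C$ is an $s$-contramodule if $\operatorname{Hom}_R(R[s^{-1}],C)=0=\operatorname{Ext}^1_R(R[s^{-1}],C)$; for an ideal $I\subset R$, an $R$-module is an $I$-contramodule if it is an $s$-contramodule for every $s\in I$; $I$-contramodule $R$-modules form a full subcategory of $R\text{-Mod}$. A full subcategory is closed under kernels (cokernels) if for every morphism between two of its objects the kernel (cokernel) computed in the ambient category belongs to it. *)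

(* Defs.v *)
From HB Require Import structures.
From mathcomp Require Import all_boot all_order all_algebra generic_quotient.
From mathcomp Require Import zify ring.
From mathcomp Require Import boolp classical_sets.

Set Implicit Arguments.
Unset Strict Implicit.
Unset Printing Implicit Defensive.

Import GRing.Theory.
Local Open Scope classical_set_scope.
Local Open Scope ring_scope.
Local Open Scope quotient_scope.

Record preaddCat := PreaddCat {
  obj :> Type;
  hom : obj -> obj -> zmodType;
  idm : forall X : obj, hom X X;
  comp : forall X Y Z : obj, hom Y Z -> hom X Y -> hom X Z;
  comp_idl : forall X Y (f : hom X Y), comp (idm Y) f = f;
  comp_idr : forall X Y (f : hom X Y), comp f (idm X) = f;
  comp_assoc : forall X Y Z W (h : hom Z W) (g : hom Y Z) (f : hom X Y),
    comp h (comp g f) = comp (comp h g) f;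
  comp_addl : forall X Y Z (g h : hom Y Z) (f : hom X Y),
    comp (g + h) f = comp g f + comp h f;
  comp_addr : forall X Y Z (g : hom Y Z) (f h : hom X Y),
    comp g (f + h) = comp g f + comp g h }.

Arguments hom {p} X Y.
Arguments idm {p} X.
Arguments comp {p X Y Z} g f.

Section CategoryTheory.
Variable A : preaddCat.
Implicit Types X Y Z : A.

Definition is_iso X Y (f : hom X Y) :=
  exists g : hom Y X, comp g f = idm X /\ comp f g = idm Y.

Definition mono X Y (f : hom X Y) :=
  forall W (u v : hom W X), comp f u = comp f v -> u = v.

Definition epi X Y (f : hom X Y) :=
  forall W (u v : hom Y W), comp u f = comp v f -> u = v.

Definition is_kernel X Y K (f : hom X Y) (k : hom K X) :=
  comp f k = 0 /\
  forall W (w : hom W X), comp f w = 0 -> exists! u : hom W K, comp k u = w.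

Definition is_cokernel X Y C (f : hom X Y) (c : hom Y C) :=
  comp c f = 0 /\
  forall W (w : hom Y W), comp w f = 0 -> exists! u : hom C W, comp u c = w.

Definition is_zero_object Z :=
  forall X, (forall f : hom X Z, f = 0) /\ (forall f : hom Z X, f = 0).

Definition is_biproduct X Y B (iX : hom X B) (iY : hom Y B)
    (pX : hom B X) (pY : hom B Y) :=
  [/\ comp pX iX = idm X, comp pY iY = idm Y,
      comp pX iY = 0, comp pY iX = 0
    & comp iX pX + comp iY pY = idm B].

Definition is_product (I : Type) (X : I -> A) P (p : forall i, hom P (X i)) :=
  forall W (w : forall i, hom W (X i)),
    exists! u : hom W P, forall i, comp (p i) u = w i.

Definition short_exact X Y Z (f : hom X Y) (g : hom Y Z) :=
  is_kernel g f /\ is_cokernel f g.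

Definition abelian :=
  [/\ exists Z, is_zero_object Z,
      forall X Y, exists B (iX : hom X B) (iY : hom Y B)
        (pX : hom B X) (pY : hom B Y), is_biproduct iX iY pX pY,
      forall X Y (f : hom X Y),
        (exists K (k : hom K X), is_kernel f k) /\
        (exists C (c : hom Y C), is_cokernel f c),
      forall X Y (f : hom X Y), mono f ->
        exists Z (g : hom Y Z), is_kernel g f
    & forall X Y (f : hom X Y), epi f ->
        exists Z (g : hom Z X), is_cokernel g f].

(* Ext^1 is Yoneda's: classes of extensions 0 -> Y -> E -> X -> 0. *)
Record extension X Y := Extension {
  ext_mid : A;
  ext_in : hom Y ext_mid;
  ext_out : hom ext_mid X;
  ext_exact : short_exact ext_in ext_out }.

(* Such an [h] is an isomorphism by the five lemma. *)
Definition ext_equiv X Y (e e' : extension X Y) :=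
  exists h : hom (ext_mid e) (ext_mid e'),
    comp h (ext_in e) = ext_in e' /\ comp (ext_out e') h = ext_out e.

(* Ext^1(X, Y) = 0: there is only one class, that of the split extension. *)
Definition Ext1_eq0 X Y := forall e e' : extension X Y, ext_equiv e e'.

Definition Hom_eq0 X Y := forall f : hom X Y, f = 0.

Section FullSubcategory.
Variable P : A -> Prop.

Definition closed_under_kernels :=
  forall X Y K (f : hom X Y) (k : hom K X),
    P X -> P Y -> is_kernel f k -> P K.

Definition closed_under_cokernels :=
  forall X Y C (f : hom X Y) (c : hom Y C),
    P X -> P Y -> is_cokernel f c -> P C.

Definition closed_under_extensions :=
  forall X Y Z (f : hom X Y) (g : hom Y Z),
    P X -> P Z -> short_exact f g -> P Y.

Definition closed_under_products :=
  forall (I : Type) (X : I -> A) Y (p : forall i, hom Y (X i)),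
    (forall i, P (X i)) -> is_product p -> P Y.

Definition full_subcat : preaddCat :=
  @PreaddCat {X : A | P X} (fun U V => hom (sval U) (sval V))
    (fun U => idm (sval U)) (fun U V W g f => comp g f)
    (fun U V f => comp_idl f) (fun U V f => comp_idr f)
    (fun U V W T h g f => comp_assoc h g f)
    (fun U V W g h f => comp_addl g h f) (fun U V W g f h => comp_addr g f h).

End FullSubcategory.
End CategoryTheory.

Record functor (A B : preaddCat) := Functor {
  fobj :> A -> B;
  fmap : forall X Y : A, hom X Y -> hom (fobj X) (fobj Y);
  fmap_id : forall X : A, fmap (idm X) = idm (fobj X);
  fmap_comp : forall (X Y Z : A) (g : hom Y Z) (f : hom X Y),
    fmap (comp g f) = comp (fmap g) (fmap f) }.

Arguments fmap {A B} f0 {X Y} f.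

Definition id_functor (A : preaddCat) : functor A A :=
  @Functor A A id (fun X Y f => f) (fun X => erefl) (fun X Y Z g f => erefl).

Section FunctorTheory.
Variables A B C : preaddCat.

Program Definition comp_functor (G : functor B C) (F : functor A B) :
    functor A C :=
  @Functor A C (fun X => G (F X)) (fun X Y f => fmap G (fmap F f)) _ _.
Next Obligation. by rewrite !fmap_id. Qed.
Next Obligation. by rewrite !fmap_comp. Qed.

Definition nat_iso (F G : functor A B) :=
  exists eta : forall X : A, hom (F X) (G X),
    (forall (X Y : A) (f : hom X Y),
       comp (fmap G f) (eta X) = comp (eta Y) (fmap F f)) /\
    (forall X : A, is_iso (eta X)).

Definition exact_functor (F : functor A B) :=
  (forall (X Y : A) (f g : hom X Y), fmap F (f + g) = fmap F f + fmap F g) /\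
  (forall (X Y Z : A) (f : hom X Y) (g : hom Y Z),
     short_exact f g -> short_exact (fmap F f) (fmap F g)).

Definition embedding (P : A -> Prop) : functor (full_subcat P) A :=
  @Functor (full_subcat P) A sval (fun X Y f => f)
    (fun X => erefl) (fun X Y Z g f => erefl).

Definition corestrict (F : functor A B) (P : B -> Prop)
    (PF : forall X, P (F X)) : functor A (full_subcat P) :=
  @Functor A (full_subcat P) (fun X => exist P (F X) (PF X))
    (fun X Y f => fmap F f) (fun X => fmap_id F X)
    (fun X Y Z g f => fmap_comp F g f).

End FunctorTheory.

Definition is_equivalence (A B : preaddCat) (F : functor A B) :=
  exists G : functor B A,
    nat_iso (comp_functor G F) (id_functor A) /\
    nat_iso (comp_functor F G) (id_functor B).

Definition dprod (I : Type) (T : I -> Type) := forall i, T i.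

Section DprodZmodule.
Variables (I : Type) (V : I -> zmodType).
Implicit Types f g h : dprod V.

HB.instance Definition _ := gen_eqMixin (dprod V).
HB.instance Definition _ := gen_choiceMixin (dprod V).

Let add f g : dprod V := fun i => f i + g i.
Let opp f : dprod V := fun i => - f i.
Let zero : dprod V := fun i => 0.

Fact dprod_addA : associative add.
Proof. by move=> f g h; apply: functional_extensionality_dep => i; exact: addrA. Qed.
Fact dprod_addC : commutative add.
Proof. by move=> f g; apply: functional_extensionality_dep => i; exact: addrC. Qed.
Fact dprod_add0 : left_id zero add.
Proof. by move=> f; apply: functional_extensionality_dep => i; exact: add0r. Qed.
Fact dprod_addN : left_inverse zero opp add.
Proof. by move=> f; apply: functional_extensionality_dep => i; exact: addNr. Qed.

HB.instance Definition _ :=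
  GRing.isZmodule.Build (dprod V) dprod_addA dprod_addC dprod_add0 dprod_addN.
End DprodZmodule.

Section DprodLmodule.
Variables (R : pzRingType) (I : Type) (V : I -> lmodType R).

HB.instance Definition _ := GRing.Zmodule.on (dprod V).

Let scale (a : R) (f : dprod V) : dprod V := fun i => a *: f i.

Fact dprod_scaleA a b f : scale a (scale b f) = scale (a * b) f.
Proof. by apply: functional_extensionality_dep => i; exact: scalerA. Qed.
Fact dprod_scale1 : left_id 1 scale.
Proof. by move=> f; apply: functional_extensionality_dep => i; exact: scale1r. Qed.
Fact dprod_scaleDr : right_distributive scale +%R.
Proof. by move=> a f g; apply: functional_extensionality_dep => i; exact: scalerDr. Qed.
Fact dprod_scaleDl f : {morph scale^~ f : a b / a + b}.
Proof. by move=> a b; apply: functional_extensionality_dep => i; exact: scalerDl. Qed.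

HB.instance Definition _ := GRing.Zmodule_isLmodule.Build R (dprod V)
  dprod_scaleA dprod_scale1 dprod_scaleDr dprod_scaleDl.
End DprodLmodule.

Section ProductCategory.
Variables (I : Type) (A : I -> preaddCat).
Implicit Types X Y Z W : forall i, A i.

Definition prod_hom X Y : zmodType := dprod (fun i => hom (X i) (Y i)).
Definition prod_idm X : prod_hom X X := fun i => idm (X i).
Definition prod_comp X Y Z (g : prod_hom Y Z) (f : prod_hom X Y) :
  prod_hom X Z := fun i => comp (g i) (f i).

Fact prod_comp_idl X Y (f : prod_hom X Y) : prod_comp (prod_idm Y) f = f.
Proof. by apply: functional_extensionality_dep => i; exact: comp_idl. Qed.
Fact prod_comp_idr X Y (f : prod_hom X Y) : prod_comp f (prod_idm X) = f.
Proof. by apply: functional_extensionality_dep => i; exact: comp_idr. Qed.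
Fact prod_comp_assoc X Y Z W (h : prod_hom Z W) (g : prod_hom Y Z)
    (f : prod_hom X Y) :
  prod_comp h (prod_comp g f) = prod_comp (prod_comp h g) f.
Proof. by apply: functional_extensionality_dep => i; exact: comp_assoc. Qed.
Fact prod_comp_addl X Y Z (g h : prod_hom Y Z) (f : prod_hom X Y) :
  prod_comp (g + h) f = prod_comp g f + prod_comp h f.
Proof. by apply: functional_extensionality_dep => i; exact: comp_addl. Qed.
Fact prod_comp_addr X Y Z (g : prod_hom Y Z) (f h : prod_hom X Y) :
  prod_comp g (f + h) = prod_comp g f + prod_comp g h.
Proof. by apply: functional_extensionality_dep => i; exact: comp_addr. Qed.

Definition prod_cat : preaddCat :=
  PreaddCat prod_comp_idl prod_comp_idr prod_comp_assoc
    prod_comp_addl prod_comp_addr.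
End ProductCategory.

Section LinearMaps.
Variables (R : comPzRingType) (U V : lmodType R).

Definition linmap := {linear U -> V}.
Implicit Types f g h : linmap.

HB.instance Definition _ := gen_eqMixin linmap.
HB.instance Definition _ := gen_choiceMixin linmap.

Lemma linmapP f g : f =1 g -> f = g.
Proof.
case: f g => [f [[fD] [fZ]]] [g [[gD] [gZ]]] /= /funext fg.
case: _ / fg in gD gZ *.
by rewrite (Prop_irrelevance gD fD) (Prop_irrelevance gZ fZ).
Qed.

Let add f g : linmap := f \+ g.
Let opp f : linmap := \- f.
Let zero : linmap := \0.

Fact linmap_addA : associative add.
Proof. by move=> f g h; apply: linmapP => x; exact: addrA. Qed.
Fact linmap_addC : commutative add.
Proof. by move=> f g; apply: linmapP => x; exact: addrC. Qed.
Fact linmap_add0 : left_id zero add.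
Proof. by move=> f; apply: linmapP => x; exact: add0r. Qed.
Fact linmap_addN : left_inverse zero opp add.
Proof. by move=> f; apply: linmapP => x; exact: addNr. Qed.

HB.instance Definition _ :=
  GRing.isZmodule.Build linmap linmap_addA linmap_addC linmap_add0 linmap_addN.
End LinearMaps.

Section ModuleCategory.
Variable R : comPzRingType.
Implicit Types U V W T : lmodType R.

Fact Mod_idl U V (f : linmap U V) : (idfun \o f : linmap U V) = f.
Proof. exact: linmapP. Qed.
Fact Mod_idr U V (f : linmap U V) : (f \o idfun : linmap U V) = f.
Proof. exact: linmapP. Qed.
Fact Mod_assoc U V W T (h : linmap W T) (g : linmap V W) (f : linmap U V) :
  (h \o (g \o f) : linmap U T) = (h \o g) \o f :> linmap U T.
Proof. exact: linmapP. Qed.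
Fact Mod_addl U V W (g h : linmap V W) (f : linmap U V) :
  ((g + h : linmap V W) \o f : linmap U W) =
  (g \o f : linmap U W) + (h \o f : linmap U W).
Proof. exact: linmapP. Qed.
Fact Mod_addr U V W (g : linmap V W) (f h : linmap U V) :
  (g \o (f + h : linmap U V) : linmap U W) =
  (g \o f : linmap U W) + (g \o h : linmap U W).
Proof. by apply: linmapP => x; exact: (linearD g). Qed.

Definition Mod : preaddCat :=
  @PreaddCat (lmodType R) (fun U V => linmap U V)
    (fun U => idfun : linmap U U) (fun U V W g f => g \o f : linmap U W)
    Mod_idl Mod_idr Mod_assoc Mod_addl Mod_addr.

Section DprodMap.
Variables (I : Type) (U V : I -> lmodType R) (f : forall i, linmap (U i) (V i)).
Definition dprod_map (x : dprod U) : dprod V := fun i => f i (x i).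
Fact dprod_map_linear : linear dprod_map.
Proof. by move=> a x y; apply: functional_extensionality_dep => i; exact: linearP. Qed.
HB.instance Definition _ :=
  GRing.isLinear.Build R (dprod U) (dprod V) *:%R dprod_map dprod_map_linear.
End DprodMap.

Program Definition product_functor (I : Type) (P : I -> Mod -> Prop) :
    functor (prod_cat (fun i => full_subcat (P i))) Mod :=
  @Functor _ Mod (fun C => dprod (fun i => sval (C i)))
    (fun C D f => dprod_map f : linmap _ _) _ _.
Next Obligation. by apply: linmapP. Qed.
Next Obligation. by apply: linmapP. Qed.

End ModuleCategory.

Section TensorProduct.
Variables (R : comPzRingType) (U V : lmodType R).

Definition bilin (W : lmodType R) (b : U -> V -> W) :=
  (forall x, linear (b x)) /\ (forall y, linear (b^~ y)).

Definition sum_bilin (W : lmodType R) (b : U -> V -> W) (s : seq (U * V)) :=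
  \sum_(p <- s) b p.1 p.2.

(* A sequence [:: (x1, y1); ...; (xn, yn)] stands for the tensor
   x1 (x) y1 + ... + xn (x) yn; two of them represent the same tensor when no
   bilinear map tells them apart. That this is the tensor product is the
   universal property [tensor_univ] below. *)
Definition tensor_rel (s t : seq (U * V)) : bool :=
  `[< forall (W : lmodType R) (b : U -> V -> W),
        bilin b -> sum_bilin b s = sum_bilin b t >].

Fact tensor_rel_refl : reflexive tensor_rel.
Proof. by move=> s; apply/asboolP. Qed.
Fact tensor_rel_sym : symmetric tensor_rel.
Proof.
by move=> s t; apply/asboolP/asboolP => st W b bb; rewrite (st W b bb).
Qed.
Fact tensor_rel_trans : transitive tensor_rel.
Proof.
move=> s t u /asboolP ts /asboolP su; apply/asboolP => W b bb.
by rewrite (ts W b bb) (su W b bb).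
Qed.

Canonical tensor_equiv :=
  EquivRel tensor_rel tensor_rel_refl tensor_rel_sym tensor_rel_trans.

Definition tensor := {eq_quot tensor_equiv}.
HB.instance Definition _ := Choice.on tensor.
HB.instance Definition _ := EqQuotient.on tensor.

Definition tens (x : U) (y : V) : tensor := \pi_tensor [:: (x, y)].

Lemma tensor_eqP (s t : seq (U * V)) :
  (forall (W : lmodType R) (b : U -> V -> W),
     bilin b -> sum_bilin b s = sum_bilin b t) <->
  \pi_tensor s = \pi_tensor t.
Proof. by split => [st|/eqmodP/asboolP//]; apply/eqmodP/asboolP. Qed.

Lemma sum_bilin_repr (W : lmodType R) (b : U -> V -> W) s :
  bilin b -> sum_bilin b (repr (\pi_tensor s)) = sum_bilin b s.
Proof. by move: W b; apply/tensor_eqP; rewrite reprK. Qed.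

Definition scale_seq (a : R) (s : seq (U * V)) := [seq (a *: p.1, p.2) | p <- s].

Lemma sum_bilin_cat (W : lmodType R) (b : U -> V -> W) s t :
  sum_bilin b (s ++ t) = sum_bilin b s + sum_bilin b t.
Proof. exact: big_cat. Qed.

Lemma bilinZl (W : lmodType R) (b : U -> V -> W) a x y :
  bilin b -> b (a *: x) y = a *: b x y.
Proof.
case=> _ /(_ y) L; have b0 : b 0 y = 0.
  by have := L (-1) 0 0; rewrite !scaleN1r oppr0 addr0 addNr.
by have := L a x 0; rewrite b0 !addr0.
Qed.

Lemma sum_bilin_scale (W : lmodType R) (b : U -> V -> W) a s :
  bilin b -> sum_bilin b (scale_seq a s) = a *: sum_bilin b s.
Proof.
move=> bb; rewrite /sum_bilin big_map scaler_sumr.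
by apply: eq_bigr => p _; exact: bilinZl.
Qed.

Let add (t u : tensor) : tensor := \pi_tensor (repr t ++ repr u).
Let scale (a : R) (t : tensor) : tensor := \pi_tensor (scale_seq a (repr t)).
Let opp (t : tensor) : tensor := scale (- 1) t.
Let zero : tensor := \pi_tensor [::].

Ltac tens_simpl bb :=
  rewrite ?sum_bilin_cat
    ?(sum_bilin_repr _ bb, sum_bilin_cat, sum_bilin_scale _ _ bb).

Fact tensor_addA : associative add.
Proof.
by move=> t u v; apply/tensor_eqP => W b bb; tens_simpl bb; exact: addrA.
Qed.
Fact tensor_addC : commutative add.
Proof.
by move=> t u; apply/tensor_eqP => W b bb; tens_simpl bb; exact: addrC.
Qed.
Fact tensor_add0 : left_id zero add.
Proof.
move=> t; rewrite -[RHS]reprK; apply/tensor_eqP => W b bb; tens_simpl bb.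
by rewrite /sum_bilin big_nil add0r.
Qed.
Fact tensor_addN : left_inverse zero opp add.
Proof.
move=> t; apply/tensor_eqP => W b bb; tens_simpl bb.
by rewrite scaleN1r addNr /sum_bilin big_nil.
Qed.

HB.instance Definition _ :=
  GRing.isZmodule.Build tensor tensor_addA tensor_addC tensor_add0 tensor_addN.

Fact tensor_scaleA a a' t : scale a (scale a' t) = scale (a * a') t.
Proof.
by apply/tensor_eqP => W b bb; tens_simpl bb; exact: scalerA.
Qed.
Fact tensor_scale1 : left_id 1 scale.
Proof.
move=> t; rewrite -[RHS]reprK; apply/tensor_eqP => W b bb; tens_simpl bb.
exact: scale1r.
Qed.
Fact tensor_scaleDr : right_distributive scale +%R.
Proof.
by move=> a t u; apply/tensor_eqP => W b bb; tens_simpl bb; exact: scalerDr.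
Qed.
Fact tensor_scaleDl t : {morph scale^~ t : a a' / a + a'}.
Proof.
by move=> a a'; apply/tensor_eqP => W b bb; tens_simpl bb; exact: scalerDl.
Qed.

HB.instance Definition _ := GRing.Zmodule_isLmodule.Build R tensor
  tensor_scaleA tensor_scale1 tensor_scaleDr tensor_scaleDl.

Definition tensor_lift (W : lmodType R) (b : U -> V -> W) (t : tensor) : W :=
  sum_bilin b (repr t).

Lemma tens_bilin : bilin tens.
Proof.
split=> [x a y y' | y a x x']; apply/tensor_eqP => W b bb; tens_simpl bb.
  by rewrite /sum_bilin !big_seq1 /=; case: bb => /(_ x) ->.
by rewrite /sum_bilin !big_seq1 /=; case: bb => _ /(_ y) ->.
Qed.

Lemma tensor_lift_linear (W : lmodType R) (b : U -> V -> W) :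
  bilin b -> linear (tensor_lift b).
Proof.
by move=> bb a t u; rewrite /tensor_lift; tens_simpl bb.
Qed.

Lemma tensor_liftE (W : lmodType R) (b : U -> V -> W) x y :
  bilin b -> tensor_lift b (tens x y) = b x y.
Proof.
by move=> bb; rewrite /tensor_lift sum_bilin_repr // /sum_bilin big_seq1.
Qed.

Lemma tensor_sum (t : tensor) : t = \sum_(p <- repr t) tens p.1 p.2.
Proof.
rewrite -[LHS]reprK; elim: (repr t) => [|[x y] s IHs]; first by rewrite big_nil.
rewrite big_cons -IHs; apply/tensor_eqP => W b bb; tens_simpl bb.
by rewrite /sum_bilin big_cons big_seq1.
Qed.

Theorem tensor_univ (W : lmodType R) (b : U -> V -> W) : bilin b ->
  exists! f : linmap tensor W, forall x y, f (tens x y) = b x y.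
Proof.
move=> bb; pose fL := GRing.isLinear.Build R tensor W *:%R (tensor_lift b)
  (tensor_lift_linear bb).
pose f : {linear tensor -> W} := HB.pack (tensor_lift b) fL.
exists f; split=> [x y|g gb]; first exact: tensor_liftE.
apply: linmapP => t; rewrite (tensor_sum t) !linear_sum.
by apply: eq_bigr => p _; rewrite gb; exact: tensor_liftE.
Qed.

End TensorProduct.

Section Flat.
Variable R : comPzRingType.

Definition tensor_map (U V F : lmodType R) (f : linmap U V) :
    tensor U F -> tensor V F :=
  tensor_lift (fun x y => tens (f x) y).

Lemma tensor_map_bilin (U V F : lmodType R) (f : linmap U V) :
  bilin (fun (x : U) (y : F) => tens (f x) y).
Proof.
have [tr tl] := tens_bilin V F; split=> [x|y] a z z'; first exact: tr.
by rewrite linearP; exact: tl.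
Qed.

Lemma tensor_map_linear (U V F : lmodType R) (f : linmap U V) :
  linear (tensor_map f : tensor U F -> tensor V F).
Proof. exact/tensor_lift_linear/tensor_map_bilin. Qed.

Lemma tensor_mapE (U V F : lmodType R) (f : linmap U V) x (y : F) :
  tensor_map f (tens x y) = tens (f x) y.
Proof. exact/tensor_liftE/tensor_map_bilin. Qed.

Definition flat (F : lmodType R) :=
  forall (U V : lmodType R) (f : linmap U V),
    injective f -> injective (tensor_map f : tensor U F -> tensor V F).

End Flat.

Section Localization.
Variables (R : comPzRingType) (s : R).

(* [loc s] is the R-module R[s^-1]; [(a, n)] stands for the fraction a / s^n. *)
Definition loc_rel (x y : R * nat) : bool :=
  `[< exists k, s ^+ k * (s ^+ y.2 * x.1) = s ^+ k * (s ^+ x.2 * y.1) >].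

Fact loc_rel_refl : reflexive loc_rel.
Proof. by move=> x; apply/asboolP; exists 0%N. Qed.
Fact loc_rel_sym : symmetric loc_rel.
Proof. by move=> x y; apply/asboolP/asboolP => -[k E]; exists k. Qed.
Fact loc_rel_trans : transitive loc_rel.
Proof.
move=> [b m] [a n] [c p] /asboolP[k /= E] /asboolP[l /= E'].
apply/asboolP; exists (k + l + m)%N => /=.
transitivity (s ^+ l * s ^+ p * (s ^+ k * (s ^+ m * a))).
  by rewrite !exprD !mulrA; congr (_ * _); rewrite mulrC [in RHS]mulrC !mulrA;
     rewrite -!exprD; congr (s ^+ _); lia.
rewrite E.
transitivity (s ^+ k * s ^+ n * (s ^+ l * (s ^+ p * b))).
  by rewrite !mulrA -!exprD; congr (s ^+ _ * _); lia.
rewrite E' !mulrA -!exprD; congr (s ^+ _ * _); lia.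
Qed.

Canonical loc_equiv := EquivRel loc_rel loc_rel_refl loc_rel_sym loc_rel_trans.

Definition loc := {eq_quot loc_equiv}.
HB.instance Definition _ := Choice.on loc.
HB.instance Definition _ := EqQuotient.on loc.

Definition frac (a : R) (n : nat) : loc := \pi_loc (a, n).

Lemma frac_eqP a n b m :
  (exists k, s ^+ k * (s ^+ m * a) = s ^+ k * (s ^+ n * b)) <->
  frac a n = frac b m.
Proof. by split => [E|/eqmodP/asboolP//]; apply/eqmodP/asboolP. Qed.

Lemma fracP (x : loc) : exists a n, x = frac a n.
Proof. by exists (repr x).1, (repr x).2; rewrite /frac -surjective_pairing reprK. Qed.

Let add (x y : loc) : loc :=
  frac (s ^+ (repr y).2 * (repr x).1 + s ^+ (repr x).2 * (repr y).1)
       ((repr x).2 + (repr y).2).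
Let scale (r : R) (x : loc) : loc := frac (r * (repr x).1) (repr x).2.
Let opp (x : loc) : loc := scale (- 1) x.
Let zero : loc := frac 0 0.

Let repr_frac a n : exists k, s ^+ k * (s ^+ n * (repr (frac a n)).1) =
  s ^+ k * (s ^+ (repr (frac a n)).2 * a).
Proof.
by apply/frac_eqP; rewrite /frac -surjective_pairing reprK.
Qed.

Let addE a n b m :
  add (frac a n) (frac b m) = frac (s ^+ m * a + s ^+ n * b) (n + m).
Proof.
have [k] := repr_frac a n; have [l] := repr_frac b m; rewrite /add.
case: (repr (frac a n)) => a' n' /=; case: (repr (frac b m)) => b' m' /= E' E.
apply/frac_eqP; exists (k + l)%N; rewrite !exprD.
transitivity (s ^+ l * s ^+ m * s ^+ m' * (s ^+ k * (s ^+ n * a')) +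
  s ^+ k * s ^+ n * s ^+ n' * (s ^+ l * (s ^+ m * b'))); first by ring.
by rewrite E E'; ring.
Qed.

Let scaleE r a n : scale r (frac a n) = frac (r * a) n.
Proof.
have [k] := repr_frac a n; rewrite /scale.
case: (repr (frac a n)) => a' n' /= E; apply/frac_eqP; exists k.
transitivity (r * (s ^+ k * (s ^+ n * a'))); first by ring.
by rewrite E; ring.
Qed.

Fact loc_addA : associative add.
Proof.
move=> x y z; have [a [n ->]] := fracP x; have [b [m ->]] := fracP y.
have [c [p ->]] := fracP z; rewrite !addE; apply/frac_eqP; exists 0%N.
by rewrite !exprD; ring.
Qed.
Fact loc_addC : commutative add.
Proof.
move=> x y; have [a [n ->]] := fracP x; have [b [m ->]] := fracP y.
by rewrite !addE addnC addrC.
Qed.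
Fact loc_add0 : left_id zero add.
Proof.
by move=> x; have [a [n ->]] := fracP x; rewrite !addE mulr0 add0r mul1r.
Qed.
Fact loc_addN : left_inverse zero opp add.
Proof.
move=> x; have [a [n ->]] := fracP x; rewrite /opp scaleE !addE.
by rewrite -mulrDr mulN1r addNr; apply/frac_eqP; exists 0%N; rewrite !mulr0.
Qed.

HB.instance Definition _ :=
  GRing.isZmodule.Build loc loc_addA loc_addC loc_add0 loc_addN.

Fact loc_scaleA r r' x : scale r (scale r' x) = scale (r * r') x.
Proof. by have [a [n ->]] := fracP x; rewrite !scaleE mulrA. Qed.
Fact loc_scale1 : left_id 1 scale.
Proof. by move=> x; have [a [n ->]] := fracP x; rewrite !scaleE mul1r. Qed.
Fact loc_scaleDr : right_distributive scale +%R.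
Proof.
move=> r x y; have [a [n ->]] := fracP x; have [b [m ->]] := fracP y.
transitivity (scale r (add (frac a n) (frac b m))) => //.
rewrite addE !scaleE; transitivity (add (frac (r * a) n) (frac (r * b) m)) => //.
by rewrite addE; congr frac; ring.
Qed.
Fact loc_scaleDl x : {morph scale^~ x : r r' / r + r'}.
Proof.
have [a [n ->]] := fracP x => r r'; rewrite !scaleE.
transitivity (add (frac (r * a) n) (frac (r' * a) n)) => //.
by rewrite addE; apply/frac_eqP; exists 0%N; rewrite exprD; ring.
Qed.

HB.instance Definition _ := GRing.Zmodule_isLmodule.Build R loc
  loc_scaleA loc_scale1 loc_scaleDr loc_scaleDl.

Lemma frac_add a n b m :
  frac a n + frac b m = frac (s ^+ m * a + s ^+ n * b) (n + m).
Proof. exact: addE. Qed.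

Lemma frac_scale r a n : r *: frac a n = frac (r * a) n.
Proof. exact: scaleE. Qed.

End Localization.

Section Spectrum.
Variable R : comPzRingType.

Definition submodule (M : lmodType R) (B : set M) :=
  [/\ B 0, forall x y, B x -> B y -> B (x + y) & forall a x, B x -> B (a *: x)].

Definition ideal (I : set R) := submodule (I : set R^o).

Definition proper_ideal (I : set R) := ideal I /\ ~ I 1.

Definition prime_ideal (p : set R) :=
  proper_ideal p /\ forall a b, p (a * b) -> p a \/ p b.

Definition minimal_prime (p : set R) :=
  prime_ideal p /\ forall q, prime_ideal q -> q `<=` p -> q = p.

Definition maximal_ideal (m : set R) :=
  proper_ideal m /\ forall I, proper_ideal I -> m `<=` I -> I = m.

Definition noetherian :=
  forall I : set R, ideal I -> exists g : seq R,
    I = [set x | exists c : nat -> R, x = \sum_(i < size g) c i * g`_i].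

(* There is no chain p_0 < p_1 < ... < p_(n+1) of prime ideals. *)
Definition krull_dim_le (n : nat) :=
  ~ exists p : nat -> set R,
      (forall i, (i <= n.+1)%N -> prime_ideal (p i)) /\
      (forall i, (i <= n)%N -> p i `<` p i.+1).

Definition spec_decomposition (P0 P1 : set (set R)) :=
  [/\ [set p | prime_ideal p] = P0 `|` P1, P0 `&` P1 = set0,
      P0 `<=` [set p | minimal_prime p] & P1 `<=` [set p | maximal_ideal p]].

Definition mult_subset (P0 : set (set R)) : set R :=
  ~` \bigcup_(q in P0) q.

End Spectrum.

Section ModuleClasses.
Variable R : comPzRingType.

Definition cotorsion (C : Mod R) :=
  forall F : Mod R, flat F -> Ext1_eq0 F C.

Definition S_divisible (S : set R) (M : lmodType R) (B : set M) :=
  forall s, S s -> [set s *: x | x in B] = B.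

Definition S_reduced (S : set R) (C : Mod R) :=
  forall B : set C, submodule B -> S_divisible S B -> B = [set 0].

Definition S_reduced_cotorsion (S : set R) (C : Mod R) :=
  S_reduced S C /\ cotorsion C.

Definition s_contramodule (s : R) (C : Mod R) :=
  Hom_eq0 (loc s : Mod R) C /\ Ext1_eq0 (loc s : Mod R) C.

Definition I_contramodule (I : set R) (C : Mod R) :=
  forall s, I s -> s_contramodule s C.

End ModuleClasses.

(* Main.v *)
(** An R-module C is an s-contramodule iff every system c_n - s c_(n+1) = a_n has
    a unique solution in C. In a cotorsion module all these systems are solvable,
    because R[s^-1] is flat; hence a quotient C/B of a cotorsion module is an
    s-contramodule as soon as it has no nonzero sequence c_n = s c_(n+1), and for
    each ideal m there is a smallest B, denoted by [core m], such that C/B is an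
    m-contramodule. If C is S-reduced cotorsion, consider the map from C to the
    product of the C/core m over the m in P1. Its kernel is S-divisible, hence zero.
    On its cokernel Z all elements of S act bijectively, so that every z in Z gives
    a map from T = S^-1 R to Z. As T is flat, this map lifts to the product, which
    is S-reduced; so it is zero, and C is the product of the C/core m.

    Conversely, let C be an m-contramodule and F flat. Some s in S and m satisfies
    y m^a <= s R with y not in m, so y acts bijectively on C. Lift a basis of F/mF
    to F. By flatness the lift is independent up to elements that are infinitely
    divisible by s/y, and its span has a cokernel on which s/y is bijective up to
    powers of y. Neither of them maps to C or extends C nontrivially; therefore
    Ext^1(F, C) = 0.

    Finally, linear maps between products of m-contramodules are diagonal, which
    reduces the closure properties of C_R to those of m-contramodules. *)

From HB Require Import structures.
From mathcomp Require Import all_boot all_algebra generic_quotient.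
From mathcomp Require Import ring.
From mathcomp Require Import boolp classical_sets.
From Stdlib Require List.
Require Import Defs.

Set Implicit Arguments.
Unset Strict Implicit.
Unset Printing Implicit Defensive.

Import GRing.Theory.
Local Open Scope classical_set_scope.
Local Open Scope ring_scope.
Local Open Scope quotient_scope.

(** * Modules and exact sequences *)

(** Quotients are rarely formed: [divset], [separated] and [core] are taken relative to a submodule
    B, and solvability of the systems over C passes to C/B for free. A solution of c_n - s c_(n+1) =
    a_n replaces the infinite sum of the s^j a_j, so geometric series are available without a
    topology.

    The set P1 may be infinite, but an element s of S lies in only finitely many of its members; on
    the components at the others s is invertible. Arguments on the product therefore fix some s and
    use the Chinese remainder theorem on a finite list of ideals.

    In the cotorsion part the obstacle is that s may be a zero divisor and that y is invertible on C
    but not on F. Replacing s by a power makes the annihilators of s and s^2 equal, and the stronger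
    bound y m^a <= s^2 R lets a relation between basis elements be divided by s/y and remain a
    relation. Other divisions by s cost powers of y, which are harmless once the argument has
    reached C. *)

Section LinearRelations.
Variable R : comPzRingType.
Implicit Types U V : lmodType R.

Lemma linmap_of_linear U V (f : U -> V) :
  linear f -> exists g : linmap U V, forall x, g x = f x.
Proof.
move=> fL; pose m := GRing.isLinear.Build R U V *:%R f fL.
by exists (HB.pack f m : {linear U -> V}).
Qed.

Lemma subr_swap (U : zmodType) (a b c d : U) : a - b - (c - d) = a - c - (b - d).
Proof. by rewrite !opprB addrACA [RHS]addrACA (addrC (- b)). Qed.

Lemma linmapZ U V (f : linmap U V) a x : f (a *: x) = a *: f x.
Proof. exact: linearZ. Qed.

Lemma linmapB U V (f : linmap U V) x y : f (x - y) = f x - f y.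
Proof. exact: linearB. Qed.

(** Many linear maps below are given by their graph. As the graph is closed under linear
    combinations, single-valuedness only has to be checked at 0. *)
Lemma linmap_of_rel U V (G : U -> V -> Prop) :
  (forall x, exists y, G x y) -> (forall y, G 0 y -> y = 0) ->
  (forall a x x' y y', G x y -> G x' y' -> G (a *: x + x') (a *: y + y')) ->
  exists f : linmap U V, forall x y, G x y <-> f x = y.
Proof.
move=> tot fun0 lin; have [f fG] := choice tot.
have G_inj x y y' : G x y -> G x y' -> y = y'.
  move=> Gy Gy'; have := lin (-1) _ _ _ _ Gy Gy'.
  by rewrite !scaleN1r addNr => /fun0 /eqP; rewrite addrC subr_eq0 => /eqP.
have [a x y|g gE] := @linmap_of_linear U V f.
  by apply: G_inj (fG _) _; apply: lin.
exists g => x y; rewrite gE; split=> [|<-] //; exact: G_inj (fG x).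
Qed.

Lemma submodule0 U (B : set U) : submodule B -> B 0.
Proof. by case. Qed.

Lemma submoduleD U (B : set U) x y : submodule B -> B x -> B y -> B (x + y).
Proof. by case=> _ BD _; apply: BD. Qed.

Lemma submoduleZ U (B : set U) a x : submodule B -> B x -> B (a *: x).
Proof. by case=> _ _ BZ; apply: BZ. Qed.

Lemma submoduleN U (B : set U) x : submodule B -> B x -> B (- x).
Proof. by move=> sB Bx; rewrite -scaleN1r; apply: submoduleZ. Qed.

Lemma submoduleB U (B : set U) x y : submodule B -> B x -> B y -> B (x - y).
Proof. by move=> sB Bx By; apply: submoduleD => //; apply: submoduleN. Qed.

Lemma submodule_subr U (B : set U) x y :
  submodule B -> B (x - y) -> B x <-> B y.
Proof.
move=> sB Bxy; split=> [Bx|By]; last by rewrite -(subrK y x); apply: submoduleD.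
by rewrite -[y](subKr x); apply: submoduleB.
Qed.

Lemma submodule_sum U (B : set U) (I : eqType) (s : seq I) (F : I -> U) :
  submodule B -> (forall i, i \in s -> B (F i)) -> B (\sum_(i <- s) F i).
Proof.
move=> sB BF; rewrite big_seq; elim/big_ind: _ => //; first exact: submodule0.
by move=> x y; apply: submoduleD.
Qed.

Lemma submodule_preim U V (f : linmap U V) (B : set V) :
  submodule B -> submodule [set x | B (f x)].
Proof.
move=> sB; split=> [|x y Bx By|a x Bx] /=.
- by rewrite linear0; exact: submodule0.
- by rewrite linearD; exact: submoduleD.
- by rewrite linearZ; exact: submoduleZ.
Qed.

Lemma submodule_range U V (f : linmap U V) : submodule [set y | exists x, f x = y].
Proof.
split=> [|_ _ [x <-] [y <-]|a _ [x <-]].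
- by exists 0; rewrite linear0.
- by exists (x + y); rewrite linearD.
- by exists (a *: x); rewrite linearZ.
Qed.

Lemma submodule_image U V (f : linmap U V) (B : set U) :
  submodule B -> submodule [set f x | x in B].
Proof.
move=> sB; split=> [|_ _ [x Bx <-] [y By <-]|a _ [x Bx <-]].
- by exists 0; rewrite ?linear0 //; exact: submodule0.
- by exists (x + y); rewrite ?linearD //; exact: submoduleD.
- by exists (a *: x); rewrite ?linearZ //; exact: submoduleZ.
Qed.

Lemma submodule_set0 U : submodule ([set 0] : set U).
Proof.
split=> //= [x y -> ->|a x ->]; first by rewrite addr0.
by rewrite scaler0.
Qed.

End LinearRelations.

Section Quotient.
Variables (R : comPzRingType) (M : lmodType R) (B : set M) (sB : submodule B).

Definition quot_rel (x y : M) : bool := `[< B (x - y) >].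

Fact quot_rel_refl : reflexive quot_rel.
Proof. by move=> x; apply/asboolP; rewrite subrr; exact: submodule0. Qed.
Fact quot_rel_sym : symmetric quot_rel.
Proof.
by move=> x y; apply/asboolP/asboolP => ?; rewrite -opprB; apply: submoduleN.
Qed.
Fact quot_rel_trans : transitive quot_rel.
Proof.
move=> y x z /asboolP xy /asboolP yz; apply/asboolP.
by rewrite -(subrKA y); apply: submoduleD.
Qed.

Canonical quot_equiv :=
  EquivRel quot_rel quot_rel_refl quot_rel_sym quot_rel_trans.

Definition quot_mod := {eq_quot quot_equiv}.
HB.instance Definition _ := Choice.on quot_mod.
HB.instance Definition _ := EqQuotient.on quot_mod.

Definition quot_pi (x : M) : quot_mod := \pi_quot_mod x.

Lemma quot_piP x y : quot_pi x = quot_pi y <-> B (x - y).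
Proof. by split=> [/eqmodP/asboolP|?] //; apply/eqmodP/asboolP. Qed.

Lemma quot_reprK z : quot_pi (repr z) = z.
Proof. exact: reprK. Qed.

Let add (x y : quot_mod) : quot_mod := quot_pi (repr x + repr y).
Let opp (x : quot_mod) : quot_mod := quot_pi (- repr x).
Let scale a (x : quot_mod) : quot_mod := quot_pi (a *: repr x).

Let B_repr x : B (repr (quot_pi x) - x).
Proof. by apply/quot_piP; rewrite quot_reprK. Qed.

Let addE x y : add (quot_pi x) (quot_pi y) = quot_pi (x + y).
Proof. by apply/quot_piP; rewrite opprD addrACA; apply: submoduleD. Qed.
Let oppE x : opp (quot_pi x) = quot_pi (- x).
Proof. by apply/quot_piP; rewrite -opprD; apply: submoduleN. Qed.
Let scaleE a x : scale a (quot_pi x) = quot_pi (a *: x).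
Proof. by apply/quot_piP; rewrite -scalerBr; apply: submoduleZ. Qed.

Fact quot_addA : associative add.
Proof.
by move=> x y z; rewrite -(quot_reprK x) -(quot_reprK y) -(quot_reprK z) !addE addrA.
Qed.
Fact quot_addC : commutative add.
Proof. by move=> x y; rewrite -(quot_reprK x) -(quot_reprK y) !addE addrC. Qed.
Fact quot_add0 : left_id (quot_pi 0) add.
Proof. by move=> x; rewrite -(quot_reprK x) addE add0r. Qed.
Fact quot_addN : left_inverse (quot_pi 0) opp add.
Proof. by move=> x; rewrite -(quot_reprK x) oppE addE addNr. Qed.

HB.instance Definition _ :=
  GRing.isZmodule.Build quot_mod quot_addA quot_addC quot_add0 quot_addN.

Fact quot_scaleA a b x : scale a (scale b x) = scale (a * b) x.
Proof. by rewrite -(quot_reprK x) !scaleE scalerA. Qed.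
Fact quot_scale1 : left_id 1 scale.
Proof. by move=> x; rewrite -(quot_reprK x) scaleE scale1r. Qed.
Fact quot_scaleDr : right_distributive scale +%R.
Proof.
move=> a x y.
transitivity (scale a (add (quot_pi (repr x)) (quot_pi (repr y)))).
  by rewrite !quot_reprK.
rewrite addE scaleE scalerDr -addE -!scaleE !quot_reprK //.
Qed.
Fact quot_scaleDl x : {morph scale^~ x : a b / a + b}.
Proof.
move=> a b; rewrite -[x in LHS]quot_reprK scaleE scalerDl -addE -!scaleE.
by rewrite quot_reprK.
Qed.

HB.instance Definition _ := GRing.Zmodule_isLmodule.Build R quot_mod
  quot_scaleA quot_scale1 quot_scaleDr quot_scaleDl.

Lemma quotient_ex : exists (Q : lmodType R) (p : linmap M Q),
  (forall z, exists x, p x = z) /\ (forall x, p x = 0 <-> B x).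
Proof.
have [a x y|p pE] := @linmap_of_linear R M quot_mod quot_pi.
  transitivity (add (scale a (quot_pi x)) (quot_pi y)) => //.
  by rewrite scaleE addE.
exists quot_mod, p; split=> [z|x]; first by exists (repr z); rewrite pE quot_reprK.
by rewrite pE -[X in B X]subr0; apply: quot_piP.
Qed.

Definition sub_mod := {x : M | B x}.
HB.instance Definition _ := gen_eqMixin sub_mod.
HB.instance Definition _ := gen_choiceMixin sub_mod.

Let sadd (x y : sub_mod) : sub_mod :=
  exist _ _ (submoduleD sB (proj2_sig x) (proj2_sig y)).
Let sopp (x : sub_mod) : sub_mod := exist _ _ (submoduleN sB (proj2_sig x)).
Let szero : sub_mod := exist _ _ (submodule0 sB).
Let sscale a (x : sub_mod) : sub_mod :=
  exist _ _ (submoduleZ a sB (proj2_sig x)).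

Let sub_inj (x y : sub_mod) : sval x = sval y -> x = y.
Proof. by case: x y => [x Bx] [y By] /= xy; exact: eq_exist. Qed.

Fact sub_addA : associative sadd.
Proof. by move=> x y z; apply: sub_inj; rewrite /= addrA. Qed.
Fact sub_addC : commutative sadd.
Proof. by move=> x y; apply: sub_inj; rewrite /= addrC. Qed.
Fact sub_add0 : left_id szero sadd.
Proof. by move=> x; apply: sub_inj; rewrite /= add0r. Qed.
Fact sub_addN : left_inverse szero sopp sadd.
Proof. by move=> x; apply: sub_inj; rewrite /= addNr. Qed.

HB.instance Definition _ :=
  GRing.isZmodule.Build sub_mod sub_addA sub_addC sub_add0 sub_addN.

Fact sub_scaleA a b x : sscale a (sscale b x) = sscale (a * b) x.
Proof. by apply: sub_inj; rewrite /= scalerA. Qed.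
Fact sub_scale1 : left_id 1 sscale.
Proof. by move=> x; apply: sub_inj; rewrite /= scale1r. Qed.
Fact sub_scaleDr : right_distributive sscale +%R.
Proof. by move=> a x y; apply: sub_inj; rewrite /= scalerDr. Qed.
Fact sub_scaleDl x : {morph sscale^~ x : a b / a + b}.
Proof. by move=> a b; apply: sub_inj; rewrite /= scalerDl. Qed.

HB.instance Definition _ := GRing.Zmodule_isLmodule.Build R sub_mod
  sub_scaleA sub_scale1 sub_scaleDr sub_scaleDl.

Lemma submodule_ex : exists (K : lmodType R) (i : linmap K M),
  injective i /\ (forall x, B x <-> exists y, i y = x).
Proof.
have [//|i iE] := @linmap_of_linear R sub_mod M sval.
exists sub_mod, i; split=> [x y|x]; first by rewrite !iE => /sub_inj.
split=> [Bx|[y <-]]; first by exists (exist _ x Bx); rewrite iE.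
by rewrite iE; exact: proj2_sig.
Qed.

End Quotient.

Section Exactness.
Variable R : comPzRingType.
Implicit Types X Y Z C F : lmodType R.

Definition surjective X Y (f : X -> Y) := forall y, exists x, f x = y.

Definition exact_at X Y Z (f : X -> Y) (g : Y -> Z) :=
  forall y, g y = 0 <-> exists x, f x = y.

Lemma lin_inj X Y (f : linmap X Y) : (forall x, f x = 0 -> x = 0) -> injective f.
Proof.
move=> f0 x y fxy; apply/eqP; rewrite -subr_eq0; apply/eqP/f0.
by rewrite linearB fxy subrr.
Qed.

Lemma linear_inverse X Y (f : linmap X Y) : injective f -> surjective f ->
  exists g : linmap Y X, cancel f g /\ cancel g f.
Proof.
move=> fI fS; have [|y|a x x' y y' <- <-|g gP] :=
    @linmap_of_rel _ Y X (fun y x => f x = y).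
- exact: fS.
- by rewrite -[X in _ = X](linear0 f) => /fI.
- by rewrite linearP.
by exists g; split=> x; [apply/gP | apply/gP].
Qed.

Lemma lift_inj X Y Z (k : linmap X Y) (h : linmap Z Y) : injective k ->
  (forall z, exists x, k x = h z) -> exists g : linmap Z X, forall z, k (g z) = h z.
Proof.
move=> kI kS; have [|x|a z z' x x' E E'|g gP] :=
    @linmap_of_rel _ Z X (fun z x => h z = k x).
- by move=> z; have [x <-] := kS z; exists x.
- by rewrite linear0 -[0 in LHS](linear0 k) => /kI ->.
- by rewrite !linearP E E'.
by exists g => z; apply/esym/gP.
Qed.

Lemma lift_surj X Y Z (c : linmap X Y) (h : linmap X Z) : surjective c ->
  (forall x, c x = 0 -> h x = 0) -> exists g : linmap Y Z, forall x, g (c x) = h x.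
Proof.
move=> cS c0; have [|z [x [/c0 ->]] //|a y y' z z' [x [<- <-]] [x' [<- <-]]|g gP] :=
    @linmap_of_rel _ Y Z (fun y z => exists x, c x = y /\ h x = z).
- by move=> y; have [x <-] := cS y; exists (h x), x.
- by exists (a *: x + x'); rewrite !linearP.
by exists g => x; apply/gP; exists x.
Qed.

(** Elements of X are the maps from the free module R, so [R^o] is the test object that turns
    categorical universal properties into statements about elements. *)
Lemma linmap_point X (x : X) : exists f : linmap (R^o : lmodType R) X, forall r, f r = r *: x.
Proof.
apply: (@linmap_of_linear _ (R^o : lmodType R) X (fun r => r *: x)) => a r s.
by rewrite scalerDl scalerA.
Qed.

Lemma linmapE X Y (f g : linmap X Y) : f = g :> @hom (Mod R) X Y -> f =1 g.
Proof. by move=> ->. Qed.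

Lemma Mod_is_kernel X Y K (f : linmap X Y) (k : linmap K X) :
  @is_kernel (Mod R) X Y K f k <-> injective k /\ exact_at k f.
Proof.
split=> [[fk kU]|[kI kE]].
  split=> [|x].
    apply: lin_inj => x kx0; have [h hE] := linmap_point x.
    have [|u [_ uU]] := kU (R^o : Mod R) (0 : linmap _ _).
      by apply: linmapP => r; exact: linear0.
    have uh : u = h.
      by apply: uU; apply: linmapP => r; rewrite /= hE linearZ /= kx0 scaler0.
    have u0 : u = (0 : linmap _ _).
      by apply: uU; apply: linmapP => r; rewrite /= linear0.
    by rewrite -[x]scale1r -hE -uh u0.
  split=> [fx0|[y <-]]; last by have := linmapE fk y.
  have [h hE] := linmap_point x.
  have [|u [uE _]] := kU (R^o : Mod R) h.
    by apply: linmapP => r; rewrite /= hE linearZ /= fx0 scaler0.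
  exists (u 1); have := linmapE uE 1.
  by rewrite /= hE scale1r.
split=> [|W w fw].
  by apply: linmapP => x; apply/kE; exists x.
have [z|g gE] := lift_inj (h := w) kI.
  by apply/kE; have := linmapE fw z.
exists g; split=> [|g' g'E]; first exact: linmapP.
apply: linmapP => z; apply: kI; rewrite gE.
by have := linmapE g'E z.
Qed.

Lemma Mod_is_cokernel X Y C (f : linmap X Y) c :
  @is_cokernel (Mod R) X Y C f c <-> surjective c /\ exact_at f c.
Proof.
split=> [[cf cU]|[cS cE]].
  split=> [z|y].
    (* The projection onto the quotient by the image of [c] and the zero map both vanish on that
       image, so the uniqueness of factorizations makes them equal. *)
    have [Q [p [pS p0]]] := quotient_ex (submodule_range c).
    have [|u [_ uU]] := cU Q (0 : linmap _ _); first exact: linmapP.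
    have up : u = p.
      by apply: uU; apply: linmapP => y; apply/p0; exists y.
    have u0 : u = (0 : linmap _ _) by apply: uU; apply: linmapP.
    by apply/p0; rewrite -up u0.
  split=> [cy0|[x <-]]; last by have := linmapE cf x.
  have [Q [p [pS p0]]] := quotient_ex (submodule_range f).
  have [|u [uE _]] := cU Q p.
    by apply: linmapP => x; apply/p0; exists x.
  apply/p0; have := linmapE uE y.
  by rewrite /= cy0 linear0.
split=> [|W w wf].
  by apply: linmapP => x; apply/cE; exists x.
have [y /cE [x <-]|g gE] := lift_surj (h := w) cS.
  by have := linmapE wf x.
exists g; split=> [|g' g'E]; first exact: linmapP.
apply: linmapP => z; have [y <-] := cS z; rewrite gE.
by have := linmapE g'E y.
Qed.

Lemma Mod_short_exact X Y Z (f : linmap X Y) (g : linmap Y Z) :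
  @short_exact (Mod R) X Y Z f g <-> [/\ injective f, surjective g & exact_at f g].
Proof.
split=> [[/Mod_is_kernel[fI fg] /Mod_is_cokernel[gS _]] //|[fI gS fg]].
by split; [apply/Mod_is_kernel | apply/Mod_is_cokernel].
Qed.

(** Splitting is expressed by a retraction onto C instead of a section over F because the later
    constructions produce maps into C. *)
Definition ext_split F C := forall (E : lmodType R) (i : linmap C E) (p : linmap E F),
  injective i -> surjective p -> exact_at i p ->
  exists r : linmap E C, forall c, r (i c) = c.

(** Comparison with the direct sum gives the retraction. Conversely, a retraction and the projection
    are coordinates on each middle term, and the map between two extensions relates the points that
    have the same two coordinates. *)
Lemma Ext1_eq0P F C : @Ext1_eq0 (Mod R) F C <-> ext_split F C.
Proof.
split=> [FC E i p iI pS ip|FC e e'].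
  have eE : @short_exact (Mod R) C E F i p by apply/Mod_short_exact.
  pose D : lmodType R := (C * F)%type.
  have [a x y|j jE] := @linmap_of_linear R C D (fun c => (c, 0)).
    by congr pair; rewrite /= scaler0 addr0.
  have [a x y|q qE] // := @linmap_of_linear R D F snd.
  have [a x y|r rE] // := @linmap_of_linear R D C fst.
  have dE : @short_exact (Mod R) C D F j q.
    apply/Mod_short_exact; split=> [x y|y|[c y]].
    - by rewrite !jE => -[].
    - by exists (0, y); rewrite qE.
    - by rewrite qE /=; split=> [->|[x]]; [exists c | rewrite jE => -[]].
  have [h [hE _]] := FC (Extension eE) (Extension dE).
  exists (r \o (h : linmap E D) : linmap E C) => c /=.
  have := linmapE hE c; rewrite /= => ->.
  by rewrite jE rE.
case: e e' => [E i p eE] [E' i' p' eE'].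
have [iI pS ip] := proj1 (Mod_short_exact _ _) eE.
have [iI' pS' ip'] := proj1 (Mod_short_exact _ _) eE'.
have [r rE] := FC E i p iI pS ip; have [r' rE'] := FC E' i' p' iI' pS' ip'.
have [x|z [r'z p'z]|a x x' z z' [rz pz] [rz' pz']|h hE] :=
    @linmap_of_rel R E E' (fun x z => r' z = r x /\ p' z = p x).
- have [z pz] := pS' (p x); exists (z + i' (r x - r' z)).
  split; first by rewrite linearD rE' addrC subrK.
  by rewrite linearD (proj2 (ip' (i' _))) ?addr0 //; eexists.
- move: p'z; rewrite linear0 => /ip' [c zE].
  by move: r'z; rewrite linear0 -zE rE' => ->; rewrite linear0.
- by rewrite !linearP rz rz' pz pz'.
exists h; split; apply: linmapP => x /=.
  apply/hE; rewrite rE' rE; split=> //.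
  by transitivity (0 : F); [apply/ip'; exists x | apply/esym/ip; exists x].
by have [] := proj2 (hE x (h x)) erefl.
Qed.

(** This is the surjectivity of Hom(B, C) -> Hom(A, C) in the long exact sequence. The pushout E of
    [a] and [f] is an extension of F by C; its retraction, restricted to B, extends [f]. *)
Lemma ext_split_extend F C (A B : lmodType R) (a : linmap A B) (q : linmap B F)
    (f : linmap A C) : ext_split F C ->
  injective a -> surjective q -> exact_at a q ->
  exists g : linmap B C, forall x, g (a x) = f x.
Proof.
move=> FC aI qS aq; pose D : lmodType R := (C * B)%type.
have [s x y|j jE] := @linmap_of_linear R A D (fun x => (f x, - a x)).
  by rewrite !linearP; congr pair; rewrite /= opprD scalerN.
have [E [p [pS p0]]] := quotient_ex (submodule_range j).
have pE x : p (f x, 0) = p (0, a x).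
  apply/eqP; rewrite -subr_eq0 -linearB; apply/eqP/p0; exists x; rewrite jE.
  by congr pair; rewrite /= ?subr0 ?sub0r.
have [s x y|i iE] := @linmap_of_linear R C E (fun c => p (c, 0)).
  by rewrite -linearP; congr (p (_, _)); rewrite /= scaler0 addr0.
have [s x y|k kE] := @linmap_of_linear R B E (fun b => p (0, b)).
  by rewrite -linearP; congr (p (_, _)); rewrite /= scaler0 addr0.
have [s x y|q' q'E] := @linmap_of_linear R D F (fun d => q d.2).
  by rewrite /= linearP.
have [d /p0 [x <-]|u uE] := lift_surj (h := q') pS.
  by rewrite q'E jE /= linearN (proj2 (aq _)) ?oppr0 //; exists x.
have [c||e|r rE] := FC E i u.
- move=> c' /eqP; rewrite !iE -subr_eq0 -linearB => /eqP /p0 [x].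
  rewrite jE => -[fx /eqP]; rewrite subr0 oppr_eq0 => /eqP.
  move=> ax0; have x0 : x = 0 by apply: aI; rewrite linear0.
  by apply/eqP; rewrite -subr_eq0 -fx x0 linear0.
- by move=> z; have [b <-] := qS z; exists (k b); rewrite kE uE q'E.
- have [[c b] <-] := pS e; rewrite uE q'E /=; split=> [/aq [x bE]|[c' ]].
    exists (c + f x); rewrite iE -bE.
    have -> : (c, a x) = (c, 0) + (0, a x) :> D by congr pair; rewrite /= ?addr0 ?add0r.
    rewrite linearD -pE -linearD.
    by congr (p (_, _)); rewrite /= addr0.
  by rewrite iE => /(congr1 u); rewrite !uE !q'E /= linear0.
exists (r \o k : linmap B C) => x /=.
by rewrite kE -pE -iE rE.
Qed.

Lemma ext_split_iso F C C' (h : linmap C C') : injective h -> surjective h ->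
  ext_split F C -> ext_split F C'.
Proof.
move=> hI hS FC E i p iI pS ip; have [g [hK gK]] := linear_inverse hI hS.
have [r rE] := ext_split_extend g FC iI pS ip.
by exists (h \o r : linmap E C') => c /=; rewrite rE gK.
Qed.

(** Exactness of Ext^1(F, X) -> Ext^1(F, Y) -> Ext^1(F, Z), by hand: [g] extends to a map g' on E,
    and the kernel K of g' is an extension of F by X, so it has a retraction [r] onto X. *)
Lemma ext_split_ext F (X Y Z : lmodType R) (f : linmap X Y) (g : linmap Y Z) :
  injective f -> surjective g -> exact_at f g ->
  ext_split F X -> ext_split F Z -> ext_split F Y.
Proof.
move=> fI gS fg FX FZ E i p iI pS ip.
have [g' g'E] := ext_split_extend g FZ iI pS ip.
have sK : submodule [set e | g' e = 0].
  exact: (submodule_preim g' (submodule_set0 _)).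
have [K [k [kI kE]]] := submodule_ex sK.
have [x|j jE] := lift_inj (h := i \o f : linmap X E) kI.
  by apply/kE; rewrite /= g'E; apply/fg; exists x.
have [x y|z|e|r rE] := FX K j (p \o k : linmap K F).
- by move/(congr1 k); rewrite !jE => /iI /fI.
- have [e <-] := pS z; have [y gy] := gS (g' e).
  have [w wE] : exists w, k w = e - i y.
    by apply/kE; rewrite /= linearB g'E gy subrr.
  exists w; rewrite /= wE linearB [X in _ - X](proj2 (ip _)) ?subr0 //.
  by exists y.
- rewrite /=; split=> [/ip [y ye]|[x <-]]; last first.
    by rewrite jE; apply/ip; exists (f x).
  have : g' (k e) = 0 by apply/kE; exists e.
  rewrite -ye g'E => /fg [x xy]; exists x; apply: kI; rewrite jE /= xy.
  exact: ye.
(* E is the sum of K and Y, which meet in X, so [r] on K and the identity on Y glue to a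
   retraction. *)
have [e|z|a e e' z z'|h hE] := @linmap_of_rel R E Y
  (fun e z => exists w y, e = k w + i y /\ z = f (r w) + y).
- have [y gy] := gS (g' e).
  have [w wE] : exists w, k w = e - i y.
    by apply/kE; rewrite /= linearB g'E gy subrr.
  by exists (f (r w) + y), w, y; rewrite wE subrK.
- case=> w [y [/esym/eqP]]; rewrite addr_eq0 => /eqP kw ->.
  have : g' (k w) = 0 by apply/kE; exists w.
  rewrite kw linearN g'E => /eqP; rewrite oppr_eq0 => /eqP /fg [x xy].
  have -> : w = j (- x) by apply: kI; rewrite jE /= !linearN xy.
  by rewrite rE -xy linearN addNr.
- case=> w [y [-> ->]] [w' [y' [-> ->]]]; exists (a *: w + w'), (a *: y + y').
  by rewrite !linearP !scalerDr !addrA; split; rewrite -!addrA; congr (_ + _);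
    rewrite addrCA.
exists h => y; apply/hE; exists 0, y.
by rewrite !linear0 !add0r.
Qed.

End Exactness.

(** * Contramodules over one element *)

Section Telescope.
Variable R : comPzRingType.
Implicit Types (s u v : R) (C E M : lmodType R).

(* Modulo B, this is the image of Hom(R[s^-1], C/B) in C/B. *)
Definition divset C s (B : set C) : set C :=
  [set x | exists c : nat -> C, c 0 = x /\ forall n, B (c n - s *: c n.+1)].

(** For a submodule B this is Hom(R[s^-1], C/B) = 0, since every term of a divisible sequence starts
    another one. *)
Definition separated C s (B : set C) := divset s B `<=` B.

(** Formally c_n is the sum of the s^j a_(n+j). Solvability supplies these sums; being separated
    modulo 0 makes them unique. *)
Definition solvable C s :=
  forall a : nat -> C, exists c : nat -> C, forall n, c n - s *: c n.+1 = a n.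

Lemma telescope_expand C s (c : nat -> C) n k :
  (forall n, c n = s *: c n.+1) -> c n = s ^+ k *: c (n + k)%N.
Proof.
move=> cE; elim: k => [|k ->]; first by rewrite addn0 scale1r.
by rewrite addnS cE scalerA exprSr.
Qed.

(** R[s^-1] is the colimit of R -> R -> ... under multiplication by s, and 1/s^n is the generator of
    the n-th copy. *)
Lemma loc_lift s E (e : nat -> E) : (forall n, e n = s *: e n.+1) ->
  exists f : linmap (loc s) E, forall n, f (frac s 1 n) = e n.
Proof.
move=> eE; have [x|y [a [n [/esym/frac_eqP [k Ek] ->]]]| b x x' y y'|f fP] :=
    @linmap_of_rel R (loc s) E (fun x y => exists a n, x = frac s a n /\ y = a *: e n).
- by have [a [n ->]] := fracP x; exists (a *: e n), a, n.
- rewrite (telescope_expand _ k eE) scalerA mulrC.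
  by move: Ek; rewrite expr0 mul1r !mulr0 => ->; rewrite scale0r.
- move=> [a [n [-> ->]]] [a' [n' [-> ->]]].
  exists (s ^+ n' * (b * a) + s ^+ n * a'), (n + n')%N.
  rewrite frac_scale frac_add; split=> //.
  rewrite scalerDl {1}(telescope_expand n n' eE) {1}(telescope_expand n' n eE).
  by rewrite !scalerA addnC; congr (_ *: _ + _ *: _); ring.
by exists f => n; apply/fP; exists 1, n; rewrite scale1r.
Qed.

Lemma sum_ord_extend C (x : nat -> C) n n' :
  (n <= n')%N -> (forall i, (n <= i)%N -> x i = 0) ->
  \sum_(i < n') x i = \sum_(i < n) x i.
Proof.
move=> nn' x0; rewrite -!(big_mkord xpredT x) (big_cat_nat_idem _ _ nn') //=;
  last exact: addr0.
by rewrite [X in _ + X]big_nat [X in _ + X]big1 ?addr0 // => i /andP[/x0].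
Qed.

Lemma free_nat_ex : exists (P : lmodType R) (e : nat -> P),
  [/\ forall (V : lmodType R) (a : nat -> V), exists f : linmap P V, forall n, f (e n) = a n,
      forall x, exists (c : nat -> R) n, x = \sum_(i < n) c i *: e i
    & forall (c : nat -> R) n, \sum_(i < n) c i *: e i = 0 ->
        forall i, (i < n)%N -> c i = 0].
Proof.
pose D : lmodType R := dprod (fun _ : nat => R^o : lmodType R).
pose fin (x : D) := exists n, forall i, (n <= i)%N -> x i = 0.
have sF : submodule fin.
  split=> [|x y [n xn] [m ym]|a x [n xn]]; first by exists 0%N.
    exists (maxn n m) => i; rewrite geq_max => /andP[/xn xi /ym yi].
    by transitivity (x i + y i) => //; rewrite xi yi addr0.
  by exists n => i /xn xi; transitivity (a * x i); rewrite // xi mulr0.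
have [P [k [kI kE]]] := submodule_ex sF.
pose d (n : nat) : D := fun i => (i == n)%:R.
have [n|e eE] := @choice _ _ (fun n x => k x = d n).
  apply/kE; exists n.+1 => i ni.
  by rewrite /d gtn_eqF.
have kD x y i : k (x + y) i = k x i + k y i by rewrite linearD.
have kZ a x i : k (a *: x) i = a * k x i by rewrite linearZ.
have sumE (c : nat -> R) n i :
    (k (\sum_(j < n) c j *: e j)) i = if (i < n)%N then c i else 0.
  elim: n => [|n IHn]; first by rewrite big_ord0 linear0.
  rewrite big_ord_recr kD IHn kZ eE /d /= [in RHS]ltnS [in RHS]leq_eqVlt.
  case: (eqVneq i n) => [->|ni] /=; first by rewrite ltnn add0r mulr1.
  by rewrite mulr0 addr0.
exists P, e; split=> [V a|x|c n c0 i i_n].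
- have [x|y|b x x' y y' [n [xn ->]] [m [ym ->]]|f fP] := @linmap_of_rel R P V
    (fun x y => exists n, (forall i, (n <= i)%N -> k x i = 0) /\
                          y = \sum_(i < n) k x i *: a i).
  + by have [n xn] := proj2 (kE (k x)) (ex_intro _ x erefl); eexists; exists n.
  + by case=> n [_ ->]; rewrite linear0; apply: big1 => i _; exact: scale0r.
  + exists (maxn n m); split=> [i|].
      rewrite geq_max => /andP[/xn xi /ym yi].
      by rewrite kD kZ xi yi mulr0 addr0.
    rewrite -(@sum_ord_extend _ (fun i => k x i *: a i) _ _ (leq_maxl n m)); last first.
      by move=> i /xn ->; rewrite scale0r.
    rewrite -(@sum_ord_extend _ (fun i => k x' i *: a i) _ _ (leq_maxr n m)); last first.
      by move=> i /ym ->; rewrite scale0r.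
    rewrite scaler_sumr -big_split; apply: eq_bigr => i _.
    by rewrite kD kZ scalerDl scalerA.
  exists f => n; apply/fP; exists n.+1; split=> [i ni|].
    by rewrite eE /d gtn_eqF.
  rewrite big_ord_recr /= eE /d eqxx scale1r big1 ?add0r // => i _.
  by rewrite ltn_eqF // scale0r.
- have [n xn] := proj2 (kE (k x)) (ex_intro _ x erefl).
  exists (k x), n; apply: kI; apply: functional_extensionality_dep => i.
  by rewrite sumE; case: ltnP => // /xn.
- have := sumE c n i; rewrite i_n => <-; by rewrite c0 linear0.
Qed.

(* The systems come from the presentation of R[s^-1] by the injective endomorphism
   e_n |-> e_n - s e_(n+1) of the free module on the e_n. *)
Lemma ext_split_solvable s C : ext_split (loc s) C -> solvable C s.
Proof.
move=> sC a; have [P [e [lift gen free]]] := free_nat_ex.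
have [d dE] := lift P (fun n => e n - s *: e n.+1).
have [q qE] := lift (loc s) (fun n => frac s 1 n).
have [f fE] := lift C a.
have dI : injective d.
  apply: lin_inj => x; have [c0 [n ->]] := gen x.
  (* Extended by zero, the coefficients of d x on n+1 basis elements are c_0 and the c_(i+1) - s
     c_i; their vanishing kills the c_i one after the other. *)
  pose c i := if (i < n)%N then c0 i else 0.
  have cE : \sum_(i < n) c0 i *: e i = \sum_(i < n) c i *: e i.
    by apply: eq_bigr => i _; rewrite /c ltn_ord.
  pose c' i := if i is j.+1 then c i - s * c j else c i.
  rewrite cE linear_sum => dx0.
  have c'0 i : (i < n.+1)%N -> c' i = 0.
    apply: free; rewrite -[RHS]dx0 => {dx0}.
    have -> : \sum_(j < n) d (c j *: e j) =
        \sum_(j < n) c j *: e j - \sum_(j < n) (s * c j) *: e j.+1.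
      rewrite -sumrB; apply: eq_bigr => j _.
      by rewrite linearZ /= dE scalerBr !scalerA (mulrC s).
    have -> : \sum_(j < n) c j *: e j = \sum_(j < n.+1) c j *: e j.
      by rewrite [RHS]big_ord_recr /= {3}/c ltnn scale0r addr0.
    rewrite [LHS]big_ord_recl [X in _ = X - _]big_ord_recl -addrA; congr (_ + _).
    by rewrite -sumrB; apply: eq_bigr => j _; rewrite scalerBl.
  have c_0 i : c i = 0.
    elim: i => [|i IHi]; first exact: (c'0 0%N).
    case: (ltnP i n) => i_n; last by rewrite /c ltnNge leqW.
    by have := c'0 i.+1 i_n; rewrite /= IHi mulr0 subr0.
  by apply: big1 => i _; rewrite c_0 scale0r.
have sI := submodule_range d.
have eI n k : [set y | exists x, d x = y] (e n - s ^+ k *: e (n + k)%N).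
  elim: k => [|k IHk]; first by rewrite addn0 scale1r subrr; exact: submodule0.
  rewrite -(subrKA (s ^+ k *: e (n + k)%N)); apply: submoduleD => //.
  rewrite exprSr -scalerA -scalerBr; apply: submoduleZ => //.
  by exists (e (n + k)%N); rewrite dE addnS.
have fracS n : frac s 1 n = s *: frac s 1 n.+1.
  by rewrite frac_scale mulr1; apply/frac_eqP; exists 0%N; rewrite exprS; ring.
have qd x : q (d x) = 0.
  have [c [n ->]] := gen x; rewrite !linear_sum; apply: big1 => i _.
  by rewrite !linearZ /= dE linearB linearZ /= !qE -fracS subrr scaler0.
have [||g gE] := ext_split_extend f sC dI (q := q).
- by move=> x; have [b [n ->]] := fracP x; exists (b *: e n);
    rewrite linearZ qE; rewrite /= frac_scale mulr1.
- move=> y; split; last first.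
    by case=> x <-.
  have [c [n ->]] := gen y => qy.
  (* Modulo the image of [d] one has e_i = s^(n-i) e_n, so y = r e_n. Its image r/s^n is zero, hence
     s^k r = 0 for some k, and r e_n = r s^k e_(n+k) = 0. *)
  pose r := \sum_(i < n) c i * s ^+ (n - i).
  have nI : [set y | exists x, d x = y] (\sum_(i < n) c i *: e i - r *: e n).
    rewrite /r scaler_suml -sumrB; apply: submodule_sum => // i _.
    rewrite -scalerA -scalerBr; apply: submoduleZ => //.
    by have := eI i (n - i)%N; rewrite subnKC // ltnW.
  have q0 z : [set y | exists x, d x = y] z -> q z = 0 by case=> x <-.
  have : frac s r n = frac s 0 0.
    transitivity (q (r *: e n)); first by rewrite linearZ qE /= frac_scale mulr1.
    by have := q0 _ nI; rewrite linearB qy sub0r => /eqP; rewrite oppr_eq0 => /eqP ->.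
  case/frac_eqP=> k; rewrite expr0 mul1r !mulr0 => rk.
  apply/(submodule_subr sI nI).
  have := submoduleZ r sI (eI n k).
  by rewrite scalerBr scalerA [r * _]mulrC rk scale0r subr0.
exists (fun n => g (e n)) => n.
by rewrite -linearZ -linearB -dE gE fE.
Qed.

Lemma s_contramoduleP s C :
  @s_contramodule R s C <-> separated s ([set 0] : set C) /\ solvable C s.
Proof.
split=> [[h0 /Ext1_eq0P /ext_split_solvable sC]|[C0 sC]].
  split=> // _ [c [<-]] cE; have [n|f fE] := @loc_lift s C c.
    by apply/eqP; rewrite -subr_eq0; apply/eqP/cE.
  by rewrite -fE; exact: linmapE (h0 f) _.
split.
  move=> f; apply: linmapP => x; have [a [n ->]] := fracP x.
  have fE k : f (frac s 1 k) = s *: f (frac s 1 k.+1).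
    rewrite -linearZ /= frac_scale mulr1; congr (f _).
    by apply/frac_eqP; exists 0%N; rewrite exprS; ring.
  have -> : frac s a n = a *: frac s 1 n by rewrite frac_scale mulr1.
  suff fn0 : f (frac s 1 n) = 0 by rewrite linearZ /= fn0 scaler0.
  apply: C0; exists (fun k => f (frac s 1 (n + k)%N)); split=> [|k].
    by rewrite addn0.
  by rewrite addnS {1}fE subrr.
apply/Ext1_eq0P => E i p iI pS ip.
(* Lifts of the 1/s^n to E are compatible up to errors a_n in C; a solution of the system for the
   a_n corrects them and yields a section [g]. *)
have [e eE] := choice (fun n => pS (frac s 1 n)).
have [n|a aE] := @choice _ _ (fun n x => i x = s *: e n.+1 - e n).
  apply/ip; rewrite linearB linearZ !eE /= frac_scale mulr1; apply/eqP.
  by rewrite subr_eq0; apply/eqP/frac_eqP; exists 0%N; rewrite exprS; ring.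
have [c cE] := sC a.
have [n|g gE] := @loc_lift s E (fun n => e n + i (c n)).
  have /(congr1 i) := cE n; rewrite linearB linearZ aE => /eqP.
  by rewrite subr_eq addrAC -scalerDr => /eqP ->; rewrite addrCA subrr addr0.
have pg x : p (g x) = x.
  have [a' [n ->]] := fracP x.
  have -> : frac s a' n = a' *: frac s 1 n by rewrite frac_scale mulr1.
  rewrite !linearZ gE linearD eE (proj2 (ip (i (c n)))) ?addr0 //.
  by exists (c n).
have [x|||r rE] := @linmap_of_rel R E C (fun x y => i y = x - g (p x)).
- by apply/ip; rewrite linearB pg subrr.
- by move=> y iy; apply: iI; rewrite iy !linear0 addr0.
- move=> b x x' y y' E1 E2.
  by rewrite (linearP i) E1 E2 (linearP p) (linearP g) opprD scalerBr addrACA.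
exists r => x; apply/rE; have -> : p (i x) = 0 by apply/ip; exists x.
by rewrite linear0 subr0.
Qed.

End Telescope.

(** * Localizations and flatness *)

Section Localize.
Variables (R : comPzRingType) (W : set R) (V : lmodType R).

Definition mult_closed := W 1 /\ forall a b, W a -> W b -> W (a * b).

Hypothesis mW : mult_closed.

Definition denom := {w : R | W w}.
HB.instance Definition _ := gen_eqMixin denom.
HB.instance Definition _ := gen_choiceMixin denom.

Let dmul (x y : denom) : denom :=
  exist _ _ (proj2 mW _ _ (proj2_sig x) (proj2_sig y)).

Definition frac_rel (x y : V * denom) : bool :=
  `[< exists k, W k /\ k *: (sval y.2 *: x.1) = k *: (sval x.2 *: y.1) >].

Fact frac_rel_refl : reflexive frac_rel.
Proof. by move=> x; apply/asboolP; exists 1; split=> //; exact: (proj1 mW). Qed.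
Fact frac_rel_sym : symmetric frac_rel.
Proof. by move=> x y; apply/asboolP/asboolP => -[k [Wk E]]; exists k. Qed.
Fact frac_rel_trans : transitive frac_rel.
Proof.
move=> [v [w Ww]] [v' [w' Ww']] [v'' [w'' Ww'']] /asboolP[k [Wk /= E]] /asboolP[l [Wl /= E']].
apply/asboolP; exists (k * l * w); split; first by do 2!apply: (proj2 mW) => //.
move: E E'; rewrite /= !scalerA => E E'.
have -> : k * l * w * w'' = l * w'' * (k * w) by ring.
rewrite -scalerA E scalerA.
have -> : l * w'' * (k * w') = k * w' * (l * w'') by ring.
rewrite -scalerA E' scalerA.
by congr (_ *: _); ring.
Qed.

Canonical frac_equiv :=
  EquivRel frac_rel frac_rel_refl frac_rel_sym frac_rel_trans.

Definition localized := {eq_quot frac_equiv}.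
HB.instance Definition _ := Choice.on localized.
HB.instance Definition _ := EqQuotient.on localized.

Let fr (v : V) (w : denom) : localized := \pi_localized (v, w).

Let frP v w v' w' : fr v w = fr v' w' <->
  exists k, W k /\ k *: (sval w' *: v) = k *: (sval w *: v').
Proof. by split=> [/eqmodP/asboolP|?] //; apply/eqmodP/asboolP. Qed.

Let frW x : exists v w, x = fr v w.
Proof. by exists (repr x).1, (repr x).2; rewrite /fr -surjective_pairing reprK. Qed.

Let add (x y : localized) : localized :=
  fr (sval (repr y).2 *: (repr x).1 + sval (repr x).2 *: (repr y).1)
     (dmul (repr x).2 (repr y).2).
Let scale r (x : localized) : localized := fr (r *: (repr x).1) (repr x).2.
Let one_ : denom := exist _ _ (proj1 mW).

Let repr_fr v w : exists k, W k /\
  k *: (sval w *: (repr (fr v w)).1) = k *: (sval (repr (fr v w)).2 *: v).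
Proof. by apply/frP; rewrite /fr -surjective_pairing reprK. Qed.

Let addE v w v' w' : add (fr v w) (fr v' w') =
  fr (sval w' *: v + sval w *: v') (dmul w w').
Proof.
have [k [Wk]] := repr_fr v w; have [l [Wl]] := repr_fr v' w'; rewrite /add.
case: (repr (fr v w)) => u [d Wd] /=; case: (repr (fr v' w')) => u' [d' Wd'] /= E' E.
apply/frP; exists (k * l); split; first exact: (proj2 mW).
case: w E => w Ww /= E; case: w' E' => w' Ww' /= E'.
move: E E'; rewrite !scalerA => E E'; rewrite !scalerDr !scalerA; congr (_ + _).
  have -> : k * l * (w * w') * d' = l * w' * d' * (k * w) by ring.
  by rewrite -scalerA E scalerA; congr (_ *: _); ring.
have -> : k * l * (w * w') * d = k * w * d * (l * w') by ring.
by rewrite -scalerA E' scalerA; congr (_ *: _); ring.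
Qed.

Let scaleE r v w : scale r (fr v w) = fr (r *: v) w.
Proof.
have [k [Wk]] := repr_fr v w; rewrite /scale.
case: (repr (fr v w)) => u d /=; rewrite !scalerA => E.
apply/frP; exists k; split=> //; rewrite !scalerA.
have -> : k * sval w * r = r * (k * sval w) by ring.
by rewrite -(scalerA r) E scalerA; congr (_ *: _); ring.
Qed.

Fact localized_addA : associative add.
Proof.
move=> x y z; have [v [w ->]] := frW x; have [v' [w' ->]] := frW y.
have [v'' [w'' ->]] := frW z; rewrite !addE; apply/frP; exists 1.
split; first exact: (proj1 mW).
rewrite /= !scalerDr !scalerA -!addrA.
by congr (_ *: _ + (_ *: _ + _ *: _)); ring.
Qed.
Fact localized_addC : commutative add.
Proof.
move=> x y; have [v [w ->]] := frW x; have [v' [w' ->]] := frW y.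
rewrite !addE addrC; congr (fr _ _); apply: eq_exist => /=; exact: mulrC.
Qed.
Fact localized_add0 : left_id (fr 0 one_) add.
Proof.
move=> x; have [v [[w Ww] ->]] := frW x; rewrite addE scaler0 add0r scale1r.
by congr (fr _ _); apply: eq_exist; rewrite /= mul1r.
Qed.
Fact localized_addN : left_inverse (fr 0 one_) (scale (-1)) add.
Proof.
move=> x; have [v [w ->]] := frW x; rewrite scaleE addE -scalerDr scaleN1r addNr.
apply/frP; exists 1; split; first exact: (proj1 mW).
by rewrite !scaler0.
Qed.

HB.instance Definition _ := GRing.isZmodule.Build localized
  localized_addA localized_addC localized_add0 localized_addN.

Fact localized_scaleA a b x : scale a (scale b x) = scale (a * b) x.
Proof. by have [v [w ->]] := frW x; rewrite !scaleE scalerA. Qed.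
Fact localized_scale1 : left_id 1 scale.
Proof. by move=> x; have [v [w ->]] := frW x; rewrite scaleE scale1r. Qed.
Fact localized_scaleDr : right_distributive scale +%R.
Proof.
move=> a x y; have [v [w ->]] := frW x; have [v' [w' ->]] := frW y.
transitivity (scale a (add (fr v w) (fr v' w'))) => //.
transitivity (add (scale a (fr v w)) (scale a (fr v' w'))) => //.
rewrite addE !scaleE addE; congr (fr _ _); rewrite scalerDr !scalerA.
by congr (_ *: _ + _ *: _); ring.
Qed.
Fact localized_scaleDl x : {morph scale^~ x : a b / a + b}.
Proof.
have [v [w ->]] := frW x => a b; rewrite !scaleE.
transitivity (add (fr (a *: v) w) (fr (b *: v) w)) => //.
rewrite addE; apply/frP; exists 1; split; first exact: (proj1 mW).
by rewrite /= -!scalerDr !scalerA -scalerDl !scalerA; congr (_ *: _); ring.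
Qed.

HB.instance Definition _ := GRing.Zmodule_isLmodule.Build R localized
  localized_scaleA localized_scale1 localized_scaleDr localized_scaleDl.

(** [q] takes any element of R as denominator, with arbitrary values outside [W], so that fractions
    are handled without membership proofs in their arguments. *)
Definition is_localization (L : lmodType R) (q : V -> R -> L) :=
  [/\ forall x, exists v w, W w /\ x = q v w,
      forall v w v' w', W w -> W w' ->
        (q v w = q v' w' <-> exists k, W k /\ k *: (w' *: v) = k *: (w *: v')),
      forall v w v' w', W w -> W w' ->
        q v w + q v' w' = q (w' *: v + w *: v') (w * w')
    & forall r v w, W w -> r *: q v w = q (r *: v) w].

Lemma localization_ex : exists L q, @is_localization L q.
Proof.
pose q v w := if pselect (W w) is left h then fr v (exist _ w h) else fr v one_.
have qE v w (Ww : W w) : q v w = fr v (exist _ w Ww).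
  by rewrite /q; case: pselect => // h; rewrite (Prop_irrelevance h Ww).
exists localized, q; split=> [x|v w v' w' Ww Ww'|v w v' w' Ww Ww'|r v w Ww].
- have [v [[w Ww] ->]] := frW x; exists v, w; split=> //; by rewrite qE.
- by rewrite !qE; apply: frP.
- rewrite !qE; first exact: (proj2 mW).
  move=> Www; transitivity (fr (w' *: v + w *: v') (dmul (exist _ w Ww) (exist _ w' Ww'))).
    exact: addE.
  by congr (fr _ _); apply: eq_exist.
- by rewrite !qE; apply: scaleE.
Qed.

Lemma localization_lift (L X : lmodType R) (q : V -> R -> L) (g : V -> R -> X) :
  is_localization q ->
  (forall a v v' w, W w -> g (a *: v + v') w = a *: g v w + g v' w) ->
  (forall k v w, W k -> W w -> g (k *: v) (k * w) = g v w) ->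
  exists f : linmap L X, forall v w, W w -> f (q v w) = g v w.
Proof.
move=> [qS qE qD qZ] gL gC; have [W1 WM] := mW.
have g0 w : W w -> g 0 w = 0.
  by move=> Ww; have := gL (-1) 0 0 w Ww; rewrite !scaleN1r oppr0 addr0 addNr.
have [x|y|a x x' y y'|f fP] := @linmap_of_rel R L X
  (fun x y => exists v w, [/\ W w, x = q v w & y = g v w]).
- by have [v [w [Ww ->]]] := qS x; exists (g v w), v, w.
- case=> v [w [Ww v0 ->]].
  have z0 : q 0 1 = 0 by rewrite -(scale0r (q 0 1)) qZ // scaler0.
  move: v0; rewrite -z0 => /esym /(qE _ _ _ _ Ww W1) [k [Wk]].
  rewrite scale1r !scaler0 => kv.
  by rewrite -(gC k) // kv g0 //; apply: WM.
- move=> [v [w [Ww -> ->]]] [v' [w' [Ww' -> ->]]].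
  exists (w' *: (a *: v) + w *: v'), (w * w'); split; first exact: WM.
    by rewrite qZ // qD.
  rewrite scalerA mulrC -scalerA gL; last exact: WM.
  have -> : g (w' *: v) (w * w') = g v w by rewrite mulrC gC.
  by rewrite gC.
by exists f => v w Ww; apply/fP; exists v, w.
Qed.

End Localize.

Section Flatness.
Variable R : comPzRingType.
Implicit Types U V F : lmodType R.

(** Tensors are classes of sequences that no bilinear map tells apart. Stated on representatives,
    flatness can be used without computing in [tensor]. *)
Lemma flatP F : flat F <->
  forall U V (f : linmap U V), injective f -> forall s t : seq (U * F),
    (forall (X : lmodType R) (b : V -> F -> X), bilin b ->
       sum_bilin (fun u y => b (f u) y) s = sum_bilin (fun u y => b (f u) y) t) ->
    forall (X : lmodType R) (b : U -> F -> X), bilin b ->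
      sum_bilin b s = sum_bilin b t.
Proof.
split=> [fF U V f fI s t st|H U V f fI x y xy].
  apply/tensor_eqP; apply: (fF _ _ f fI).
  have bt := tensor_map_bilin F f.
  rewrite /tensor_map /tensor_lift !(sum_bilin_repr _ bt).
  exact/st/tens_bilin.
rewrite -[x]reprK -[y]reprK; apply/tensor_eqP; apply: (H _ _ f fI) => X b bb.
have liftE (z : tensor U F) :
    tensor_lift b (tensor_map f z) = sum_bilin (fun u y => b (f u) y) (repr z).
  have [bL _] := tensor_univ bb.
  rewrite /tensor_map {2}/tensor_lift.
  pose L := GRing.isLinear.Build R _ X *:%R (tensor_lift b) (tensor_lift_linear bb).
  pose g : {linear tensor V F -> X} := HB.pack (tensor_lift b) L.
  rewrite -[LHS]/(g _) linear_sum; apply: eq_bigr => p _.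
  exact: tensor_liftE.
by rewrite -!liftE xy.
Qed.

(** The map [bU] : (u, r/w) |-> ru/w makes W^-1 U the tensor product of U and W^-1 R: any bilinear
    [b] factors through it by u/w |-> b(u, 1/w). Localization of modules preserves injectivity. *)
Lemma localization_flat (W : set R) (L : lmodType R) (q : R^o -> R -> L) :
  mult_closed W -> is_localization W q -> flat L.
Proof.
move=> mW Lq; have [qS qE qD qZ] := Lq; have [W1 WM] := mW.
have bil U : exists (LU : lmodType R) (qU : U -> R -> LU) (b : U -> L -> LU),
    [/\ is_localization W qU, bilin b &
      forall u r w, W w -> b u (q r w) = qU (r *: u) w].
  have [LU [qU LqU]] := localization_ex U mW.
  have [qUS qUE qUD qUZ] := LqU; exists LU, qU.
  have cE k u w : W k -> W w -> qU (k *: u) (k * w) = qU u w.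
    move=> Wk Ww; apply/qUE => //; first exact: WM.
    by exists 1; split=> //; rewrite !scalerA; congr (_ *: _); ring.
  have lE a u u' w : W w -> qU (a *: u + u') w = a *: qU u w + qU u' w.
    move=> Ww; rewrite qUZ // qUD // -scalerDr cE //.
  have [u|b bE] := @choice U (linmap L LU)
      (fun u f => forall r w, W w -> f (q r w) = qU (r *: u) w).
    apply: (localization_lift mW Lq) => [a r r' w Ww|k r w Wk Ww].
      by rewrite -lE // scalerDl scalerA.
    by rewrite -scalerA cE.
  exists (fun u x => b u x); split=> //.
  split=> [u a x y|x a u u']; first by rewrite linearP.
  have [r [w [Ww ->]]] := qS x; rewrite !bE // -lE //.
  by rewrite scalerDr !scalerA mulrC.
apply/flatP => U V f fI s t st X b bb.
have [LU [qU [bU [LqU bilU bUE]]]] := bil U.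
have [LV [qV [bV [LqV bilV bVE]]]] := bil V.
have [qUS qUE qUD qUZ] := LqU; have [qVS qVE qVD qVZ] := LqV.
have [|k u w Wk Ww|h hE] := localization_lift (X := LV) mW LqU (g := fun u w => qV (f u) w).
- move=> a u u' w Ww; rewrite linearP qVZ // qVD // -scalerDr; apply/qVE => //.
    exact: WM.
  by exists 1; split=> //; rewrite !scalerA; congr (_ *: _); ring.
- apply/qVE => //; first exact: WM.
  by exists 1; split=> //; rewrite (linmapZ f k) !scalerA; congr (_ *: _); ring.
have hI : injective h.
  move=> x y; have [u [w [Ww ->]]] := qUS x; have [u' [w' [Ww' ->]]] := qUS y.
  rewrite !hE // => /qVE [//|//|k [Wk E]]; apply/qUE => //; exists k; split=> //.
  by apply: fI; rewrite !linearZ.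
have hb u x : h (bU u x) = bV (f u) x.
  have [r [w [Ww ->]]] := qS x; rewrite bUE // bVE // hE //.
  by rewrite linearZ.
have [b1 b2] := bb.
have [a u u' w Ww|k u w Wk Ww|g gE] :=
    localization_lift (X := X) mW LqU (g := fun u w => b u (q 1 w)).
- exact: b2.
- rewrite bilinZl //.
  have -> : k *: b u (q 1 (k * w)) = b u (k *: q 1 (k * w)).
    have b0 : b u 0 = 0.
      by have := b1 u (-1) 0 0; rewrite !scaleN1r oppr0 addr0 addNr.
    by have := b1 u k (q 1 (k * w)) 0; rewrite b0 !addr0.
  rewrite qZ; last exact: WM.
  congr (b u _); apply/qE => //; first exact: WM.
  by exists 1; split=> //; rewrite !scalerA /GRing.scale /=; ring.
have gb u x : g (bU u x) = b u x.
  have [r [w [Ww ->]]] := qS x; rewrite bUE // gE // bilinZl //.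
  have b0 : b u 0 = 0.
    by have := b1 u (-1) 0 0; rewrite !scaleN1r oppr0 addr0 addNr.
  have := b1 u r (q 1 w) 0; rewrite b0 !addr0 => <-.
  by rewrite qZ // /GRing.scale /= mulr1.
have gs r : sum_bilin b r = g (sum_bilin bU r).
  by rewrite /sum_bilin linear_sum; apply: eq_bigr => p _.
rewrite !gs; congr (g _); apply: hI.
have hs r : h (sum_bilin bU r) = sum_bilin (fun u y => bV (f u) y) r.
  by rewrite /sum_bilin linear_sum; apply: eq_bigr => p _; exact: hb.
by rewrite !hs; apply: st.
Qed.

Lemma flat_iso F G (h : linmap F G) : injective h -> surjective h -> flat F -> flat G.
Proof.
move=> hI hS /flatP fF; have [k [hK kK]] := linear_inverse hI hS.
apply/flatP => U V f fI s t st X b bb.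
have bilh (Y Z : lmodType R) (b' : Y -> G -> Z) : bilin b' -> bilin (fun u x => b' u (h x)).
  by case=> b1 b2; split=> [u|x] a z z'; [rewrite linearP; apply: b1 | apply: b2].
have bilk (Y Z : lmodType R) (b' : Y -> F -> Z) : bilin b' -> bilin (fun u x => b' u (k x)).
  by case=> b1 b2; split=> [u|x] a z z'; [rewrite linearP; apply: b1 | apply: b2].
have sE (Y Z : lmodType R) (b' : Y -> G -> Z) r : sum_bilin b' r =
    sum_bilin (fun u x => b' u (h x)) [seq (p.1, k p.2) | p <- r].
  by rewrite /sum_bilin big_map; apply: eq_bigr => p _; rewrite kK.
rewrite !(sE _ _ b); apply: (fF _ _ f fI) => [Y b' bb'|]; last exact: bilh.
have := st Y _ (bilk _ _ _ bb').
by rewrite /sum_bilin !big_map.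
Qed.

Lemma flat_loc (s : R) : flat (loc s).
Proof.
pose W := [set w | exists n, w = s ^+ n].
have mW : mult_closed W.
  split; first by exists 0%N.
  by move=> _ _ [n ->] [m ->]; exists (n + m)%N; rewrite exprD.
have [L [q Lq]] := localization_ex (R^o : lmodType R) mW.
have [qS qE qD qZ] := Lq.
have Ws n : W (s ^+ n) by exists n.
have zE r n : q r (s ^+ n) = r *: q 1 (s ^+ n).
  by rewrite qZ // /GRing.scale /= mulr1.
have [n|f fE] := @loc_lift R s L (fun n => q 1 (s ^+ n)).
  rewrite qZ //; apply/qE => //; exists 1; split; first exact: (Ws 0%N).
  by rewrite /GRing.scale /= exprS; ring.
have fE' a n : f (frac s a n) = q a (s ^+ n).
  have -> : frac s a n = a *: frac s 1 n by rewrite frac_scale mulr1.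
  by rewrite linmapZ fE -zE.
have fI : injective f.
  move=> x y; have [a [n ->]] := fracP x; have [b [m ->]] := fracP y.
  rewrite !fE' => /qE [//|//|_ [[k ->] E]]; apply/frac_eqP; exists k; exact: E.
have fS : surjective f.
  by move=> x; have [a [w [[n ->] ->]]] := qS x; exists (frac s a n).
have [g [fK gK]] := linear_inverse fI fS.
apply: (flat_iso (h := g)); [exact: can_inj gK|by move=> x; exists (f x)|].
exact: localization_flat mW Lq.
Qed.

Lemma cotorsion_solvable (s : R) (C : Mod R) : cotorsion C -> solvable C s.
Proof.
by move=> cC; apply/ext_split_solvable/Ext1_eq0P/cC/flat_loc.
Qed.

End Flatness.

(** * Infinitely divisible elements *)

Lemma iterated_choice (T : Type) (P : T -> Prop) (Q : T -> T -> Prop) :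
  (forall x, P x -> exists y, P y /\ Q x y) ->
  forall x, P x -> exists f : nat -> T, f 0%N = x /\ forall n, P (f n) /\ Q (f n) (f n.+1).
Proof.
move=> step x Px.
have [z|g gE] := @choice {z | P z} {z | P z} (fun z y => Q (sval z) (sval y)).
  by have [y [Py Qzy]] := step _ (proj2_sig z); exists (exist _ y Py).
exists (fun n => sval (iter n g (exist _ x Px))); split=> // n.
by split; [exact: proj2_sig|exact: gE].
Qed.

Section Divisible.
Variables (R : comPzRingType) (C : lmodType R).
Implicit Types (e f s t u : R) (B : set C).

Lemma submodule_divset s B : submodule B -> submodule (divset s B).
Proof.
move=> sB; split=> [|x y [c [<- cB]] [d [<- dB]]|a x [c [<- cB]]].
- exists (fun=> 0); split=> // n; rewrite scaler0 subrr; exact: submodule0.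
- exists (fun n => c n + d n); split=> // n.
  by rewrite scalerDr opprD addrACA; exact: submoduleD.
- exists (fun n => a *: c n); split=> // n.
  by rewrite scalerA mulrC -scalerA -scalerBr; exact: submoduleZ.
Qed.

Lemma sub_divset s B : submodule B -> B `<=` divset s B.
Proof.
move=> sB x Bx; exists (fun n => if n is 0%N then x else 0); split=> // -[|n].
  by rewrite scaler0 subr0.
by rewrite scaler0 subr0; exact: submodule0.
Qed.

Lemma divset_sub s B B' : B `<=` B' -> divset s B `<=` divset s B'.
Proof. by move=> BB' x [c [cx cB]]; exists c; split=> // n; apply: BB'. Qed.

Lemma divset_shift s B (c : nat -> C) n :
  (forall n, B (c n - s *: c n.+1)) -> divset s B (c n).
Proof.
move=> cB; exists (fun k => c (n + k)%N); rewrite addn0; split=> // k.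
by rewrite addnS.
Qed.

Lemma divset_expand s B (c : nat -> C) n k : submodule B ->
  (forall n, B (c n - s *: c n.+1)) -> B (c n - s ^+ k *: c (n + k)%N).
Proof.
move=> sB cB; elim: k => [|k IHk].
  by rewrite addn0 scale1r subrr; exact: submodule0.
rewrite -(subrKA (s ^+ k *: c (n + k)%N)); apply: submoduleD => //.
by rewrite exprSr -scalerA -scalerBr addnS; apply: submoduleZ.
Qed.

(** Coinduction: [divset s B] is the largest set in which every element is, modulo B, s times
    another element of the set. *)
Lemma divset_step s B (P : set C) : (forall x, P x -> exists y, P y /\ B (x - s *: y)) ->
  P `<=` divset s B.
Proof.
move=> step x Px; have [c [c0 cP]] := iterated_choice step Px.
by exists c; split=> // n; case: (cP n).
Qed.

Hypothesis adj : forall u, solvable C u.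

(* With the sequences [dd n k] of e-quotients of [d n], the wanted x_n is formally
   the sum of the u^j d_(n+j), and w_n that of the u^j e^j [dd (n+j) (n+j)],
   that is, x_n divided by e^n. *)
Lemma divset_solvable B e u (d : nat -> C) : submodule B ->
  (forall n, divset e B (d n)) ->
  exists x : nat -> C, (forall n, divset e B (x n)) /\
                       forall n, B (x n - u *: x n.+1 - d n).
Proof.
move=> sB /choice [dd ddP].
have dd0 n : dd n 0%N = d n by case: (ddP n).
have ddB n k : B (dd n k - e *: dd n k.+1) by case: (ddP n).
have [w wE] := adj (u * e) (fun n => dd n n).
have wD n : divset e B (w n).
  (* [S k k] + u^k w_(n+k) plays the role of x_n divided by e^(n+k): the first k terms of the series
     are divided by means of [dd], and the tail is u^k x_(n+k) divided by e^(n+k). *)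
  pose S k l := \sum_(j < k) u ^+ j *: dd (n + j)%N (n + l)%N.
  exists (fun k => S k k + u ^+ k *: w (n + k)%N); split=> [|k].
    by rewrite /S big_ord0 add0r scale1r addn0.
  have -> : S k k + u ^+ k *: w (n + k)%N -
      e *: (S k.+1 k.+1 + u ^+ k.+1 *: w (n + k.+1)%N) = S k.+1 k - e *: S k.+1 k.+1.
    rewrite scalerDr opprD addrA addrAC; congr (_ - _).
    rewrite /S [RHS]big_ord_recr /= -addrA; congr (_ + _).
    rewrite -wE scalerBr addnS; congr (_ - _); rewrite !scalerA exprS.
    by congr (_ *: _); ring.
  rewrite /S scaler_sumr -sumrB; apply: submodule_sum => // j _.
  rewrite scalerA mulrC -scalerA -scalerBr; apply: submoduleZ => //.
  by rewrite addnS.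
exists (fun n => e ^+ n *: w n); split=> n.
  by apply: submoduleZ (wD n); apply: submodule_divset.
rewrite scalerA exprS mulrA [_ * e ^+ n]mulrC -scalerA -scalerBr wE -dd0.
by rewrite -opprB; apply: submoduleN => //; exact: (divset_expand 0%N n sB (ddB n)).
Qed.

(** The errors are e-divisible modulo B and are summed by [divset_solvable]; subtracting the sums
    leaves a sequence that is u-divisible modulo B itself. Hence dividing out the e-divisible
    elements creates no new u-divisible ones, nor new e-divisible ones. *)
Lemma divset_divset B e u x : submodule B -> divset u (divset e B) x ->
  exists y z, [/\ divset u B y, divset e B z & x = y + z].
Proof.
move=> sB [c [<- cD]]; have [z [zD zB]] := divset_solvable u sB cD.
exists (c 0%N - z 0%N), (z 0%N); split=> //; last by rewrite subrK.
exists (fun n => c n - z n); split=> // n.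
have -> : c n - z n - u *: (c n.+1 - z n.+1) =
   - (z n - u *: z n.+1 - (c n - u *: c n.+1)).
  by rewrite opprB scalerBr subr_swap.
exact: submoduleN.
Qed.

Lemma separated_divset B e u : submodule B -> separated u B -> separated u (divset e B).
Proof.
move=> sB uB x /(divset_divset sB) [y [z [/uB By Dz ->]]].
apply: submoduleD Dz; [exact: submodule_divset|exact: sub_divset].
Qed.

Lemma separated_divset_self B e : submodule B -> separated e (divset e B).
Proof.
move=> sB x /(divset_divset sB) [y [z [Dy Dz ->]]].
by apply: submoduleD => //; apply: submodule_divset.
Qed.

(** Up to e-divisible elements, f = 1 - e has an inverse, the geometric series in e. So every
    element is f-divisible modulo the e-divisible ones, and [divset_divset] splits it. *)
Lemma divset_cover B e f : submodule B -> e + f = 1 ->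
  forall x, exists y z, [/\ divset e B y, divset f B z & x = y + z].
Proof.
move=> sB ef x; have sD := submodule_divset e sB.
suff Dx : divset f (divset e B) x.
  by have [y [z [Dy Dz ->]]] := divset_divset sB Dx; exists z, y; rewrite addrC.
apply: (@divset_step f _ setT) => // {}x _.
(* z_0 stands for x + e x + e^2 x + ...; the shifted series z_1 may differ from it, but only by an
   e-divisible element. *)
have [z zE] := adj e (fun=> x); exists (z 0%N); split=> //.
have Dz : divset e B (z 0%N - z 1%N).
  exists (fun n => z n - z n.+1); split=> // n.
  by rewrite scalerBr subr_swap !zE subrr; exact: submodule0.
have -> : x - f *: z 0%N = e *: (z 0%N - z 1%N).
  rewrite -(zE 0%N) scalerBr addrAC; congr (_ - _).
  by rewrite -{1}[z 0%N]scale1r -scalerBl -ef addrK.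
exact: submoduleZ.
Qed.

(** If x is divisible for both and c_1 is its first quotient by e, then c_1 - f c_1 = e c_1 is
    f-divisible, so the constant sequence c_1 shows that c_1 is f-divisible too. The intersection is
    thus stable under division by e, by f, and by both in turn. *)
Lemma divset_cap B e f : submodule B -> e + f = 1 ->
  divset e B `&` divset f B `<=` divset (e * f) B.
Proof.
move=> sB.
have half a b : a + b = 1 -> forall x, (divset a B `&` divset b B) x ->
    exists y, (divset a B `&` divset b B) y /\ B (x - a *: y).
  move=> ab x [[c [<- cB]] Dx]; exists (c 1%N); split; last exact: cB.
  split; first exact: divset_shift.
  apply: (separated_divset_self sB); exists (fun=> c 1%N); split=> // _.
  rewrite -{1}[c 1%N]scale1r -scalerBl -ab addrK.
  apply: (proj1 (submodule_subr (submodule_divset b sB) _) Dx).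
  by apply: sub_divset => //; apply: cB.
move=> ef; apply: divset_step => x Px.
have [y [Py xy]] := half e f ef x Px.
have fe : f + e = 1 by rewrite addrC.
have [z [Pz yz]] := half f e fe y (conj (proj2 Py) (proj1 Py)).
exists z; split; first by case: Pz.
rewrite -(subrKA (e *: y)); apply: submoduleD => //.
by rewrite -scalerA -scalerBr; apply: submoduleZ.
Qed.

Lemma separated_mul B s t : submodule B -> separated t B -> separated (s * t) B.
Proof.
move=> sB tB x [c [<- cB]]; apply: tB; exists (fun n => s ^+ n *: c n).
split=> [|n]; first by rewrite scale1r.
rewrite scalerA (_ : t * s ^+ n.+1 = s ^+ n * (s * t)); last by rewrite exprS; ring.
by rewrite -scalerA -scalerBr; apply: submoduleZ.
Qed.

Lemma separated_exp B u k : submodule B -> separated (u ^+ k) B -> separated u B.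
Proof.
move=> sB uB x [c [<- cB]]; apply: uB; exists (fun n => c (n * k)%N); split=> // n.
by rewrite mulSn addnC; exact: (divset_expand (n * k)%N k sB cB).
Qed.

(* If d is infinitely (s+t)-divisible, then d_1 + s d_2 + s^2 d_3 + ... is the quotient
   of d_0 by (s+t) - s = t, and it is again infinitely (s+t)-divisible. *)
Lemma separated_add B s t : submodule B ->
  separated s B -> separated t B -> separated (s + t) B.
Proof.
move=> sB sepS sepT x [c [<- cB]]; pose u := s + t.
pose P := [set y | exists d : nat -> C, d 0%N = y /\ forall n, B (d n - u *: d n.+1)].
suff : P `<=` divset t B by move=> PD; apply/sepT/PD; exists c.
apply: divset_step => _ [d [<- dB]].
have [d' dE] := adj s (fun n => d n.+1).
(* Modulo B both u d'_(n+1) and d'_n solve the s-system with right-hand sides d_(n+1), and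
   s-separation makes solutions unique. *)
have deltaB n : B (u *: d' n.+1 - d' n).
  apply: sepS; exists (fun k => u *: d' (n + k).+1 - d' (n + k)%N).
  rewrite addn0; split=> // k; rewrite addnS.
  have -> : u *: d' (n + k).+1 - d' (n + k)%N - s *: (u *: d' (n + k).+2 - d' (n + k).+1)
     = u *: (d' (n + k).+1 - s *: d' (n + k).+2) - (d' (n + k)%N - s *: d' (n + k).+1).
    by rewrite !scalerBr !scalerA (mulrC s) subr_swap.
  by rewrite !dE -opprB; apply: submoduleN.
have tB n : B (d n.+1 - t *: d' n.+1).
  by rewrite -dE -addrA -opprD -scalerDl -opprB; apply: submoduleN.
exists (d' 0%N); split.
  by exists d'; split=> // n; rewrite -opprB; apply: submoduleN.
rewrite -(subrKA (u *: d 1%N)); apply: submoduleD => //.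
rewrite -(subrKA (u *: (t *: d' 1%N))); apply: submoduleD => //.
  by rewrite -scalerBr; apply: submoduleZ.
by rewrite scalerA mulrC -scalerA -scalerBr; apply: submoduleZ.
Qed.

Definition sep_on (J : set R) B := forall u, J u -> separated u B.

(* If all systems are solvable in C, this is the kernel of the universal map from C to
   J-contramodules. *)
Definition core (J : set R) : set C :=
  [set x | forall B, submodule B -> sep_on J B -> B x].

Lemma submodule_core J : submodule (core J).
Proof.
split=> [B sB _|x y xB yB B sB JB|a x xB B sB JB]; first exact: submodule0.
  by apply: submoduleD; [|apply: xB|apply: yB].
by apply: submoduleZ => //; apply: xB.
Qed.

(** Being separated survives arbitrary intersections because [divset] is monotone in B; hence a
    least such B exists. *)
Lemma core_sep J : sep_on J (core J).
Proof.
move=> u Ju x xD B sB JB; apply: (JB u Ju).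
by apply: divset_sub xD => y; apply.
Qed.

End Divisible.

(** * Comaximal ideals and intersections of cores *)

Section Maximal.
Variable R : comPzRingType.
Implicit Types (I J m : set R) (l : seq (set R)).

Lemma idealM I a x : ideal I -> I x -> I (a * x).
Proof. by case=> _ _ IZ; exact: IZ. Qed.

Lemma idealMr I a x : ideal I -> I x -> I (x * a).
Proof. by rewrite mulrC; apply: idealM. Qed.

Lemma idealD I x y : ideal I -> I x -> I y -> I (x + y).
Proof. by case=> _ ID _; exact: ID. Qed.

Lemma idealB I x y : ideal I -> I x -> I y -> I (x - y).
Proof. by move=> iI Ix Iy; exact: (@submoduleB R R^o). Qed.

Lemma ideal0 I : ideal I -> I 0.
Proof. by case. Qed.

Definition inter l : set R := [set x | forall I, List.In I l -> I x].

Lemma maximal_comax m m' : maximal_ideal m -> maximal_ideal m' -> m <> m' ->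
  exists a b, [/\ m a, m' b & a + b = 1].
Proof.
move=> [[im m1] mm] [[im' m1'] mm'] mne; apply: contrapT => no.
pose I := [set x | exists a b, [/\ m a, m' b & a + b = x]].
have pI : proper_ideal I.
  split; last by move=> [a [b H]]; apply: no; exists a, b.
  split=> [|_ _ [a [b [ma mb <-]]] [a' [b' [ma' mb' <-]]]|r _ [a [b [ma mb <-]]]].
  - by exists 0, 0; split; rewrite ?addr0 //; apply: ideal0.
  - by exists (a + a'), (b + b'); split; rewrite 1?addrACA //; apply: idealD.
  - by exists (r * a), (r * b); split; rewrite -?mulrDr //; apply: idealM.
apply: mne; transitivity I; last first.
  by apply: mm' => // x mx; exists 0, x; rewrite add0r; split=> //; apply: ideal0.
apply/esym/mm => // x mx; exists x, 0; rewrite addr0; split=> //; exact: ideal0.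
Qed.

Lemma maximal_crt m l : maximal_ideal m -> (forall m', List.In m' l -> maximal_ideal m') ->
  ~ List.In m l -> exists e f, [/\ m e, inter l f & e + f = 1].
Proof.
move=> mm; have [[im _] _] := mm; elim: l => [_ _|m' l IHl lm nm].
  by exists 0, 1; rewrite add0r; split=> //; apply: ideal0.
have [|nml|e [f [me lf ef]]] := IHl.
- by move=> m'' ?; apply: lm; right.
- by apply: nm; right.
have mm' : maximal_ideal m' by apply: lm; left.
have [|a [b [ma mb ab]]] := maximal_comax mm mm'.
  by move=> E; apply: nm; left.
exists (e + f * a), (f * b); split.
- by apply: idealD => //; apply: idealM.
- move=> I [<-|lI]; first by apply: idealM => //; case: mm' => -[].
  by apply: idealMr (lf I lI); case: (lm I (or_intror lI)) => -[].
- by rewrite -addrA -mulrDr ab mulr1.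
Qed.

Lemma ideal_inter l : (forall I, List.In I l -> ideal I) -> ideal (inter l).
Proof.
move=> lI; split=> [I Il|x y Ix Iy I Il|a x Ix I Il].
- by apply: ideal0; apply: lI.
- by apply: idealD (lI _ Il) (Ix _ Il) (Iy _ Il).
- exact: idealM (lI _ Il) (Ix _ Il).
Qed.

(** Take e in m and f in all ideals of l with e + f = 1. For u in m, u = ue + uf, where [divset e B]
    is separated for ue by construction and for uf because B is; so it contains [core m]. By
    induction [divset f B] contains the intersection of the other cores, and [divset_cap] leads back
    to B. *)
Lemma core_inter (C : lmodType R) l (B : set C) :
  (forall u, solvable C u) -> (forall m, List.In m l -> maximal_ideal m) ->
  submodule B -> sep_on (inter l) B ->
  forall x, (forall m, List.In m l -> core m x) -> B x.
Proof.
move=> adj; elim: l B => [|m l IHl] B lm sB lB x xl.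
  (* The empty intersection contains 1, and constant sequences are 1-divisible, so B is
     everything. *)
  apply: (lB 1) => //; exists (fun=> x); split=> // _.
  by rewrite scale1r subrr; exact: submodule0.
have lm' m' : List.In m' l -> maximal_ideal m' by move=> ?; apply: lm; right.
have xl' m' : List.In m' l -> core m' x by move=> ?; apply: xl; right.
have mm : maximal_ideal m by apply: lm; left.
have [ml|ml] := pselect (List.In m l).
  by apply: IHl => // u ul; apply: lB => I [<-|/ul //]; apply: ul.
have [e [f [me lf ef]]] := maximal_crt mm lm' ml.
have im : ideal m by case: mm => -[].
have il : ideal (inter l) by apply: ideal_inter => I /lm' [[]].
have inI u v : m u -> inter l v -> inter (m :: l) (u * v).
  move=> mu lv I [<-|lI]; first exact: idealMr.
  by apply: idealM (lv I lI); case: (lm' I lI) => -[].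
have Dx a b (J : set R) : a + b = 1 -> (forall u, J u -> inter (m :: l) (u * b)) ->
    sep_on J (divset a B).
  move=> ab Jb u Ju; have sD := submodule_divset a sB.
  rewrite -[u]mulr1 -ab mulrDr; apply: separated_add => //.
    by apply: separated_mul => //; apply: separated_divset_self.
  by apply: separated_divset => //; apply: lB; apply: Jb.
apply: (lB (e * f)); first exact: inI.
apply: divset_cap => //; split.
  apply: xl; [by left|exact: submodule_divset|].
  by apply: (Dx _ f) => // u mu; apply: inI.
apply: IHl => //; first exact: submodule_divset.
by apply: (Dx _ e); [rewrite addrC|move=> u lu; rewrite mulrC; apply: inI].
Qed.

End Maximal.

(** * Prime ideals *)

Section Primes.
Variable R : comPzRingType.
Implicit Types (I J p q m : set R) (l : seq (set R)).

Lemma noetherian_max (P : set R -> Prop) : noetherian R ->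
  (exists I, ideal I /\ P I) ->
  exists I, [/\ ideal I, P I & forall J, ideal J -> P J -> I `<=` J -> J `<=` I].
Proof.
move=> noeth [I0 I0P]; apply: contrapT => nomax.
pose T := {I | ideal I /\ P I}.
have [z|g gP] := @choice T T (fun z z' => sval z `<=` sval z' /\ ~ (sval z' `<=` sval z)).
  apply: contrapT => noz; apply: nomax; exists (sval z).
  have [iz Pz] := proj2_sig z; split=> // J iJ PJ zJ.
  by apply: contrapT => Jz; apply: noz; exists (exist _ J (conj iJ PJ)).
pose I n := sval (iter n g (exist _ I0 I0P)).
have iI n : ideal (I n) by case: (proj2_sig (iter n g (exist _ I0 I0P))).
have Imono n k : I n `<=` I (n + k)%N.
  elim: k => [|k IHk]; first by rewrite addn0.
  by rewrite addnS; apply: subset_trans IHk _; case: (gP (iter (n + k) g (exist _ I0 I0P))).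
have Ile n k : (n <= k)%N -> I n `<=` I k by move=> nk; rewrite -(subnKC nk).
pose U := [set x | exists n, I n x].
have iU : ideal U.
  split=> [|x y [n xn] [k yk]|a x [n xn]].
  - by exists 0%N; apply: ideal0 (iI _).
  - exists (maxn n k); apply: idealD (iI _) _ _.
      exact: (Ile _ _ (leq_maxl n k) x xn).
    exact: (Ile _ _ (leq_maxr n k) y yk).
  - by exists n; apply: idealM (iI _) _.
have [gs gsE] := noeth U iU.
have [n nP] : exists n, forall i, (i < size gs)%N -> I n gs`_i.
  have Ug i : (i < size gs)%N -> U gs`_i.
    move=> i_s; rewrite gsE; exists (fun j => (j == i)%:R).
    rewrite (bigD1 (Ordinal i_s)) //= eqxx mul1r big1 ?addr0 // => j ji.
    by rewrite (negPf (_ : val j != i)) ?mul0r.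
  elim: (size gs) Ug => [|k IHk] Ug; first by exists 0%N.
  have [|n nP] := IHk; first by move=> i ik; apply: Ug; apply: leqW.
  have [n' n'P] := Ug k (ltnSn k).
  exists (maxn n n') => i; rewrite ltnS leq_eqVlt => /predU1P[->|/nP].
    exact: (Ile _ _ (leq_maxr n n') _ n'P).
  exact: (Ile _ _ (leq_maxl n n')).
have [_] := gP (iter n g (exist _ I0 I0P)); apply => x xI.
have : U x by exists n.+1.
rewrite gsE => -[c ->]; apply: (@submodule_sum R R^o) => [|i _]; first exact: iI.
by apply: idealM (iI n) _; apply: nP.
Qed.

(* The product of the ideals in [l] is contained in [I]. *)
Fixpoint prodin l I : Prop :=
  if l is p :: l then forall u, p u -> prodin l [set x | I (u * x)] else I 1.

Lemma prodin_sub l I J : I `<=` J -> prodin l I -> prodin l J.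
Proof.
elim: l I J => [|p l IHl] I J IJ /=; first exact: IJ.
by move=> H u /H; apply: IHl => x; apply: IJ.
Qed.

Lemma prodin_cat l l' I J : prodin l I ->
  (forall x, I x -> prodin l' [set y | J (x * y)]) -> prodin (l ++ l') J.
Proof.
elim: l I J => [|p l IHl] I J /=.
  by move=> I1 /(_ 1 I1); apply: prodin_sub => x /=; rewrite mul1r.
move=> H IJ u /H; move/IHl; apply=> x /IJ; apply: prodin_sub => y /=.
by rewrite mulrA.
Qed.

Lemma prodin_expr l I u : prodin l I -> inter l u -> I (u ^+ size l).
Proof.
elim: l I => [|p l IHl] I //= H ul; rewrite exprS.
apply: (IHl [set x | I (u * x)]); first by apply: H; apply: ul; left.
by move=> q ql; apply: ul; right.
Qed.

Lemma prodin_prime l I p : prime_ideal p -> prodin l I -> I `<=` p ->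
  exists q, List.In q l /\ q `<=` p.
Proof.
move=> [[ip p1] pM]; elim: l I => [|q l IHl] I /= H Ip; first by case: p1; apply: Ip.
have [qp|/existsNP [u /not_implyP [qu pu]]] := pselect (q `<=` p).
  by exists q; split=> //; left.
have [x Ix|q' [ql qp]] := IHl _ (H u qu); last by exists q'; split=> //; right.
by have /pM [] := Ip _ Ix.
Qed.

(** Noetherian induction: a maximal counterexample I is not prime, so it contains some ab with a and
    b outside, and the lists for I + Ra and I + Rb concatenate to one for I. *)
Lemma noetherian_prodin I : noetherian R -> ideal I ->
  exists l, (forall p, List.In p l -> prime_ideal p /\ I `<=` p) /\ prodin l I.
Proof.
move=> noeth iI; apply: contrapT => badI.
have [|{iI badI}I [iI badI maxI]] := @noetherian_max (fun I => ~ exists l,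
  (forall p, List.In p l -> prime_ideal p /\ I `<=` p) /\ prodin l I) noeth.
  by exists I.
have goodJ a : ~ I a -> exists l,
    (forall p, List.In p l -> prime_ideal p /\ I `<=` p) /\
    prodin l [set x | exists i r, I i /\ x = i + r * a].
  move=> Ia; pose J := [set x | exists i r, I i /\ x = i + r * a].
  have IJ : I `<=` J by move=> x Ix; exists x, 0; rewrite mul0r addr0.
  have iJ : ideal J.
    split=> [|_ _ [i [r [Ii ->]]] [i' [r' [Ii' ->]]]|b _ [i [r [Ii ->]]]].
    - by apply: IJ; apply: ideal0.
    - by exists (i + i'), (r + r'); rewrite mulrDl addrACA; split=> //; apply: idealD.
    - exists (b * i), (b * r); split; first exact: idealM.
      by rewrite -mulrA -mulrDr.
  have [l [lp Jl]] : exists l, (forall p, List.In p l -> prime_ideal p /\ J `<=` p) /\ prodin l J.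
    apply: contrapT => badJ; apply: Ia; apply: (maxI J) => //.
    by exists 0, 1; rewrite add0r mul1r; split=> //; apply: ideal0.
  by exists l; split=> // p /lp [pp Jp]; split=> //; apply: subset_trans IJ Jp.
apply: badI; have [I1|I1] := pselect (I 1); first by exists [::]; split.
have [pI|npI] := pselect (prime_ideal I).
  exists [:: I]; split=> [p [<-|//]|u Iu /=]; first by split.
  by rewrite mulr1.
have [a [b [Iab Ia Ib]]] : exists a b, [/\ I (a * b), ~ I a & ~ I b].
  apply: contrapT => no; apply: npI; split=> // a b Iab.
  apply: contrapT => /not_orP [Ia Ib]; apply: no; by exists a, b.
have [l [lp la]] := goodJ a Ia; have [l' [lp' lb]] := goodJ b Ib.
exists (l ++ l'); split=> [p /List.in_app_iff [/lp|/lp']//|].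
apply: prodin_cat la _ => _ [i [r [Ii ->]]]; apply: prodin_sub lb => _ [j [t [Ij ->]]] /=.
have -> : (i + r * a) * (j + t * b) = (j + t * b) * i + r * a * j + r * t * (a * b).
  by ring.
by do ?apply: idealD => //; apply: idealM.
Qed.

(** Prime avoidance, where minimality enters through the incomparability of distinct members of the
    list. *)
Lemma minimal_avoid l I : (forall q, List.In q l -> minimal_prime q) -> ideal I ->
  (forall q, List.In q l -> ~ (I `<=` q)) ->
  exists s, I s /\ forall q, List.In q l -> ~ q s.
Proof.
move=> lm iI; elim: l lm => [|q l IHl] lm lI; first by exists 0; split=> //; apply: ideal0.
have lm' q' : List.In q' l -> minimal_prime q' by move=> ?; apply: lm; right.
have [q' ?|s [Is sl]] := IHl lm'; first by apply: lI; right.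
have [qs|qs] := pselect (q s); last by exists s; split=> // q' [<-|/sl].
have nq : ~ List.In q l by move/sl.
have mq : minimal_prime q by apply: lm; left.
have [[[iq q1] qM] _] := mq.
have /existsNP [x /not_implyP [Ix qx]] : ~ (I `<=` q) by apply: lI; left.
(* With s in q but in no other member, x in I outside q, and y in all other members but outside q,
   the sum s + xy avoids every member. *)
have [y [yl qy]] : exists y, (forall q', List.In q' l -> q' y) /\ ~ q y.
  elim: {lI IHl sl lm} l lm' nq => [_ _|q' l IHl lm nq]; first by exists 1.
  have [|nql|y [yl qy]] := IHl.
  - by move=> ? ?; apply: lm; right.
  - by apply: nq; right.
  have [pq' _] : minimal_prime q' by apply: lm; left.
  have /existsNP [z /not_implyP [qz nqz]] : ~ (q' `<=` q).
    by move=> q'q; apply: nq; left; apply: (proj2 mq).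
  exists (z * y); split=> [p [<-|lp]|/qM []//].
    by apply: idealMr => //; case: pq' => -[].
  by apply: idealM; [case: (lm p (or_intror lp)) => -[[]]|apply: yl].
exists (s + x * y); split; first by apply: idealD => //; apply: idealMr.
move=> q' [<-|lq'] H.
  suff /qM[] : q (x * y) by [].
  by rewrite -[x * y](addKr s) addrC; apply: idealB.
have [[[iq' _] _] _] := lm' _ lq'.
apply: (sl q' lq'); rewrite -[s](addrK (x * y)); apply: idealB => //.
by apply: idealM => //; apply: yl.
Qed.

Section Decomposition.
Variables P0 P1 : set (set R).
Hypotheses (noeth : noetherian R) (dec : spec_decomposition P0 P1).

Lemma P1_prime m : P1 m -> prime_ideal m.
Proof.
case: dec => E _ _ _ Pm.
by rewrite -[prime_ideal m]/([set p | prime_ideal p] m) E; right.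
Qed.

Lemma P1_maximal m : P1 m -> maximal_ideal m.
Proof. by case: dec => _ _ _; apply. Qed.

Lemma mult_subset_closed : mult_closed (mult_subset P0).
Proof.
have P0p q : P0 q -> prime_ideal q by case: dec => _ _ H _ /H [].
split=> [[q Pq q1]|a b Sa Sb [q Pq qab]].
  by case: (P0p q Pq) => -[].
by case: (P0p q Pq) => _ /(_ a b qab) [?|?]; [apply: Sa|apply: Sb]; exists q.
Qed.

(** A product of finitely many primes is zero, and a minimal prime contains, hence equals, one of
    the factors. *)
Lemma P0_finite : exists l, forall q, List.In q l <-> P0 q.
Proof.
have [_ _ P0m _] := dec.
have i0 : ideal [set (0 : R)] by exact: (@submodule_set0 R R^o).
have [l [lp l0]] := noetherian_prodin noeth i0.
exists (List.filter (fun q => `[< P0 q >]) l) => q; split=> [/List.filter_In [_ /asboolP]//|Pq].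
apply/List.filter_In; split; last exact/asboolP.
have [pq qm] := P0m q Pq.
have [_ ->|q' [q'l q'q]] := prodin_prime pq l0; first by apply: ideal0; case: pq => -[].
by have [pq' _] := lp q' q'l; rewrite -(qm q').
Qed.

(** If m were contained in some q of P0, maximality would give q = m, against disjointness; prime
    avoidance then applies. *)
Lemma P1_meets_S m : P1 m -> exists s, m s /\ mult_subset P0 s.
Proof.
move=> Pm; have [E P01 P0m _] := dec; have [l lP] := P0_finite.
have mm := P1_maximal Pm; have [[im _] mmax] := mm.
have [|q /lP Pq mq|s [ms sl]] := minimal_avoid (l := l) _ im.
- by move=> q /lP /P0m.
- have [[pq _] _] := P0m q Pq.
  have : (P0 `&` P1) q by split=> //; rewrite (mmax q pq mq).
  by rewrite P01.
- by exists s; split=> // -[q /lP lq qs]; apply: (sl q lq).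
Qed.

(** Primes containing s lie outside P0, hence in P1. So sR contains a finite product of maximal
    ideals of P1, and any m of P1 containing s must be one of the factors. *)
Lemma S_prodin s : mult_subset P0 s ->
  exists l, [/\ forall m, List.In m l -> P1 m, forall m, P1 m -> m s -> List.In m l
    & prodin l [set x | exists r, x = s * r]].
Proof.
move=> Ss; have [E _ _ _] := dec.
have iI : ideal [set x | exists r, x = s * r].
  split=> [|_ _ [r ->] [t ->]|a _ [r ->]].
  - by exists 0; rewrite mulr0.
  - by exists (r + t); rewrite mulrDr.
  - by exists (a * r); rewrite mulrCA.
have [l [lp lI]] := noetherian_prodin noeth iI.
have lP m : List.In m l -> P1 m.
  move=> /lp [pm Im].
  have ms : m s by apply: Im; exists 1; rewrite mulr1.
  have : [set p | prime_ideal p] m by [].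
  by rewrite E => -[Pm|//]; case: Ss; exists m.
exists l; split=> // m Pm ms; have pm := P1_prime Pm.
have [_ [r ->]|q [ql qm]] := prodin_prime pm lI.
  by apply: idealMr => //; case: pm => -[].
have [_ qmax] := P1_maximal (lP q ql).
by rewrite (qmax m) //; case: pm.
Qed.

(** y is a product of elements outside m, one from each factor different from m, and a counts the
    remaining factors. Neither depends on I. *)
Lemma prodin_colon m l : P1 m -> (forall p, List.In p l -> P1 p) ->
  exists y a, (~ m y) /\ (forall I, prodin l I -> prodin (nseq a m) [set x | I (y * x)]).
Proof.
move=> Pm; have [[_ m1] mM] := P1_prime Pm.
elim: l => [_|p l IHl lP].
  by exists 1, 0%N; split=> // I I1 /=; rewrite mulr1.
have [|y [a [my yP]]] := IHl; first by move=> q ql; apply: lP; right.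
have Pp : P1 p by apply: lP; left.
have [pm|pm] := pselect (p `<=` m).
  have -> : p = m.
    by have [_ pmax] := P1_maximal Pp; apply/esym/pmax => //; case: (P1_prime Pm).
  exists y, a.+1; split=> // I H /= u mu.
  by have := yP _ (H u mu); apply: prodin_sub => x /=; rewrite mulrCA.
have /existsNP [z /not_implyP [pz mz]] := pm.
exists (z * y), a; split=> [/mM[]//|I H].
by have := yP _ (H z pz); apply: prodin_sub => x /=; rewrite mulrA.
Qed.

(** The annihilators of the powers of an element of m and S become stationary, so a high power has
    the same annihilator as its square. Removing the factors other than m from a product inside s^2
    R gives y and a. *)
Lemma local_parameter m : P1 m -> exists s y a,
  [/\ m s, forall x, s * s * x = 0 -> s * x = 0, ~ m y &
      prodin (nseq a m) [set x | exists r, y * x = s * s * r]].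
Proof.
move=> Pm; have [s [ms Ss]] := P1_meets_S Pm; have [[im _] _] := P1_prime Pm.
have [S1 SM] := mult_subset_closed.
pose Ann n := [set x : R | s ^+ n.+1 * x = 0].
have iA n : ideal (Ann n).
  split=> [|x y xA yA|b x xA]; first by rewrite /Ann /= mulr0.
    by rewrite /Ann /= mulrDr xA yA addr0.
  by rewrite /Ann /GRing.scale /= mulrCA xA mulr0.
have [|_ [_ [n ->] nmax]] := @noetherian_max (fun I => exists n, I = Ann n) noeth.
  by exists (Ann 0%N); split=> //; exists 0%N.
pose t := s ^+ n.+1.
have SX k : mult_subset P0 (s ^+ k).
  by elim: k => [|k IHk]; rewrite ?expr0 // exprS; apply: SM.
have [l [lP _ lI]] := S_prodin (SM _ _ (SX n.+1) (SX n.+1)).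
have [y [a [my yP]]] := @prodin_colon m l Pm lP.
exists t, y, a; split=> //.
- by rewrite /t exprSr; apply: idealM.
- move=> x tx; apply: (nmax (Ann (n + n.+1)%N)) => //; first by exists (n + n.+1)%N.
    by move=> z; rewrite /Ann /= -addSn exprD -mulrA => ->; rewrite mulr0.
  by rewrite /Ann /= -addSn exprD.
- exact: yP _ lI.
Qed.

End Decomposition.
End Primes.

(** * Contramodules are cotorsion *)

Section Mulset.
Variables (R : comPzRingType) (F : lmodType R).
Implicit Types (I J K m : set R) (B X : set F).

(* The subgroup I B generated by the products; in particular [mulset setT B] is the
   span of B. *)
Definition mulset I B : set F := [set x | exists t : seq (R * F),
  (forall q, q \in t -> I q.1 /\ B q.2) /\ x = \sum_(q <- t) q.1 *: q.2].

Lemma mulset1 I B a x : I a -> B x -> mulset I B (a *: x).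
Proof.
move=> Ia Bx; exists [:: (a, x)]; split=> [q|]; last by rewrite big_seq1.
by rewrite inE => /eqP ->.
Qed.

Lemma submodule_mulset I B : (ideal I \/ submodule B) -> submodule (mulset I B).
Proof.
move=> IB; split=> [|_ _ [t [tP ->]] [t' [tP' ->]]|a _ [t [tP ->]]].
- by exists [::]; split=> //; rewrite big_nil.
- exists (t ++ t'); split=> [q|]; last by rewrite big_cat.
  by rewrite mem_cat => /orP[/tP|/tP'].
- case: IB => [iI|sB].
    exists [seq (a * q.1, q.2) | q <- t]; split=> [_ /mapP[q /tP [Iq Bq] ->]|].
      by split=> //; apply: idealM.
    by rewrite big_map scaler_sumr; apply: eq_bigr => q _; rewrite scalerA.
  exists [seq (q.1, a *: q.2) | q <- t]; split=> [_ /mapP[q /tP [Iq Bq] ->]|].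
    by split=> //; apply: submoduleZ.
  by rewrite big_map scaler_sumr; apply: eq_bigr => q _; rewrite !scalerA mulrC.
Qed.

Lemma mulset_sub I B (D : set F) : submodule D ->
  (forall a x, I a -> B x -> D (a *: x)) -> mulset I B `<=` D.
Proof.
move=> sD IBD _ [t [tP ->]]; apply: submodule_sum => // q /tP [Iq Bq].
exact: IBD.
Qed.

End Mulset.

(** * Linear relations in flat modules *)

Section FlatRelations.
Variables (R : comPzRingType) (F : lmodType R).
Hypothesis flatF : flat F.
Implicit Types (I J K m : set R) (r s : R).

(** Injectivity of I (x) F -> F: equal elements of F have equal images under any bilinear map on I
    and F. [b] is defined on all of R but need only be bilinear over I, which keeps the module
    structure on I out of the applications. *)
Lemma flat_bilin I (W : lmodType R) (b : R -> F -> W) (s t : seq (R * F)) :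
  ideal I -> (forall q, q \in s -> I q.1) -> (forall q, q \in t -> I q.1) ->
  \sum_(q <- s) q.1 *: q.2 = \sum_(q <- t) q.1 *: q.2 ->
  (forall r, I r -> linear (b r)) ->
  (forall x a r r', I r -> I r' -> b (a * r + r') x = a *: b r x + b r' x) ->
  \sum_(q <- s) b q.1 q.2 = \sum_(q <- t) b q.1 q.2.
Proof.
move=> iI sI tI st b1 b2.
have [K [k [kI kE]]] := submodule_ex (iI : submodule (I : set (R^o : lmodType R))).
have [r|h hE] := @choice R K (fun r z => I r -> k z = r).
  by have [/kE [z <-]|?] := pselect (I r); [exists z|exists 0].
pose l := map (fun q : R * F => (h q.1, q.2)).
have kI' z : I (k z) by apply/kE; exists z.
have bb : bilin (fun z x => b (k z) x).
  split=> [z|x a z z'] /=; first exact: b1.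
  by rewrite linearP; apply: b2.
have bE u : (forall q, q \in u -> I q.1) ->
    \sum_(q <- u) b q.1 q.2 = sum_bilin (fun z x => b (k z) x) (l u).
  move=> uI; rewrite /sum_bilin big_map [LHS]big_seq [RHS]big_seq.
  by apply: eq_bigr => q /uI Iq /=; rewrite hE.
rewrite !bE //.
have H := proj1 (flatP F) flatF _ _ k kI (l s) (l t).
apply: H => // Y b' bb'.
have b'E u : (forall q, q \in u -> I q.1) ->
    sum_bilin (fun z x => b' (k z) x) (l u) = b' 1 (\sum_(q <- u) q.1 *: q.2).
  move=> uI; have [b'1 _] := bb'.
  have b'0 : b' 1 0 = 0.
    by have := b'1 1 (-1) 0 0; rewrite !scaleN1r oppr0 addr0 addNr.
  rewrite /sum_bilin big_map.
  have {b'0} -> : b' 1 (\sum_(q <- u) q.1 *: q.2) = \sum_(q <- u) b' 1 (q.1 *: q.2).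
    elim: u {uI} => [|q u IHu]; first by rewrite !big_nil.
    by rewrite !big_cons -[q.1 *: q.2]scale1r b'1 IHu !scale1r.
  rewrite [LHS]big_seq [RHS]big_seq; apply: eq_bigr => q /uI Iq /=; rewrite hE //.
  have b'0 : b' 1 0 = 0.
    by have := b'1 1 (-1) 0 0; rewrite !scaleN1r oppr0 addr0 addNr.
  have := b'1 1 q.1 q.2 0; rewrite b'0 !addr0 => ->.
  by rewrite -bilinZl // /GRing.scale /= mulr1.
by rewrite !b'E // st.
Qed.

(** With A the annihilator of s, (sr, x) |-> rx modulo AF is well defined and bilinear on sR and F.
    It sends (s, f) to the class of f, while s f = 0. *)
Lemma flat_ann s (f : F) : s *: f = 0 -> mulset [set a | s * a = 0] setT f.
Proof.
move=> sf; pose I := [set u | exists r, u = s * r].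
have iI : ideal I.
  split=> [|_ _ [r ->] [r' ->]|a _ [r ->]].
  - by exists 0; rewrite mulr0.
  - by exists (r + r'); rewrite mulrDr.
  - by exists (a * r); rewrite mulrCA.
pose A := [set a | s * a = 0].
have sA : submodule (mulset A setT : set F).
  by apply: submodule_mulset; right.
have [Q [p [pS p0]]] := quotient_ex sA.
have [u|g gE] := @choice R R (fun u r => I u -> u = s * r).
  by have [[r ->]|?] := pselect (I u); [exists r|exists 0].
have pE a (x : F) : s * a = 0 -> p (a *: x) = 0 by move=> sa; apply/p0/mulset1.
have Is : I s by exists 1; rewrite mulr1.
have pg : \sum_(q <- [:: (s, f)]) p (g q.1 *: q.2) = \sum_(q <- [::]) p (g q.1 *: q.2).
  apply: (@flat_bilin I Q (fun u x => p (g u *: x)) _ _ iI) => // [q||u Iu|x a u u' Iu Iu'].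
  - by rewrite inE => /eqP ->.
  - by rewrite big_seq1 big_nil.
  - by move=> a x y; rewrite -linearP scalerDr !scalerA mulrC.
  apply/eqP; rewrite -subr_eq0 -!linearP -linearB; apply/eqP.
  rewrite scalerA -scalerDl -scalerBl; apply: pE.
  rewrite mulrBr mulrDr mulrCA -!gE //; first by rewrite subrr.
  by apply: idealD => //; apply: idealM.
move: pg; rewrite big_seq1 big_nil /= => pg; apply/p0.
have : p ((g s - 1) *: f) = 0 by apply: pE; rewrite mulrBr -gE // mulr1 subrr.
by rewrite scalerBl scale1r linearB pg sub0r => /eqP; rewrite oppr_eq0 => /eqP.
Qed.

(* Here [lam x] is the coordinate function at [x] modulo m. The ideals J + m^n are
   treated one after the other: a |-> a lam x f is bilinear from (J + m^n) x F to
   R modulo J + m^(n+1). *)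
Lemma flat_indep m (X : set F) (lam : F -> F -> R) J K a (l : seq F) (r : F -> R) :
  ideal m ->
  (forall x c f f', X x -> m (lam x (c *: f + f') - (c * lam x f + lam x f'))) ->
  (forall x x', X x -> X x' -> m (lam x x' - (x == x')%:R)) ->
  ideal J -> ideal K -> J `<=` K -> prodin (nseq a m) K ->
  uniq l -> (forall x, x \in l -> X x) ->
  mulset J setT (\sum_(x <- l) r x *: x) ->
  forall x, x \in l -> K (r x).
Proof.
move=> im lamL lam1 iJ iK JK mK ul lX [t [tJ st]].
(* [chain n] is J + m^n, written as J + m (J + m^(n-1)) for the induction. *)
pose chain := fix chain n : set R := if n is n.+1 then
  [set u | exists j v, [/\ J j, mulset m (chain n : set R^o) v & u = j + v]] else setT.
have ichain n : ideal (chain n).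
  elim: n => [|n IHn] //=.
  have sV : submodule (mulset m (chain n : set R^o)).
    by apply: submodule_mulset; left.
  split=> [|_ _ [j [v [Jj mv ->]]] [j' [v' [Jj' mv' ->]]]|c _ [j [v [Jj mv ->]]]].
  - exists 0, 0; rewrite addr0; split=> //; [exact: ideal0|exact: submodule0].
  - exists (j + j'), (v + v'); rewrite addrACA; split=> //; first exact: idealD.
    exact: (submoduleD sV).
  - exists (c * j), (c * v); rewrite -mulrDr; split=> //; first exact: idealM.
    exact: (submoduleZ _ sV).
have Jchain n : J `<=` chain n.
  case: n => [|n] //= j Jj; exists j, 0; rewrite addr0; split=> //.
  by apply: submodule0; apply: submodule_mulset; left.
have mchain n u v : m u -> chain n v -> chain n.+1 (u * v).
  move=> mu cv; exists 0, (u * v); rewrite add0r; split=> //; first exact: ideal0.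
  exact: mulset1.
suff {a mK} Hchain n x : x \in l -> chain n (r x).
  move=> x xl; have := Hchain a x xl.
  suff : chain a `<=` K by apply.
  elim: a K iK JK mK => [|a IHa] K iK JK /= mK.
    by move=> v _; rewrite -[v]mulr1; apply: idealM.
  move=> _ [j [v [Jj mv ->]]]; apply: idealD => //; first exact: JK.
  apply: (mulset_sub _ _ mv) => // u w mu cw.
  suff : [set x | K (u * x)] w by [].
  apply: IHa cw; last exact: mK.
    split=> [|y z Ky Kz|c y Ky] /=.
    - by rewrite mulr0; apply: ideal0.
    - by rewrite mulrDr; apply: idealD.
    - by rewrite [c *: y]/(c * y) mulrCA; apply: idealM.
  by move=> j' Jj' /=; apply: idealM => //; apply: JK.
elim: n x => [|n IHn] x xl //.
have [Q [p [pS p0]]] :=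
  quotient_ex (ichain n.+1 : submodule (chain n.+1 : set (R^o : lmodType R))).
have pE u v : chain n u -> m v -> p (u * v) = 0.
  by move=> cu mv; apply/p0; rewrite mulrC; apply: mchain.
have Xx := lX x xl.
(* Both sequences represent the same element of F. Modulo [chain n.+1] the right side vanishes
   because its coefficients are in J; on the left, where the r z are in [chain n], only r x
   survives. *)
have : \sum_(q <- [seq (r z, z) | z <- l]) p (q.1 * lam x q.2) =
       \sum_(q <- t) p (q.1 * lam x q.2).
  apply: (@flat_bilin (chain n) Q (fun u f => p (u * lam x f)) _ _ (ichain n)).
  - by move=> _ /mapP[z zl ->]; apply: IHn.
  - by move=> q /tJ [Jq _]; apply: Jchain.
  - by rewrite big_map.
  - move=> u cu c f f'; apply/eqP; rewrite -subr_eq0 -!linearP -linearB; apply/eqP.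
    rewrite /GRing.scale /=.
    have -> : u * lam x (c *: f + f') - (c * (u * lam x f) + u * lam x f') =
      u * (lam x (c *: f + f') - (c * lam x f + lam x f')) by ring.
    by apply: pE => //; apply: lamL.
  - by move=> f c u u' _ _; rewrite -linearP; congr (p _); rewrite /GRing.scale /=; ring.
rewrite big_map [X in _ = X]big_seq [X in _ = X]big1; last first.
  move=> q /tJ [Jq _]; apply/p0.
  by apply: idealMr; [exact: ichain|exact: Jchain].
rewrite (bigD1_seq x) //= big_seq_cond big1 => [|z /andP[zl zx]]; last first.
  have := lam1 x z Xx (lX z zl); rewrite eq_sym (negPf zx) subr0 => ?.
  by apply: pE => //; apply: IHn.
rewrite addr0 => plam.
have := lam1 x x Xx Xx; rewrite eqxx => /(pE (r x)) => /(_ (IHn x xl)).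
rewrite mulrBr mulr1 linearB plam sub0r => /eqP; rewrite oppr_eq0 => /eqP /p0.
exact.
Qed.

End FlatRelations.

(** * Bases of F/mF and their coordinates *)

Section ResidueBasis.
Variables (R : comPzRingType) (F : lmodType R) (m : set R).
Hypothesis mm : maximal_ideal m.
Implicit Types (X : set F) (l : seq F) (r : F -> R).

Let im : ideal m. Proof. by case: mm => -[]. Qed.

Lemma maximal_inverse a : ~ m a -> exists b c, m c /\ b * a + c = 1.
Proof.
move=> ma; have [_ mmax] := mm; apply: contrapT => no.
pose I := [set x | exists b c, m c /\ x = b * a + c].
have mI : m `<=` I by move=> c mc; exists 0, c; rewrite mul0r add0r.
have pI : proper_ideal I.
  split; last by move=> [b [c [mc E]]]; apply: no; exists b, c.
  split=> [|_ _ [b [c [mc ->]]] [b' [c' [mc' ->]]]|d _ [b [c [mc ->]]]].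
  - by apply: mI; apply: ideal0.
  - by exists (b + b'), (c + c'); rewrite mulrDl addrACA; split=> //; apply: idealD.
  - by exists (d * b), (d * c); rewrite -mulrA -mulrDr; split=> //; apply: idealM.
apply: ma; rewrite -(mmax I pI mI); exists 1, 0; rewrite mul1r addr0; split=> //.
exact: ideal0.
Qed.

(** The regrouped coefficients do not depend on [phi], so the same ones serve for a combination of
    basis elements in F and for that of their lifts in E. *)
Lemma uniq_comb (t : seq (R * F)) : exists l r,
  [/\ uniq l, forall x, x \notin l -> r x = 0, {subset l <= [seq q.2 | q <- t]} &
  forall (M : lmodType R) (phi : F -> M),
    \sum_(q <- t) q.1 *: phi q.2 = \sum_(x <- l) r x *: phi x].
Proof.
pose r x := \sum_(q <- t | q.2 == x) q.1.
exists (undup [seq q.2 | q <- t]), r; split=> [|x|x|M phi].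
- exact: undup_uniq.
- rewrite mem_undup => xt; rewrite /r big_seq_cond big1 // => q /andP[qt /eqP E].
  by case/mapP: xt; exists q.
- by rewrite mem_undup.
under [RHS]eq_bigr do rewrite scaler_suml big_mkcond.
rewrite exchange_big /= [LHS]big_seq [RHS]big_seq; apply: eq_bigr => q qt.
have q2 : q.2 \in undup [seq q.2 | q <- t] by rewrite mem_undup; apply: map_f.
rewrite (bigD1_seq q.2) ?undup_uniq //= eqxx big1 ?addr0 // => x.
by rewrite eq_sym => /negPf ->.
Qed.

Lemma comb_extend (M : lmodType R) (phi : F -> M) l l' r :
  uniq l -> uniq l' -> {subset l <= l'} -> (forall x, x \notin l -> r x = 0) ->
  \sum_(x <- l') r x *: phi x = \sum_(x <- l) r x *: phi x.
Proof.
move=> ul ul' ll' r0; rewrite (bigID (fun x => x \in l)) /= [X in _ + X]big1 ?addr0.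
  rewrite -big_filter; apply: perm_big; apply: uniq_perm => //; first exact: filter_uniq.
  by move=> x; rewrite mem_filter; case xl: (x \in l) => //=; apply: ll'.
by move=> x /r0 ->; rewrite scale0r.
Qed.

Let mF : set F := mulset m setT.
Let smF : submodule mF. Proof. by apply: submodule_mulset; left. Qed.

Definition indep X := forall l r, uniq l -> (forall x, x \in l -> X x) ->
  mF (\sum_(x <- l) r x *: x) -> forall x, x \in l -> m (r x).

Lemma maximal_indep : exists X, indep X /\ forall Y, X `<` Y -> ~ indep Y.
Proof.
apply: Zorn_bigcup => G Gind Gtot l r ul lX.
have [->//|[X [GX lX']]] : l = [::] \/ exists X, G X /\ forall x, x \in l -> X x.
  elim: {r ul} l lX => [|x l IHl] lX; first by left.
  right; have [X GX Xx] := lX x (mem_head x l).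
  have [z zl|l0|[Y [GY Yl]]] := IHl; first by apply: lX; rewrite inE zl orbT.
    by exists X; split=> // z; rewrite l0 inE => /eqP ->.
  have [XY|YX] := Gtot X Y GX GY.
    by exists Y; split=> // z; rewrite inE => /predU1P[->|/Yl//]; apply: XY.
  by exists X; split=> // z; rewrite inE => /predU1P[->//|/Yl]; apply: YX.
exact: (Gind X GX l r ul lX').
Qed.

(** A basis of F/mF over R/m. Coordinates are lifted to R arbitrarily, so [lam] is linear and dual
    to X only modulo m. *)
Lemma residue_basis : exists X (lam : F -> F -> R),
  [/\ forall f, exists h v, [/\ mulset setT X h, mulset m setT v & f = h + v],
      forall x c f f', X x -> m (lam x (c *: f + f') - (c * lam x f + lam x f'))
    & forall x x', X x -> X x' -> m (lam x x' - (x == x')%:R)].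
Proof.
have [X [indX maxX]] := maximal_indep.
have sX : submodule (mulset setT X) by apply: submodule_mulset; left.
have span f : exists h v, [/\ mulset setT X h, mF v & f = h + v].
  apply: contrapT => nf.
  have nXf : ~ X f.
    move=> Xf; apply: nf; exists f, 0; rewrite addr0; split=> //; last exact: submodule0.
    by rewrite -[f]scale1r; apply: mulset1.
  apply: (maxX (X `|` [set f])).
    split=> [x Xx|H]; first by left.
    by apply: nXf; apply: H; right.
  move=> l r ul lX lr.
  have [fl|fl] := boolP (f \in l); last first.
    apply: indX => // x xl; have [//|xf] := lX x xl.
    by move: fl; rewrite -xf xl.
  have remX x : x \in rem f l -> X x.
    by rewrite mem_rem_uniq // inE => /andP[xf /lX []//] E; rewrite E eqxx in xf.
  have lE : \sum_(x <- l) r x *: x = r f *: f + \sum_(x <- rem f l) r x *: x.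
    by rewrite (perm_big _ (perm_to_rem fl)) big_cons.
  (* Otherwise r f is invertible modulo m, and f is a combination of X modulo mF. *)
  have mrf : m (r f).
    apply: contrapT => /maximal_inverse [b [c [mc bc]]]; apply: nf.
    exists (- b *: \sum_(x <- rem f l) r x *: x), (b *: (\sum_(x <- l) r x *: x) + c *: f).
    split.
    - apply: submoduleZ => //; apply: submodule_sum => // x /remX Xx.
      exact: mulset1.
    - by apply: submoduleD => //; [apply: submoduleZ|apply: mulset1].
    - by rewrite lE scalerDr scalerA scaleNr addrAC -scalerDl bc scale1r addrC addKr.
  have mrem : mF (\sum_(x <- rem f l) r x *: x).
    have mf : mF (r f *: f) by apply: mulset1.
    by have := submoduleB smF lr mf; rewrite lE addrAC subrr add0r.
  move=> x xl; have [->//|xf] := eqVneq x f.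
  apply: (indX (rem f l) r _ remX mrem); first exact: rem_uniq.
  by rewrite mem_rem_uniq // inE xf.
have comb f : exists lr : seq F * (F -> R), [/\ uniq lr.1,
    forall x, x \notin lr.1 -> lr.2 x = 0, forall x, x \in lr.1 -> X x
    & mF (f - \sum_(x <- lr.1) lr.2 x *: x)].
  have [h [v [[t [tX ->]] mv ->]]] := span f.
  have [l [r [ul r0 lt lr]]] := uniq_comb t.
  exists (l, r); split=> //= [x /lt /mapP[q /tX[_ Xq] ->] //|].
  by rewrite (lr _ id) addrC addKr.
have [g gP] := choice comb.
(* Uniqueness of coordinates modulo m, by independence over the union of the three supports. It
   yields both the linearity of [lam] and its values on X. *)
have coef a l1 r1 l2 r2 l3 r3 :
    uniq l1 -> uniq l2 -> uniq l3 -> (forall x, x \notin l1 -> r1 x = 0) ->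
    (forall x, x \notin l2 -> r2 x = 0) -> (forall x, x \notin l3 -> r3 x = 0) ->
    (forall x, x \in l1 -> X x) -> (forall x, x \in l2 -> X x) ->
    (forall x, x \in l3 -> X x) ->
    mF (\sum_(x <- l3) r3 x *: x -
       (a *: (\sum_(x <- l1) r1 x *: x) + \sum_(x <- l2) r2 x *: x)) ->
    forall x, m (r3 x - (a * r1 x + r2 x)).
  move=> u1 u2 u3 z1 z2 z3 X1 X2 X3.
  pose L := undup (l1 ++ l2 ++ l3); have uL : uniq L by apply: undup_uniq.
  rewrite -(@comb_extend F id l1 L) // => [|x xl]; last first.
    by rewrite mem_undup !mem_cat xl.
  rewrite -(@comb_extend F id l2 L) // => [|x xl]; last first.
    by rewrite mem_undup !mem_cat xl orbT.
  rewrite -(@comb_extend F id l3 L) // => [|x xl]; last first.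
    by rewrite mem_undup !mem_cat xl !orbT.
  rewrite scaler_sumr -big_split -sumrB /= => mS x.
  have [xL|] := boolP (x \in L); last first.
    rewrite mem_undup !mem_cat !negb_or => /and3P[/z1 -> /z2 -> /z3 ->].
    by rewrite mulr0 addr0 subrr; apply: ideal0.
  apply: (indX L (fun x => r3 x - (a * r1 x + r2 x)) uL) xL => [z|].
    by rewrite mem_undup !mem_cat => /or3P[/X1|/X2|/X3].
  rewrite (eq_bigr (fun i => r3 i *: i - (a *: (r1 i *: i) + r2 i *: i))) // => i _.
  by rewrite scalerBl scalerDl scalerA.
exists X, (fun x f => (g f).2 x); split=> [//|x c f f' Xx|x x' Xx Xx'].
  have [u1 z1 X1 S1] := gP f; have [u2 z2 X2 S2] := gP f'.
  have [u3 z3 X3 S3] := gP (c *: f + f').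
  apply: (coef c _ _ _ _ _ _ u1 u2 u3 z1 z2 z3 X1 X2 X3).
  set s1 := \sum_(x <- (g f).1) _ in S1 *; set s2 := \sum_(x <- (g f').1) _ in S2 *.
  set s3 := \sum_(x <- (g (c *: f + f')).1) _ in S3 *.
  have -> : s3 - (c *: s1 + s2) = (c *: (f - s1) + (f' - s2)) - (c *: f + f' - s3).
    by rewrite scalerBr addrACA -opprD opprB [RHS]addrC addrA subrK.
  by apply: submoduleB => //; apply: submoduleD => //; apply: submoduleZ.
have [u3 z3 X3 S3] := gP x'.
have mx : m ((x == x')%:R - (0 * 0 + (g x').2 x)).
  apply: (@coef 0 [::] (fun=> 0) (g x').1 (g x').2 [:: x'] (fun z => (z == x')%:R)) => //.
  - by move=> z; rewrite inE => /negPf ->.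
  - by move=> z; rewrite inE => /eqP ->.
  - by rewrite big_nil big_seq1 eqxx scale1r scaler0 add0r.
by rewrite -opprB -mulN1r; apply: idealM => //; move: mx; rewrite mulr0 add0r.
Qed.

End ResidueBasis.

(** * Splitting of extensions of flat modules by m-contramodules *)

Section ContramoduleCotorsion.
Variables (R : comPzRingType) (m : set R) (s y : R) (a : nat).
Hypotheses (mm : maximal_ideal m)
  (ann_s : forall x, s * s * x = 0 -> s * x = 0)
  (m_s : prodin (nseq a m) [set x | exists r, y * x = s * s * r]).

Let im : ideal m. Proof. by case: mm => -[]. Qed.

Section Module.
Variable C : lmodType R.
Hypotheses (yI : forall c : C, y *: c = 0 -> c = 0) (yS : forall c : C, exists d, y *: d = c)
  (sC : solvable C s) (sepC : separated s ([set 0] : set C)).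

Let yXI k (c : C) : y ^+ k *: c = 0 -> c = 0.
Proof.
elim: k => [|k IHk]; first by rewrite scale1r.
by rewrite exprS -scalerA => /yI.
Qed.

Let yXS k (c : C) : exists d, y ^+ k *: d = c.
Proof.
elim: k c => [|k IHk] c; first by exists c; rewrite scale1r.
have [d <-] := yS c; have [e <-] := IHk d.
by exists e; rewrite scalerA exprS.
Qed.

(** Dividing c_n by y^(kn), which is possible on C, turns the sequence into an s-divisible one. *)
Let divisible0 k (c : nat -> C) : (forall n, y ^+ k *: c n = s *: c n.+1) -> c 0%N = 0.
Proof.
move=> cE; have [d dE] := choice (fun n => yXS (k * n) (c n)).
have d0 : d 0%N = 0.
  apply: sepC; exists d; split=> // n; apply/eqP; rewrite subr_eq0; apply/eqP.
  apply/eqP; rewrite -subr_eq0; apply/eqP; apply: (@yXI (k * n.+1)).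
  rewrite scalerBr {1}mulnS exprD -scalerA dE scalerA mulrC -scalerA dE cE.
  by rewrite subrr.
by rewrite -(dE 0%N) d0 scaler0.
Qed.

(** With b_n = y^(n+1) d_n and z a solution of the s-system for the d_n, take c_n = y^n z_n. *)
Let twisted_solvable (b : nat -> C) : exists c, forall n, y *: c n - s *: c n.+1 = b n.
Proof.
have [d dE] := choice (fun n => yXS n.+1 (b n)).
have [z zE] := sC d; exists (fun n => y ^+ n *: z n) => n.
rewrite -(dE n) -zE scalerBr !scalerA -exprS mulrC.
by [].
Qed.

Let K : set R := [set x | exists r, y * x = s * r].
Let K2 : set R := [set x | exists r, y * x = s * s * r].

Let iK : ideal K.
Proof.
split=> [|x z [r E] [r' E']|b x [r E]].
- by exists 0; rewrite !mulr0.
- by exists (r + r'); rewrite !mulrDr E E'.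
- by exists (b * r); rewrite [b *: x]/(b * x) mulrCA E mulrCA.
Qed.

Let iK2 : ideal K2.
Proof.
split=> [|x z [r E] [r' E']|b x [r E]].
- by exists 0; rewrite !mulr0.
- by exists (r + r'); rewrite !mulrDr E E'.
- by exists (b * r); rewrite [b *: x]/(b * x) mulrCA E mulrCA.
Qed.

Let m_K : prodin (nseq a m) K.
Proof. by apply: prodin_sub m_s => x [r E]; exists (s * r); rewrite E mulrA. Qed.

Lemma ext_split_flat (F : lmodType R) : flat F -> ext_split F C.
Proof.
move=> flatF E i p iI pS ip.
have [X [lam [span lamL lam1]]] := residue_basis F mm.
pose H := mulset setT X.
have sH : submodule H by apply: submodule_mulset; left.
(* F = H + mF is substituted into itself a times, replacing the ideal by its colon with an element
   of m at each step. *)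
have spanK : forall f, exists h v, [/\ H h, mulset K setT v & f = h + v].
  elim: a K iK m_K => [|b IHb] J iJ mJ f.
    exists 0, f; rewrite add0r; split=> //; first exact: submodule0.
    by rewrite -[f]scale1r; apply: mulset1.
  have [h [v [Hh [t [tm ->]] ->]]] := span f.
  have sHJ : submodule [set f | exists h v, [/\ H h, mulset J setT v & f = h + v]].
    have sJ : submodule (mulset J (setT : set F)) by apply: submodule_mulset; left.
    split=> [|_ _ [h1 [v1 [H1 J1 ->]]] [h2 [v2 [H2 J2 ->]]]|c _ [h1 [v1 [H1 J1 ->]]]].
    - by exists 0, 0; rewrite addr0; split=> //; apply: submodule0.
    - by exists (h1 + h2), (v1 + v2); rewrite addrACA; split=> //; apply: submoduleD.
    - by exists (c *: h1), (c *: v1); rewrite scalerDr; split=> //; apply: submoduleZ.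
  apply: (submoduleD sHJ).
    exists h, 0; rewrite addr0; split=> //.
    by apply: submodule0; apply: submodule_mulset; left.
  apply: (submodule_sum sHJ) => q /tm [mq _].
  have [||h' [v' [Hh' Jv' ->]]] := IHb [set x | J (q.1 * x)] _ _ q.2.
  - split=> [|x z Jx Jz|c x Jx] /=.
    + by rewrite mulr0; apply: ideal0.
    + by rewrite mulrDr; apply: idealD.
    + by rewrite [c *: x]/(c * x) mulrCA; apply: idealM.
  - exact: mJ.
  exists (q.1 *: h'), (q.1 *: v'); rewrite scalerDr; split=> //; first exact: submoduleZ.
  case: Jv' => t' [t'J ->]; rewrite scaler_sumr; apply: submodule_sum.
    by apply: submodule_mulset; left.
  by move=> q' /t'J [Jq' _]; rewrite scalerA; apply: mulset1.
have annF (f : F) : s *: (s *: f) = 0 -> s *: f = 0.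
  rewrite scalerA => /(flat_ann flatF) [t [tA ->]].
  rewrite scaler_sumr big_seq big1 // => q /tA [/ann_s sq _].
  by rewrite scalerA sq scale0r.
have [sig sigE] := choice pS.
pose HE := mulset setT (sig @` X).
have sHE : submodule HE by apply: submodule_mulset; left.
have liftH f : H f -> exists e, HE e /\ p e = f.
  case=> t [tX ->]; exists (\sum_(q <- t) q.1 *: sig q.2); split.
    by apply: submodule_sum => // q /tX [_ Xq]; apply: mulset1 => //; exists q.2.
  by rewrite linear_sum; apply: eq_bigr => q _; rewrite linearZ sigE.
have pHE e : HE e -> H (p e).
  case=> t [tX ->]; rewrite linear_sum; apply: submodule_sum => // q /tX [_ [x Xx <-]].
  by rewrite linearZ /= sigE; apply: mulset1.
have HE0 c : HE (i c) -> c = 0.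
  case=> t [tX icE].
  have [g gE] : exists g : E -> F, forall q, q \in t -> X (g q.2) /\ sig (g q.2) = q.2.
    have [e|g gE] := @choice E F (fun e x => (sig @` X) e -> X x /\ sig x = e).
      have [[x Xx <-]|?] := pselect ((sig @` X) e); [by exists x|by exists 0].
    by exists g => q /tX [_ /gE].
  have [l [r [ul r0 lt lr]]] := uniq_comb [seq (q.1, g q.2) | q <- t].
  have lX x : x \in l -> X x.
    by move=> /lt; rewrite -map_comp => /mapP[q /gE [Xq _] ->].
  have icE' : i c = \sum_(x <- l) r x *: sig x.
    rewrite -lr big_map icE [LHS]big_seq [RHS]big_seq; apply: eq_bigr => q /gE [_ ->].
    by [].
  pose P (r : F -> R) := \sum_(x <- l) r x *: x = 0.
  have Pr : P r.
    have : p (i c) = 0 by apply/ip; exists c.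
    rewrite icE' linear_sum => E0; rewrite /P -[RHS]E0.
    by apply: eq_bigr => x _; rewrite linearZ /= sigE.
  (* The coefficients of a relation u lie in [K2], so y u = s^2 v. Then s^2 kills the sum of the v_x
     x, hence so does s by [annF], and s v is again a relation, with y u = s (s v). Iteration makes
     c infinitely divisible by s/y. *)
  have [u uP|f [f0 fE]] := @iterated_choice (F -> R) P
      (fun u v => forall x, x \in l -> y * u x = s * v x) _ r Pr.
    rewrite /P in uP; have Ku x : x \in l -> K2 (u x).
      apply: (flat_indep flatF im lamL lam1 (J := [set 0])) => //.
      - exact: (@submodule_set0 R R^o).
      - by move=> _ ->; apply: ideal0.
      - exact: m_s.
      - by rewrite uP; apply: submodule0; apply: submodule_mulset; right.
    have [x|v vE] := @choice F R (fun x v => x \in l -> y * u x = s * s * v).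
      by have [/Ku [v E']|] := boolP (x \in l); [exists v|exists 0].
    exists (fun x => s * v x); split; last by move=> x xl; rewrite vE // mulrA.
    rewrite /P.
    have -> : \sum_(x <- l) (s * v x) *: x = s *: (\sum_(x <- l) v x *: x).
      by rewrite scaler_sumr; apply: eq_bigr => x _; rewrite scalerA.
    apply: annF; rewrite scalerA scaler_sumr.
    transitivity (y *: (\sum_(x <- l) u x *: x)); last by rewrite uP scaler0.
    rewrite scaler_sumr big_seq [RHS]big_seq; apply: eq_bigr => x xl.
    by rewrite !scalerA vE.
  have [n|d dE] := @choice nat C (fun n d => i d = \sum_(x <- l) f n x *: sig x).
    apply/ip; rewrite linear_sum -[RHS](proj1 (fE n)); apply: eq_bigr => x _.
    by rewrite linearZ /= sigE.
  have -> : c = d 0%N by apply: iI; rewrite dE f0.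
  apply: (@divisible0 1) => n; apply: iI; rewrite !linearZ !dE /= expr1 !scaler_sumr.
  rewrite big_seq [RHS]big_seq; apply: eq_bigr => x xl.
  by rewrite !scalerA (proj2 (fE n)).
(* On F/H, s is injective up to y^2. One factor y makes the coefficients of s f divisible by s and
   moves f into H + Ann(s) F. *)
have divH f : H (s *: f) -> H (y ^+ 2 *: f).
  move=> [t [tX sfE]].
  have [l [r [ul r0 lt lr]]] := uniq_comb t.
  have lX x : x \in l -> X x by move=> /lt /mapP[q /tX[_ Xq] ->].
  have sfE' : s *: f = \sum_(x <- l) r x *: x by rewrite sfE; exact: (lr _ id).
  pose J := [set x | exists r, x = s * r].
  have Kr x : x \in l -> K (r x).
    apply: (flat_indep flatF im lamL lam1 (J := J)) => //.
    - split=> [|_ _ [u ->] [v ->]|c _ [u ->]].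
      + by exists 0; rewrite mulr0.
      + by exists (u + v); rewrite mulrDr.
      + by exists (c * u); rewrite mulrCA.
    - by move=> _ [u ->]; exists (y * u); rewrite mulrCA.
    - exact: m_K.
    - by rewrite -sfE'; apply: mulset1 => //; exists 1; rewrite mulr1.
  have [x|v vE] := @choice F R (fun x v => x \in l -> y * r x = s * v).
    by have [/Kr [v E']|] := boolP (x \in l); [exists v|exists 0].
  pose h := \sum_(x <- l) v x *: x.
  have Hh : H h by apply: submodule_sum => // x /lX Xx; apply: mulset1.
  have : s *: (y *: f - h) = 0.
    rewrite scalerBr scalerA mulrC -scalerA sfE' !scaler_sumr; apply/eqP.
    rewrite subr_eq0; apply/eqP; rewrite big_seq [RHS]big_seq; apply: eq_bigr => x xl.
    by rewrite !scalerA vE.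
  (* The second factor y: as F = H + KF and yK <= sR, the part in Ann(s) K F is killed by y. *)
  move=> /(flat_ann flatF) [t' [t'A yfh]].
  have Hyh : H (y *: (y *: f - h)).
    rewrite yfh scaler_sumr; apply: submodule_sum => // q /t'A [/= sq _].
    have [h' [_ [Hh' [t2 [t2K ->]] ->]]] := spanK q.2.
    rewrite !scalerDr; apply: submoduleD => //.
      exact: (submoduleZ _ sH (submoduleZ _ sH Hh')).
    rewrite !scaler_sumr; apply: submodule_sum => // q' /t2K [[w wE] _].
    rewrite !scalerA (_ : y * q.1 * q'.1 = 0) ?scale0r; first exact: submodule0.
    by rewrite mulrAC wE mulrAC sq mul0r.
  rewrite expr2 -scalerA -[y *: f](subrK h) scalerDr; apply: submoduleD => //.
  exact: submoduleZ.
(* [rho e c] expresses that e - i c is infinitely divisible by s/y in E/HE; as C is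
   an s/y-contramodule, rho is the graph of the retraction. *)
pose rho e c := exists e_ : nat -> E, e_ 0%N = e - i c /\
  forall n, HE (y *: e_ n - s *: e_ n.+1).
have [e|c [e_ [e0 eH]]|b e e' c c' [u [u0 uH]] [v [v0 vH]]|rr rrE] :=
    @linmap_of_rel R E C rho.
(* Totality: as F = H + KF and yK <= sR, elements of F/H can be divided by s/y, starting from p e.
   Lifted to E, the equations hold modulo HE up to errors b_n in C, which [twisted_solvable]
   absorbs. *)
- have [f _|f [f0 fE]] := @iterated_choice F setT (fun f f' => H (y *: f - s *: f')) _ (p e) I.
    have [h [v [Hh [t [tK ->]] ->]]] := spanK f.
    have [q0|w wE] := @choice (R * F) R (fun q w => q \in t -> y * q.1 = s * w).
      by have [/tK [[w E'] _]|] := boolP (q0 \in t); [exists w|exists 0].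
    exists (\sum_(q <- t) w q *: q.2); split=> //.
    rewrite scalerDr -addrA !scaler_sumr (_ : _ - _ = 0) ?addr0; first exact: submoduleZ.
    apply/eqP; rewrite subr_eq0; apply/eqP; rewrite big_seq [RHS]big_seq.
    by apply: eq_bigr => q qt; rewrite !scalerA wE.
  pose e1 n := if n is 0%N then e else sig (f n).
  have pe1 n : p (e1 n) = f n by case: n => [|n]; rewrite /e1 ?f0 ?sigE.
  have [n|b bE] := @choice nat C (fun n b => HE (y *: e1 n - s *: e1 n.+1 - i b)).
    have [h [HEh ph]] := liftH _ (proj2 (fE n)).
    have [b bE] : exists b, i b = y *: e1 n - s *: e1 n.+1 - h.
      by apply/ip; rewrite !(linmapB p) !(linmapZ p) !pe1 ph subrr.
    by exists b; rewrite bE subKr.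
  have [c cE] := twisted_solvable b; exists (c 0%N), (fun n => e1 n - i (c n)); split=> // n.
  have -> : y *: (e1 n - i (c n)) - s *: (e1 n.+1 - i (c n.+1)) =
     y *: e1 n - s *: e1 n.+1 - i (b n).
    by rewrite -cE (linmapB i) !(linmapZ i) !scalerBr subr_swap.
  exact: bE.
(* Uniqueness: each division by s costs y^2 by [divH], so y^(2n) e_n lies over H and is some d_n of
   C modulo HE. Multiplied by y^(2n+2), the relation between e_n and e_(n+1) becomes y^3 d_n = s
   d_(n+1), whence the exponent 3 below. *)
- have Hn n : H (y ^+ (2 * n) *: p (e_ n)).
    elim: n => [|n IHn].
      rewrite scale1r e0 linearB linear0 sub0r (proj2 (ip (i c))) ?oppr0; last by exists c.
      exact: submodule0.
    rewrite mulnS exprD -scalerA;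
    apply: divH; rewrite scalerA mulrC -scalerA.
    have /pHE := eH n; rewrite (linmapB p) !(linmapZ p) => H1.
    have H2 : H (y *: (y ^+ (2 * n) *: p (e_ n))) by apply: submoduleZ.
    have := submoduleB sH H2 (submoduleZ (y ^+ (2 * n)) sH H1).
    by rewrite scalerBr opprB !scalerA [y * _]mulrC addrC subrK.
  have [n|d dE] := @choice nat C (fun n d => HE (y ^+ (2 * n) *: e_ n - i d)).
    have [h [HEh ph]] := liftH _ (Hn n).
    have [d dE] : exists d, i d = y ^+ (2 * n) *: e_ n - h.
      by apply/ip; rewrite (linmapB p) (linmapZ p) ph subrr.
    by exists d; rewrite dE subKr.
  have d0 : d 0%N = 0.
    apply: (@divisible0 3) => n; apply/eqP; rewrite -subr_eq0; apply/eqP; apply: HE0.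
    rewrite (linmapB i) !(linmapZ i).
    set k := y ^+ (2 * n).
    have -> : y ^+ 3 *: i (d n) - s *: i (d n.+1) =
      (y ^+ 2 * k) *: (y *: e_ n - s *: e_ n.+1) -
      (y ^+ 3 *: (k *: e_ n - i (d n)) - s *: (y ^+ (2 * n.+1) *: e_ n.+1 - i (d n.+1))).
      rewrite mulnS exprD -/k !scalerBr !scalerA.
      have -> : y ^+ 2 * k * y = y ^+ 3 * k by rewrite !exprS; ring.
      have -> : s * (y ^+ 2 * k) = y ^+ 2 * k * s by ring.
      by rewrite [RHS]subr_swap !subKr.
    apply: (submoduleB sHE); first exact: (submoduleZ _ sHE (eH n)).
    exact: (submoduleB sHE (submoduleZ _ sHE (dE n)) (submoduleZ _ sHE (dE n.+1))).
  have := dE 0%N; rewrite scale1r e0 d0 linear0 subr0 sub0r.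
  by move/(submoduleN sHE); rewrite opprK => /HE0.
- exists (fun n => b *: u n + v n); split=> [|n].
    by rewrite u0 v0 linearP scalerBr opprD addrACA.
  rewrite !scalerDr opprD addrACA !scalerA [y * b]mulrC [s * b]mulrC -!scalerA -scalerBr.
  by apply: submoduleD => //; apply: submoduleZ.
exists rr => c; apply/rrE; exists (fun=> 0); rewrite subrr; split=> // n.
by rewrite !scaler0 subrr; apply: submodule0.
Qed.

End Module.
End ContramoduleCotorsion.

(** * Decomposition of reduced cotorsion modules *)

Section Contramodules.
Variable R : comPzRingType.
Implicit Types (C X Y Z : lmodType R) (m I S : set R).

Lemma I_contramoduleP I C : @I_contramodule R I C <->
  forall u, I u -> separated u ([set 0] : set C) /\ solvable C u.
Proof. by split=> H u Iu; apply/s_contramoduleP; apply: H. Qed.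

(** Some multiple bu is 1 - v with v in m, and the geometric series in v converges on C: solvability
    gives its sums, separatedness the independence of shifts. *)
Lemma contramodule_unit m C u : maximal_ideal m -> @I_contramodule R m C -> ~ m u ->
  (forall c : C, u *: c = 0 -> c = 0) /\ (forall c : C, exists d, u *: d = c).
Proof.
move=> mm /I_contramoduleP mC mu.
have [b [v [mv bv]]] := maximal_inverse mm mu; have [sepv solv] := mC v mv.
split=> [c uc|c].
  apply: sepv; exists (fun=> c); split=> // _ /=.
  by rewrite -{1}[c]scale1r -bv scalerDl addrK -scalerA uc scaler0.
have [z zE] := solv (fun=> c); exists (b *: z 0%N).
have z01 : z 0%N - z 1%N = 0.
  apply: sepv; exists (fun n => z n - z n.+1); split=> // n /=.
  by rewrite scalerBr subr_swap !zE subrr.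
rewrite scalerA mulrC -(zE 0%N); have -> : z 1%N = z 0%N.
  by apply/esym/eqP; rewrite -subr_eq0 z01.
rewrite -{2}[z 0%N]scale1r -scalerBl; congr (_ *: _).
by rewrite -bv addrK.
Qed.

Lemma cotorsionP C : @cotorsion R C <-> forall F, flat F -> ext_split F C.
Proof. by split=> H F /H /Ext1_eq0P. Qed.

Lemma S_reducedP S C : @S_reduced R S C <-> forall B : set C, submodule B ->
  (forall s b, S s -> B b -> exists d, B d /\ b = s *: d) -> forall b, B b -> b = 0.
Proof.
split=> [red B sB divB b Bb|red B sB divB].
  suff B0 : B = [set 0] by rewrite B0 in Bb.
  apply: red => // s Ss; apply/seteqP; split=> [_ [d Bd <-]|d Bd].
    exact: submoduleZ.
  by have [d' [Bd' ->]] := divB s d Ss Bd; exists d'.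
apply/seteqP; split=> [b Bb|_ ->]; last exact: submodule0.
apply: (red B) Bb => // s {}b Ss Bb; rewrite -(divB s Ss) in Bb.
by case: Bb => d Bd <-; exists d.
Qed.

(** Joint injectivity is all that is needed, so the same statement serves [dprod], modules that are
    products only by universal property, and isomorphic copies. *)
Lemma S_reduced_joint S (I : Type) (X : I -> lmodType R) Y
    (p : forall i, linmap Y (X i)) :
  (forall y, (forall i, p i y = 0) -> y = 0) ->
  (forall i, @S_reduced R S (X i)) -> @S_reduced R S Y.
Proof.
move=> pI redX; apply/S_reducedP => B sB divB b Bb; apply: pI => i.
apply: (proj1 (S_reducedP _ _) (redX i) [set p i b | b in B]); last by exists b.
  exact: submodule_image.
move=> s _ Ss [d Bd <-]; have [d' [Bd' ->]] := divB s d Ss Bd.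
by exists (p i d'); split; [exists d'|rewrite linmapZ].
Qed.

Lemma ext_split_joint F (I : Type) (X : I -> lmodType R) Y
    (p : forall i, linmap Y (X i)) :
  (forall y, (forall i, p i y = 0) -> y = 0) ->
  (forall W (w : forall i, linmap W (X i)), exists u : linmap W Y,
     forall i x, p i (u x) = w i x) ->
  (forall i, ext_split F (X i)) -> ext_split F Y.
Proof.
move=> pI pU FX E j q jI qS jq.
have r i : {g : linmap E (X i) | forall y, g (j y) = p i y}.
  by apply: cid; apply: ext_split_extend (FX i) jI qS jq.
have [u uE] := pU E (fun i => sval (r i)); exists u => y.
apply/eqP; rewrite -subr_eq0; apply/eqP/pI => i.
by rewrite linmapB uE (svalP (r i)) subrr.
Qed.

Lemma dprod_proj (I : Type) (X : I -> lmodType R) i :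
  exists p : linmap (dprod X) (X i), forall x, p x = x i.
Proof. by apply: (@linmap_of_linear R (dprod X) (X i) (fun x => x i)). Qed.

Lemma dprod_tuple (I : Type) (X : I -> lmodType R) W (w : forall i, linmap W (X i)) :
  exists u : linmap W (dprod X), forall x i, u x i = w i x.
Proof.
have [a x y|u uE] := @linmap_of_linear R W (dprod X) (fun x i => w i x).
  by apply: functional_extensionality_dep => i; rewrite linearP.
by exists u => x i; rewrite uE.
Qed.

Lemma dprod_ext_split F (I : Type) (X : I -> lmodType R) :
  (forall i, ext_split F (X i)) -> ext_split F (dprod X).
Proof.
pose p i := sval (cid (dprod_proj X i)).
have pE i x : p i x = x i by exact: (svalP (cid (dprod_proj X i))).
apply: (ext_split_joint (p := p)) => [y y0|W w].
  by apply: functional_extensionality_dep => i; rewrite -pE y0.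
by have [u uE] := dprod_tuple w; exists u => i x; rewrite pE uE.
Qed.

Lemma dprod_reduced S (I : Type) (X : I -> lmodType R) :
  (forall i, @S_reduced R S (X i)) -> @S_reduced R S (dprod X).
Proof.
pose p i := sval (cid (dprod_proj X i)).
have pE i x : p i x = x i by exact: (svalP (cid (dprod_proj X i))).
apply: (S_reduced_joint (p := p)) => y y0.
by apply: functional_extensionality_dep => i; rewrite -pE y0.
Qed.

Lemma S_reduced_cotorsion_iso S X Y (h : linmap X Y) : injective h -> surjective h ->
  @S_reduced_cotorsion R S X -> @S_reduced_cotorsion R S Y.
Proof.
move=> hI hS [redX /cotorsionP cotX]; have [g [hK gK]] := linear_inverse hI hS.
split; last by apply/cotorsionP => F /cotX; apply: ext_split_iso hI hS.
apply: (@S_reduced_joint S unit (fun=> X) Y (fun=> g)) => // y /(_ tt) gy.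
by rewrite -(gK y) gy linear0.
Qed.

End Contramodules.

Section Decomposition.
Variables (R : comPzRingType) (P0 P1 : set (set R)).
Hypotheses (noeth : noetherian R) (dec : spec_decomposition P0 P1).
Implicit Types (C X Y Z : lmodType R).

Let S := mult_subset P0.
Let mx m : P1 m -> maximal_ideal m := @P1_maximal R P0 P1 dec m.

Lemma contramodule_reduced m C : P1 m -> @I_contramodule R m C -> @S_reduced R S C.
Proof.
move=> Pm /I_contramoduleP mC; have [s [ms Ss]] := P1_meets_S noeth dec Pm.
apply/S_reducedP => B sB divB b Bb; have [sepS _] := mC s ms.
apply: sepS; apply: divset_step Bb => x Bx.
by have [d [Bd ->]] := divB s x Ss Bx; exists d; rewrite subrr.
Qed.

Lemma contramodule_cotorsion m C : P1 m -> @I_contramodule R m C -> @cotorsion R C.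
Proof.
move=> Pm mC; have mm := mx Pm; apply/cotorsionP => F flatF.
have [s [y [a [ms ann my ms2]]]] := local_parameter noeth dec Pm.
have [yI yS] := contramodule_unit mm mC my.
move/I_contramoduleP: mC => /(_ s ms) [sepS solS].
exact: (ext_split_flat mm ann ms2 yI yS solS sepS flatF).
Qed.

Lemma dprod_S_reduced_cotorsion (D : {m | P1 m} -> lmodType R) :
  (forall m, @I_contramodule R (sval m) (D m)) -> @S_reduced_cotorsion R S (dprod D).
Proof.
move=> Dm; split.
  by apply: dprod_reduced => m; apply: contramodule_reduced (Dm m); apply: svalP.
apply/cotorsionP => F flatF; apply: dprod_ext_split => m.
have := contramodule_cotorsion (svalP m) (Dm m).
by move/cotorsionP; apply.
Qed.

Lemma contramodule_quotient m C : (forall u, solvable C u) ->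
  exists Q (p : linmap C Q), [/\ @I_contramodule R m Q, surjective p &
    forall x, p x = 0 <-> core m x].
Proof.
move=> adj; have [Q [p [pS p0]]] := quotient_ex (submodule_core C m).
exists Q, p; split=> //; apply/I_contramoduleP => u mu; split=> [_ [c [<-]]|b].
  have [d dE] := choice (fun n => pS (c n)); move=> cE.
  rewrite -dE; apply/p0; apply: (@core_sep R C m u mu); exists d; split=> // n.
  by apply/p0; rewrite linmapB linmapZ !dE; apply: cE.
have [d dE] := choice (fun n => pS (b n)).
have [c cE] := adj u d; exists (fun n => p (c n)) => n.
by rewrite -linmapZ -linmapB cE dE.
Qed.

Section Components.
Variable C : lmodType R.
Hypotheses (redC : @S_reduced R S C) (cotC : @cotorsion R C).

Let adj u : solvable C u. Proof. exact: cotorsion_solvable cotC. Qed.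

Variables (D : {m | P1 m} -> lmodType R) (p : forall m, linmap C (D m)).
Hypotheses (Dm : forall m, @I_contramodule R (sval m) (D m))
  (pS : forall m, surjective (p m)) (p0 : forall m x, p m x = 0 <-> core (sval m) x).

Let div s := divset s ([set 0] : set C).

Let div_core m s x : m s -> div s x -> core m x.
Proof.
move=> ms sx B sB mB; apply: (mB s ms); apply: divset_sub sx => _ ->.
exact: submodule0.
Qed.

Let div_core_p m s x : sval m s -> div s x -> p m x = 0.
Proof. by move=> ms sx; apply/p0; apply: div_core ms sx. Qed.

Let unit_D m s x : ~ sval m s -> s *: x = 0 -> x = 0 :> D m.
Proof. by move=> ms; apply: (proj1 (contramodule_unit (mx (svalP m)) (@Dm m) ms)). Qed.

(** For u in all members of l a power of u lies in sR. As [divset s] of 0 is s-separated, it is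
    u-separated, and [core_inter] applies to it. *)
Let support s : S s -> exists l, [/\ forall m, List.In m l -> P1 m,
  forall m, P1 m -> m s -> List.In m l &
  forall x, (forall m, List.In m l -> core m x) -> div s x].
Proof.
move=> Ss; have [l [lP lS lI]] := S_prodin noeth dec Ss; exists l; split=> // x.
apply: core_inter => // [m /lP /mx //||u ul].
  exact/submodule_divset/submodule_set0.
have [r E] := prodin_expr lI ul; have s0 := submodule_set0 C.
apply: (separated_exp (k := size l)); first exact: submodule_divset.
rewrite E mulrC; apply: separated_mul; first exact: submodule_divset.
exact: separated_divset_self.
Qed.

(** The kernel is S-divisible: by [support] its elements are s-divisible, and a first quotient by s
    dies in D m because it is s-divisible if s is in m, because s is injective there otherwise. *)
Let component_inj x : (forall m, p m x = 0) -> x = 0.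
Proof.
apply: (proj1 (S_reducedP _ _) redC [set x | forall m, p m x = 0]).
  split=> [m|y z py pz m|a y py m]; first by rewrite linear0.
    by rewrite linearD py pz addr0.
  by rewrite linmapZ py scaler0.
move=> s y Ss py; have [l [lP lS lD]] := support Ss.
have [c [c0 cE]] : div s y.
  by apply: lD => m /lP Pm; apply/(p0 (exist _ m Pm)).
have yE : y = s *: c 1%N by apply/eqP; rewrite -c0 -subr_eq0; apply/eqP/cE.
exists (c 1%N); split=> // m; have [ms|ms] := pselect (sval m s).
  by apply: div_core_p ms _; apply: divset_shift.
by apply: (unit_D ms); rewrite -linmapZ -yE py.
Qed.

Let finite_surj l (d : dprod D) : (forall m, List.In m l -> P1 m) ->
  exists c, forall m, List.In (sval m) l -> p m c = d m.
Proof.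
elim: l => [_|m l IHl lP]; first by exists 0.
have [m' m'l|c cE] := IHl; first by apply: lP; right.
have [ml|ml] := pselect (List.In m l).
  by exists c => m' [E|]; apply: cE => //; rewrite -E.
have Pm : P1 m by apply: lP; left.
have [|e [f [me lf ef]]] := maximal_crt (mx Pm) (l := l) _ ml.
  by move=> m' m'l; apply/mx/lP; right.
have [c1 c1E] := pS (d (exist _ m Pm)).
(* The e-divisible part a vanishes at m and the f-divisible part b at the members of l, so adding b
   to c changes only the component at m, to that of c1. *)
have [a [b [Da Db ab]]] := divset_cover adj (submodule_set0 C) ef (c1 - c).
exists (c + b) => -[m' Pm'] /= [E|m'l].
  move: Pm'; rewrite -E => Pm'; rewrite (Prop_irrelevance Pm' Pm) -c1E.
  have c1ab : c1 = a + b + c by rewrite -ab subrK.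
  have -> : c + b = c1 - a by rewrite c1ab -[a + b + c]addrA addrAC subrr add0r addrC.
  by rewrite linmapB (div_core_p (m := exist _ m Pm) me Da) subr0.
rewrite linearD (div_core_p (m := exist _ m' Pm') _ Db) ?addr0; last exact: lf.
exact: cE.
Qed.

Lemma components_bijective (phi : linmap C (dprod D)) :
  (forall c m, phi c m = p m c) -> injective phi /\ surjective phi.
Proof.
move=> phiE; split.
  by apply: lin_inj => c c0; apply: component_inj => m; rewrite -phiE c0.
(* s is surjective on the cokernel Z: some element of C matches d at the finitely many components
   with s in m, and s is invertible at the others. *)
have Zdiv s d : S s -> exists c d', d = s *: d' + phi c.
  move=> Ss; have [l [lP lS lD]] := support Ss; have [c cE] := finite_surj d lP.
  have dd m : {d' : D m | (d - phi c) m = s *: d'}.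
    apply: cid; have [ms|ms] := pselect (sval m s); last first.
      have [d' <-] := proj2 (contramodule_unit (mx (svalP m)) (@Dm m) ms) ((d - phi c) m).
      by exists d'.
    exists 0; rewrite scaler0; transitivity (d m - phi c m) => //.
    by rewrite phiE cE ?subrr //; apply: lS => //; apply: svalP.
  exists c, (fun m => sval (dd m)); apply: functional_extensionality_dep => m.
  transitivity (s *: sval (dd m) + phi c m) => //.
  rewrite -(svalP (dd m)); transitivity (d m - phi c m + phi c m) => //.
  by rewrite subrK.
(* s is injective on Z: if c2 matches d on the finite list, then c - s c2 is s-divisible, say s x_1,
   and d = phi (c2 + x_1); at components with s in m because x_1 dies there, at the others because s
   is injective. *)
have Zinj s d c : S s -> s *: d = phi c -> exists c', d = phi c'.
  move=> Ss; have [l [lP lS lD]] := support Ss; have [c2 c2E] := finite_surj d lP.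
  move=> sd; have sdm m : s *: d m = p m c by rewrite -phiE -sd.
  have [x [x0 xE]] : div s (c - s *: c2).
    apply: lD => m ml; apply/(p0 (exist _ m (lP m ml))).
    by rewrite linmapB linmapZ c2E // sdm subrr.
  have cE : c - s *: c2 = s *: x 1%N.
    by apply/eqP; rewrite -x0 -subr_eq0; apply/eqP/xE.
  exists (c2 + x 1%N); apply: functional_extensionality_dep => m; rewrite phiE linearD.
  have [ms|ms] := pselect (sval m s).
    rewrite (div_core_p ms (x := x 1%N)) ?addr0 ?c2E //; last exact: divset_shift.
    by apply: lS => //; apply: svalP.
  apply/eqP; rewrite -subr_eq0; apply/eqP/(unit_D ms).
  rewrite scalerBr scalerDr sdm -!linmapZ -cE linmapB addrCA subrr addr0.
  by rewrite subrr.
move=> d; have mS := mult_subset_closed dec.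
have [L [q Lq]] := localization_ex (R^o : lmodType R) mS.
have flatL := localization_flat mS Lq.
have [qS qE qD qZ] := Lq; have [S1 SM] := mS.
have q0 : q 0 1 = 0 by rewrite -(scale0r (q 0 1)) qZ // scaler0.
(* Pullback of dprod D -> Z along the map L = S^-1 R -> Z sending 1 to the class of d,
   where Z is the cokernel of phi. *)
pose M : lmodType R := (dprod D * L)%type.
pose G : set M := [set z | exists r w c, [/\ S w, z.2 = q r w & w *: z.1 - r *: d = phi c]].
have sG : submodule G.
  split=> [|z z' [r [w [c [Sw zL zc]]]] [r' [w' [c' [Sw' zL' zc']]]]|a z [r [w [c [Sw zL zc]]]]].
  - exists 0, 1, 0; split=> //=; by rewrite scaler0 scale0r subrr linear0.
  - exists (w' * r + w * r'), (w * w'), (w' *: c + w *: c'); split; first exact: SM.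
      by rewrite /= zL zL' qD.
    have -> : phi (w' *: c + w *: c') = w' *: phi c + w *: phi c'.
      by rewrite linearD !linmapZ.
    rewrite -zc -zc' /= !scalerBr addrACA -opprD.
    rewrite scalerDr scalerDl !scalerA; congr (_ *: _ + _ *: _ - _); ring.
  - exists (a * r), w, (a *: c); split=> //=; first by rewrite zL qZ.
    by rewrite linmapZ -zc scalerBr !scalerA mulrC.
have [E [k [kI kE]]] := submodule_ex sG.
have [a x x'|fst_ fstE] // := @linmap_of_linear R M (dprod D) fst.
have [a x x'|snd_ sndE] // := @linmap_of_linear R M L snd.
have [a x x'|ini iniE] := @linmap_of_linear R C M (fun c => (phi c, 0)).
  by rewrite linearP; congr pair; rewrite /= scaler0 addr0.
have [c|i iE] := lift_inj (h := ini) kI.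
  apply/kE; rewrite iniE; exists 0, 1, c; split=> //=.
  by rewrite scale1r scale0r subr0.
pose pr : linmap E L := snd_ \o k.
have prE z : pr z = (k z).2 by exact: sndE.
have iI : injective i.
  apply: lin_inj => c /(congr1 k); rewrite iE iniE linear0 => /(congr1 fst) phic.
  by apply: component_inj => m; rewrite -phiE [phi c]phic.
have prS : surjective pr.
  move=> x; have [r [w [Sw ->]]] := qS x; have [c [d' dE]] := Zdiv w (r *: d) Sw.
  have [z zE] : exists z, k z = (d', q r w).
    apply/kE; exists r, w, (- c); split=> //=.
    by rewrite dE linearN opprD addrA subrr sub0r.
  by exists z; rewrite prE zE.
have ipr : exact_at i pr.
  move=> z; rewrite prE; split=> [z2|[c <-]]; last by rewrite iE iniE.
  have [r [w [c [Sw zL zc]]]] := proj2 (kE (k z)) (ex_intro _ z erefl).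
  have [w' [Sw' E0]] : exists w', S w' /\ w' * r = 0.
    move: zL; rewrite z2 -q0 => /(qE _ _ _ _ S1 Sw) [w' [Sw' E0]].
    exists w'; split=> //; move: E0; rewrite /GRing.scale /= mul1r mulr0 mulr0.
    by move=> <-.
  have [|c'' c''E] := Zinj (w' * w) (k z).1 (w' *: c) (SM _ _ Sw' Sw).
    by rewrite linmapZ -zc scalerBr !scalerA E0 scale0r subr0.
  exists c''; apply: kI; rewrite iE iniE -c''E -z2.
  by case: (k z).
have [r rE] := proj1 (cotorsionP C) cotC L flatL E i pr iI prS ipr.
have [z zE] : exists z, k z = (d, q 1 1).
  by apply/kE; exists 1, 1, 0; split=> //=; rewrite !scale1r subrr linear0.
(* This vanishes on C, hence factors through L = S^-1 R. The image is S-divisible in a reduced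
   module, so it is zero; at a point of E over 1 this reads d = phi (r z). *)
pose h0 z := (k z).1 - phi (r z).
have [a x x'|h hE] := @linmap_of_linear R E (dprod D) h0.
  by rewrite /h0 (linearP k) (linearP r) (linearP phi) /= opprD addrACA scalerBr.
have [x /ipr [c <-]|g gE] := lift_surj (h := h) prS.
  by rewrite hE /h0 iE iniE rE subrr.
exists (r z); apply/esym/eqP; rewrite -subr_eq0.
have -> : d - phi (r z) = g (pr z) by rewrite gE hE /h0 zE.
apply/eqP; have [redD _] := dprod_S_reduced_cotorsion Dm.
apply: (proj1 (S_reducedP _ _) redD [set y | exists x, g x = y]); last by exists (pr z).
  exact: submodule_range.
move=> s _ Ss [x <-]; have [u [w [Sw ->]]] := qS x.
exists (g (q u (s * w))); split; first by eexists.
rewrite -linmapZ qZ; last exact: SM.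
congr (g _); apply/qE => //; first exact: SM.
by exists 1; split=> //; rewrite /GRing.scale /=; ring.
Qed.

End Components.

Theorem S_reduced_cotorsion_decomposition C : @S_reduced_cotorsion R S C ->
  exists (D : {m | P1 m} -> lmodType R) (phi : linmap C (dprod D)),
    [/\ forall m, @I_contramodule R (sval m) (D m), injective phi & surjective phi].
Proof.
move=> [redC cotC]; have adj u : solvable C u by exact: cotorsion_solvable cotC.
pose T m := {Q : lmodType R & linmap C Q}.
have c m : {Qp : {Q : lmodType R & linmap C Q} |
    [/\ @I_contramodule R (sval m) (projT1 Qp), surjective (projT2 Qp) &
     forall x, projT2 Qp x = 0 <-> core (sval (m : {m | P1 m})) x]}.
  apply: cid; have [Q [p [H1 H2 H3]]] := contramodule_quotient (sval m) adj.
  by exists (existT _ Q p).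
pose D m := projT1 (sval (c m)); pose p m : linmap C (D m) := projT2 (sval (c m)).
have [phi phiE] := dprod_tuple p; exists D, phi.
have Dm m : @I_contramodule R (sval m) (D m) by case: (svalP (c m)).
have [] := @components_bijective C redC cotC D p Dm _ _ phi phiE.
- by move=> m; case: (svalP (c m)).
- by move=> m; case: (svalP (c m)).
by move=> ? ?; split.
Qed.

End Decomposition.

(** * Categories *)

Lemma equivalence_of_fully_faithful (A B : preaddCat) (F : functor A B) :
  (forall X Y (f f' : hom X Y), fmap F f = fmap F f' -> f = f') ->
  (forall X Y (g : hom (F X) (F Y)), exists f : hom X Y, fmap F f = g) ->
  (forall Y, exists X (u : hom (F X) Y), is_iso u) ->
  is_equivalence F.
Proof.
move=> faith full es.
have c Y : {T : {X : A & (hom (F X) Y * hom Y (F X))%type} |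
    comp (projT2 T).2 (projT2 T).1 = idm (F (projT1 T)) /\
    comp (projT2 T).1 (projT2 T).2 = idm Y}.
  by apply: cid; have [X [u [v uv]]] := es Y; exists (existT _ X (u, v)).
pose G0 Y := projT1 (sval (c Y)).
pose u Y : hom (F (G0 Y)) Y := (projT2 (sval (c Y))).1.
pose v Y : hom Y (F (G0 Y)) := (projT2 (sval (c Y))).2.
have vu Y : comp (v Y) (u Y) = idm _ by case: (svalP (c Y)).
have uv Y : comp (u Y) (v Y) = idm _ by case: (svalP (c Y)).
have lft X Y (g : hom (F X) (F Y)) : {f : hom X Y | fmap F f = g} by exact/cid/full.
pose G1 Y Y' (g : hom Y Y') := sval (lft _ _ (comp (v Y') (comp g (u Y)))).
have FG1 Y Y' (g : hom Y Y') : fmap F (G1 _ _ g) = comp (v Y') (comp g (u Y)).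
  exact: svalP (lft _ _ _).
have G1id Y : G1 _ _ (idm Y) = idm (G0 Y).
  by apply: faith; rewrite FG1 comp_idl vu fmap_id.
have G1comp X Y Z (g : hom Y Z) (f : hom X Y) :
    G1 _ _ (comp g f) = comp (G1 _ _ g) (G1 _ _ f).
  by apply: faith; rewrite fmap_comp !FG1 -!comp_assoc (comp_assoc (u Y)) uv comp_idl.
exists (Functor G1id G1comp); split.
  exists (fun X => sval (lft _ _ (u (F X)))); have eE X := svalP (lft _ _ (u (F X))).
  split=> [X Y f|X].
    by apply: faith; rewrite !fmap_comp !eE /= FG1 comp_assoc uv comp_idl.
  exists (sval (lft _ _ (v (F X)))); have eV := svalP (lft _ _ (v (F X))).
  by split; apply: faith; rewrite fmap_comp eE eV fmap_id ?vu ?uv.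
exists u; split=> [X Y f|Y]; last by exists (v Y); split; [exact: vu|exact: uv].
rewrite /= FG1 (comp_assoc (u Y) (v Y)) uv comp_idl //.
Qed.

Section FullSubcategory.
Variables (R : comPzRingType) (P : Mod R -> Prop).
Hypotheses (Pker : closed_under_kernels P) (Pcok : closed_under_cokernels P)
  (Pzero : exists Z : lmodType R, P Z /\ forall z : Z, z = 0)
  (Psum : forall U V : lmodType R, P U -> P V -> P (U * V)%type).
Implicit Types X Y Z : full_subcat P.

Let kernel_ex (X Y : full_subcat P) (f : linmap (sval X) (sval Y)) :
  exists (K : full_subcat P) (k : linmap (sval K) (sval X)),
    injective k /\ exact_at k f.
Proof.
have [K [k [kI kE]]] := submodule_ex (submodule_preim f (submodule_set0 (sval Y))).
have kf : exact_at k f by move=> x; apply: kE.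
have PK : P K.
  by apply: (Pker (svalP X) (svalP Y)); apply/Mod_is_kernel; split; [exact: kI|exact: kf].
by exists (exist _ K PK), k.
Qed.

Let cokernel_ex (X Y : full_subcat P) (f : linmap (sval X) (sval Y)) :
  exists (C : full_subcat P) (c : linmap (sval Y) (sval C)),
    surjective c /\ exact_at f c.
Proof.
have [C [c [cS cE]]] := quotient_ex (submodule_range f).
have PC : P C.
  by apply: (Pcok (svalP X) (svalP Y)); apply/Mod_is_cokernel; split; [exact: cS|exact: cE].
by exists (exist _ C PC), c.
Qed.

(** The test module R may be outside P. Instead, the kernel in modules belongs to P by hypothesis,
    and uniqueness identifies it with any kernel in the subcategory. *)
Let sub_kernel X Y K (f : linmap (sval X) (sval Y)) (k : linmap (sval K) (sval X)) :
  @is_kernel (full_subcat P) X Y K f k <-> injective k /\ exact_at k f.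
Proof.
split=> [[fk kU]|kf]; last first.
  have [fk kU] := proj2 (Mod_is_kernel f k) kf; split=> // W w; exact: kU.
have [K' [k' kf']] := kernel_ex f; have [kI' kE'] := kf'.
have [fk' kU'] := proj2 (Mod_is_kernel f k') kf'.
have [u [ku _]] := kU K' k' fk'; have [v [kv _]] := kU' (sval K) k fk.
have {}ku x : k (u x) = k' x by exact: linmapE ku x.
have {}kv x : k' (v x) = k x by exact: linmapE kv x.
have uv x : u (v x) = x.
  have [w [_ wU]] := kU K k fk.
  have H1 : w = (u \o v : linmap (sval K) (sval K)).
    by apply: wU; apply: linmapP => z; rewrite /= ku kv.
  have H2 : w = (idfun : linmap (sval K) (sval K)) by apply: wU; apply: linmapP.
  by have := linmapE (etrans (esym H1) H2) x.
split=> [x y kxy|x].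
  by rewrite -(uv x) -(uv y); congr (u _); apply: kI'; rewrite !kv.
by split=> [/kE' [y <-]|[y <-]]; [exists (u y)|apply/kE'; exists (v y)].
Qed.

Let sub_cokernel X Y C (f : linmap (sval X) (sval Y)) (c : linmap (sval Y) (sval C)) :
  @is_cokernel (full_subcat P) X Y C f c <-> surjective c /\ exact_at f c.
Proof.
split=> [[cf cU]|fc]; last first.
  have [cf cU] := proj2 (Mod_is_cokernel f c) fc; split=> // W w; exact: cU.
have [C' [c' fc']] := cokernel_ex f; have [cS' cE'] := fc'.
have [cf' cU'] := proj2 (Mod_is_cokernel f c') fc'.
have [u [uc _]] := cU C' c' cf'; have [v [vc _]] := cU' (sval C) c cf.
have {}uc x : u (c x) = c' x by exact: linmapE uc x.
have {}vc x : v (c' x) = c x by exact: linmapE vc x.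
have vu x : v (u x) = x.
  have [w [_ wU]] := cU C c cf.
  have H1 : w = (v \o u : linmap (sval C) (sval C)).
    by apply: wU; apply: linmapP => z; rewrite /= uc vc.
  have H2 : w = (idfun : linmap (sval C) (sval C)) by apply: wU; apply: linmapP.
  by have := linmapE (etrans (esym H1) H2) x.
split=> [x|x].
  by have [y yE] := cS' (u x); exists y; rewrite -vc yE vu.
split=> [cx|[y <-]]; last by rewrite -vc (proj2 (cE' _)) ?linear0 //; exists y.
by apply/cE'; rewrite -uc cx linear0.
Qed.

Lemma abelian_full_subcat : abelian (full_subcat P).
Proof.
split.
- have [Z [PZ Z0]] := Pzero; exists (exist _ Z PZ) => X; split=> f; apply: linmapP => x.
    exact: Z0.
  by rewrite (Z0 x) linear0.
- move=> [U PU] [V PV]; exists (exist _ _ (Psum PU PV)).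
  have [a x y|iX iXE] := @linmap_of_linear R U (U * V)%type (fun x => (x, 0)).
    by congr pair; rewrite /= scaler0 addr0.
  have [a x y|iY iYE] := @linmap_of_linear R V (U * V)%type (fun x => (0, x)).
    by congr pair; rewrite /= scaler0 addr0.
  have [a x y|pX pXE] // := @linmap_of_linear R (U * V)%type U fst.
  have [a x y|pY pYE] // := @linmap_of_linear R (U * V)%type V snd.
  exists iX, iY, pX, pY; split; apply: linmapP => x /=;
    rewrite ?pXE ?pYE ?iXE ?iYE //; case: x => x y.
  by congr pair; rewrite /= ?addr0 ?add0r.
- move=> X Y f; split.
    by have [K [k /sub_kernel kf]] := kernel_ex f; exists K, k.
  by have [C [c /sub_cokernel fc]] := cokernel_ex f; exists C, c.
- move=> X Y f fmono; have [C [c [cS cE]]] := cokernel_ex f; exists C, c.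
  apply/sub_kernel; split=> //; have [K [k [kI kE]]] := kernel_ex f.
  have k0 : k = (0 : linmap _ _).
    apply: fmono; apply: linmapP => x; rewrite /= linear0; apply/kE; by exists x.
  by apply: lin_inj => x /kE [y <-]; rewrite k0.
- move=> X Y f fepi; have [K [k [kI kE]]] := kernel_ex f; exists K, k.
  apply/sub_cokernel; split=> //; have [C [c [cS cE]]] := cokernel_ex f.
  have c0 : c = (0 : linmap _ _).
    by apply: fepi; apply: linmapP => x; apply/cE; exists x.
  by move=> y; apply/cE; rewrite c0.
Qed.

Lemma exact_embedding : exact_functor (embedding P).
Proof.
split=> // X Y Z f g [/sub_kernel kf /sub_cokernel fc].
by split; [apply/Mod_is_kernel | apply/Mod_is_cokernel].
Qed.

End FullSubcategory.

(** * Kernels and cokernels of contramodules *)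

Section ContramoduleClosure.
Variables (R : comPzRingType) (I : set R).
Implicit Types X Y Z : lmodType R.

Lemma separatedE X u : separated u ([set 0] : set X) <->
  forall c : nat -> X, (forall n, c n = u *: c n.+1) -> c 0%N = 0.
Proof.
split=> [sep c cE|H _ [c [<- cE]]].
  by apply: sep; exists c; split=> // n /=; rewrite -cE subrr.
by apply: H => n; apply/eqP; rewrite -subr_eq0; apply/eqP/cE.
Qed.

Lemma contramodule_kernel X Y K (f : linmap X Y) (k : linmap K X) :
  injective k -> exact_at k f ->
  @I_contramodule R I X -> @I_contramodule R I Y -> @I_contramodule R I K.
Proof.
move=> kI kE /I_contramoduleP cX /I_contramoduleP cY.
apply/I_contramoduleP => u Iu; have [/separatedE sX aX] := cX u Iu.
have [/separatedE sY aY] := cY u Iu.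
have fk x : f (k x) = 0 by apply/kE; exists x.
split=> [|a].
  apply/separatedE => c cE; apply: kI; rewrite linear0.
  by apply: (sX (fun n => k (c n))) => n; rewrite -linmapZ -cE.
have [x xE] := aX (fun n => k (a n)).
(* A solution in X already lies in the kernel: its image in Y solves the homogeneous system, which
   has only the zero solution. *)
have [n|c cE] := @choice nat K (fun n c => k c = x n).
  apply/kE; have := sY (fun i => f (x (n + i)%N)); rewrite addn0; apply=> i.
  rewrite -linmapZ; apply/eqP; rewrite -subr_eq0 -linmapB addnS xE; apply/eqP.
  exact: fk.
by exists c => n; apply: kI; rewrite linmapB linmapZ !cE.
Qed.

Lemma contramodule_cokernel X Y C (f : linmap X Y) (c : linmap Y C) :
  surjective c -> exact_at f c ->
  @I_contramodule R I X -> @I_contramodule R I Y -> @I_contramodule R I C.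
Proof.
move=> cS cE /I_contramoduleP cX /I_contramoduleP cY.
apply/I_contramoduleP => u Iu; have [/separatedE sX aX] := cX u Iu.
have [/separatedE sY aY] := cY u Iu.
split=> [|a].
  apply/separatedE => z zE; have [y yE] := choice (fun n => cS (z n)).
  have [n|x xE] := @choice nat X (fun n x => f x = y n - u *: y n.+1).
    by apply/cE; rewrite linmapB linmapZ !yE -zE subrr.
  (* The lifts y_n are u-divisible up to the f(x_n). Correcting them by f(w_n), with w a solution
     for the x_n, gives a u-divisible sequence in Y, hence zero. *)
  have [w wE] := aX x; rewrite -yE; apply/cE; exists (w 0%N).
  apply/esym/eqP; rewrite -subr_eq0; apply/eqP.
  apply: (sY (fun n => y n - f (w n))) => n; apply/eqP; rewrite -subr_eq0.
  by rewrite scalerBr subr_swap -xE -linmapZ -linmapB wE subrr.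
have [y yE] := choice (fun n => cS (a n)); have [z zE] := aY y.
by exists (fun n => c (z n)) => n; rewrite -linmapZ -linmapB zE yE.
Qed.

Lemma contramodule_zero X : (forall x : X, x = 0) -> @I_contramodule R I X.
Proof.
move=> X0; apply/I_contramoduleP => u _; split; first by move=> x _; apply: X0.
by move=> a; exists a => n; rewrite [RHS]X0; apply: X0.
Qed.

Lemma contramodule_sum X Y : @I_contramodule R I X -> @I_contramodule R I Y ->
  @I_contramodule R I (X * Y)%type.
Proof.
move=> /I_contramoduleP cX /I_contramoduleP cY.
apply/I_contramoduleP => u Iu; have [/separatedE sX aX] := cX u Iu.
have [/separatedE sY aY] := cY u Iu.
split=> [|a].
  apply/separatedE => c cE; have c1 n : (c n).1 = u *: (c n.+1).1 by rewrite {1}cE.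
  have c2 n : (c n).2 = u *: (c n.+1).2 by rewrite {1}cE.
  have := sX (fun n => (c n).1) c1; have := sY (fun n => (c n).2) c2.
  by case: (c 0%N) => x y /= -> ->.
have [x xE] := aX (fun n => (a n).1); have [y yE] := aY (fun n => (a n).2).
exists (fun n => (x n, y n)) => n; have := xE n; have := yE n.
by case: (a n) => b d /= <- <-.
Qed.

Lemma abelian_contramodules : abelian (full_subcat (@I_contramodule R I)).
Proof.
apply: abelian_full_subcat.
- move=> X Y K f k cX cY /Mod_is_kernel [kI kE].
  exact: contramodule_kernel kI kE cX cY.
- move=> X Y C f c cX cY /Mod_is_cokernel [cS cE].
  exact: contramodule_cokernel cS cE cX cY.
- pose Z : lmodType R := dprod (fun _ : False => R^o : lmodType R).
  have Z0 (z : Z) : z = 0 by apply: functional_extensionality_dep => -[].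
  by exists Z; split=> //; apply: contramodule_zero.
- exact: contramodule_sum.
Qed.

End ContramoduleClosure.

(** * Closure properties of C_R and the equivalence *)

Section ReducedCotorsion.
Variables (R : comPzRingType) (P0 P1 : set (set R)).
Hypotheses (noeth : noetherian R) (dec : spec_decomposition P0 P1).

Let S := mult_subset P0.
Let Idx := {m : set R | P1 m}.
Let mx (m : set R) : P1 m -> maximal_ideal m := @P1_maximal R P0 P1 dec m.

Lemma divset_map (X Y : lmodType R) (f : linmap X Y) s x :
  divset s [set 0] x -> divset s [set 0] (f x).
Proof.
move=> [c [<- cE]]; exists (fun n => f (c n)); split=> // n.
by rewrite /= -linmapZ -linmapB cE linear0.
Qed.

Lemma dprod_divset (X : Idx -> lmodType R) (Q : set Idx) s (x : dprod X) :
  (forall n, @I_contramodule R (sval n) (X n)) -> (forall n, Q n -> ~ sval n s) ->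
  (forall n, ~ Q n -> x n = 0) -> divset s [set 0] x.
Proof.
move=> cX Qs; apply: (@divset_step _ _ _ _ [set x : dprod X | forall n, ~ Q n -> x n = 0]).
move=> {}x xQ.
have y n : {y : X n | (~ Q n -> y = 0) /\ x n = s *: y}.
  apply: cid; have [Qn|Qn] := pselect (Q n); last first.
    by exists 0; rewrite scaler0; split=> //; apply: xQ.
  have [_ /(_ (x n)) [y yE]] := contramodule_unit (mx (svalP n)) (cX n) (Qs n Qn).
  by exists y.
exists (fun n => sval (y n)); split=> [n Qn|]; first by case: (svalP (y n)) => /(_ Qn).
apply/eqP; rewrite subr_eq0; apply/eqP; apply: functional_extensionality_dep => n.
by case: (svalP (y n)).
Qed.

(** With s in m and S, split x into x1, supported where s is not in the ideal, and x2, supported at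
    the finitely many others except m. The first is s-divisible, the second e-divisible for an e in
    m that is 1 modulo those ideals; an m-contramodule receives zero from both. *)
Lemma dprod_hom_diagonal (X Y : Idx -> lmodType R) (h : linmap (dprod X) (dprod Y)) :
  (forall n, @I_contramodule R (sval n) (X n)) ->
  (forall n, @I_contramodule R (sval n) (Y n)) ->
  forall x m, x m = 0 -> h x m = 0.
Proof.
move=> cX cY x m xm0; have Pm := svalP m.
have [s [ms Ss]] := P1_meets_S noeth dec Pm.
have [l [lP lS _]] := S_prodin noeth dec Ss.
pose l' := List.filter (fun n => `[< n <> sval m >]) l.
have [n|ml|e [f [me lf ef]]] := @maximal_crt R (sval m) l' (mx Pm).
- by move=> /List.filter_In [/lP /mx].
- by case/List.filter_In: ml => _ /asboolP; apply.
pose x1 : dprod X := fun n => if pselect (sval n s) then 0 else x n.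
pose x2 : dprod X := fun n => if pselect (sval n s) then x n else 0.
have -> : x = x1 + x2.
  apply: functional_extensionality_dep => n; transitivity (x1 n + x2 n) => //.
  by rewrite /x1 /x2; case: pselect => ns; rewrite ?addr0 ?add0r.
have [pm pmE] := dprod_proj Y m; have cYm := proj1 (I_contramoduleP _ _) (cY m).
have h0 u z : sval m u -> divset u [set 0] z -> h z m = 0.
  move=> mu uz; rewrite -pmE; have [sep _] := cYm u mu; apply: sep.
  exact/divset_map/divset_map.
rewrite linearD; transitivity (h x1 m + h x2 m) => //.
rewrite (h0 s x1 ms) ?(h0 e x2 me) ?addr0 //.
  apply: (dprod_divset (Q := [set n | sval n s /\ n <> m])) => // n; last first.
    move=> nQ; rewrite /x2; have [->|nm] := pselect (n = m); case: pselect => // ns.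
    by case: nQ.
  move=> [ns nm] ne; have [[idn n1] _] := P1_prime dec (svalP n); apply: n1; rewrite -ef.
  apply: idealD => //; apply: lf; apply/List.filter_In; split.
    by apply: lS => //; apply: svalP.
  apply/asboolP => E; apply: nm; apply: eq_sig_hprop E => ? ? ?; exact: Prop_irrelevance.
apply: (dprod_divset (Q := [set n | ~ sval n s])) => // n.
by rewrite /x1; case: pselect => // ns [].
Qed.

Lemma dprod_single (X : Idx -> lmodType R) m (a : X m) : exists x : dprod X, x m = a.
Proof.
exists (fun n => if pselect (m = n) is left E then eq_rect m X a n E else 0).
by case: pselect => // E; rewrite (Prop_irrelevance E erefl).
Qed.

Lemma dprod_hom_components (X Y : Idx -> lmodType R) (h : linmap (dprod X) (dprod Y)) :
  (forall n, @I_contramodule R (sval n) (X n)) ->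
  (forall n, @I_contramodule R (sval n) (Y n)) ->
  exists f : forall m, linmap (X m) (Y m), forall x m, h x m = f m (x m).
Proof.
move=> cX cY; have hd := dprod_hom_diagonal h cX cY.
have f m : {f : linmap (X m) (Y m) | forall x, h x m = f (x m)}.
  apply: cid; have [a|_ [x [/hd xm0 <-]]|b a a' c c' [x [<- <-]] [x' [<- <-]]|f fE] //:=
      @linmap_of_rel R (X m) (Y m) (fun a c => exists x : dprod X, x m = a /\ h x m = c).
  - by have [x xa] := dprod_single a; exists (h x m), x.
  - by exists (b *: x + x'); rewrite linearP.
  - by exists f => x; apply/esym/fE; exists x.
by exists (fun m => sval (f m)) => x m; case: (f m).
Qed.

Let C_R : Mod R -> Prop := S_reduced_cotorsion S.

(** Up to isomorphism a morphism of C_R is a family of morphisms of contramodules, so kernels and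
    cokernels can be taken componentwise. *)
Lemma reduced_cotorsion_hom (X Y : lmodType R) (f : linmap X Y) : C_R X -> C_R Y ->
  exists (D D' : Idx -> lmodType R) (phi : linmap X (dprod D)) (psi : linmap Y (dprod D'))
    (g : forall m, linmap (D m) (D' m)),
  [/\ forall m, @I_contramodule R (sval m) (D m),
      forall m, @I_contramodule R (sval m) (D' m),
      injective phi /\ surjective phi, injective psi /\ surjective psi
    & forall x m, psi (f x) m = g m (phi x m)].
Proof.
move=> cX cY.
have [D [phi [cD phiI phiS]]] := S_reduced_cotorsion_decomposition noeth dec cX.
have [D' [psi [cD' psiI psiS]]] := S_reduced_cotorsion_decomposition noeth dec cY.
have [phi' [phiK phiK']] := linear_inverse phiI phiS.
have [g gE] := dprod_hom_components (psi \o (f \o phi') : linmap _ _) cD cD'.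
exists D, D', phi, psi, g; split=> // x m.
by rewrite -gE /= phiK.
Qed.

Lemma reduced_cotorsion_kernels : closed_under_kernels C_R.
Proof.
move=> X Y K f k cX cY /Mod_is_kernel [kI kE].
have [D [D' [phi [psi [g [cD cD' [phiI phiS] [psiI psiS] gE]]]]]] :=
  reduced_cotorsion_hom f cX cY.
have Q m : {Q : {Q : lmodType R & linmap Q (D m)} |
    injective (projT2 Q) /\ exact_at (projT2 Q) (g m)}.
  apply: cid; have [Q [q [qI qE]]] := submodule_ex (submodule_preim (g m) (submodule_set0 _)).
  by exists (existT _ Q q); split=> //= x; apply: qE.
pose D'' m := projT1 (sval (Q m)); pose q m : linmap (D'' m) (D m) := projT2 (sval (Q m)).
have qI m : injective (q m) by case: (svalP (Q m)).
have qE m : exact_at (q m) (g m) by case: (svalP (Q m)).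
have cD'' m : @I_contramodule R (sval m) (D'' m).
  exact: contramodule_kernel (@qI m) (@qE m) (cD m) (cD' m).
have [phi' [phiK phiK']] := linear_inverse phiI phiS.
pose w : linmap (dprod D'') X := phi' \o dprod_map q.
have wE x m : phi (w x) m = q m (x m) by rewrite /= phiK'.
have [x|t tE] := lift_inj (h := w) kI.
  apply/kE/psiI; rewrite linear0; apply: functional_extensionality_dep => m.
  by rewrite gE wE; apply/qE; exists (x m).
apply: (S_reduced_cotorsion_iso (h := t)); last exact: (dprod_S_reduced_cotorsion noeth dec).
  apply: lin_inj => x tx0; apply: functional_extensionality_dep => m; apply: qI.
  by rewrite -wE -tE tx0 !linear0.
move=> z; have y m : {y | q m y = phi (k z) m}.
  apply/cid/qE; rewrite -gE (proj2 (kE (k z))) ?linear0 //; by exists z.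
exists (fun m => sval (y m)); apply: kI; apply: phiI; rewrite tE.
by apply: functional_extensionality_dep => m; rewrite wE (svalP (y m)).
Qed.

Lemma reduced_cotorsion_cokernels : closed_under_cokernels C_R.
Proof.
move=> X Y C f c cX cY /Mod_is_cokernel [cS cE].
have [D [D' [phi [psi [g [cD cD' [phiI phiS] [psiI psiS] gE]]]]]] :=
  reduced_cotorsion_hom f cX cY.
have Q m : {Q : {Q : lmodType R & linmap (D' m) Q} |
    surjective (projT2 Q) /\ exact_at (g m) (projT2 Q)}.
  apply: cid; have [Q [q [qS qE]]] := quotient_ex (submodule_range (g m)).
  by exists (existT _ Q q).
pose D'' m := projT1 (sval (Q m)); pose q m : linmap (D' m) (D'' m) := projT2 (sval (Q m)).
have qS m : surjective (q m) by case: (svalP (Q m)).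
have qE m : exact_at (g m) (q m) by case: (svalP (Q m)).
have cD'' m : @I_contramodule R (sval m) (D'' m).
  exact: contramodule_cokernel (@qS m) (@qE m) (cD m) (cD' m).
pose w : linmap Y (dprod D'') := dprod_map q \o psi.
have wE y m : w y m = q m (psi y m) by [].
have [y /cE [x <-]|t tE] := lift_surj (h := w) cS.
  apply: functional_extensionality_dep => m; rewrite wE gE.
  by apply/qE; exists (phi x m).
have tI : injective t.
  apply: lin_inj => z; have [y <-] := cS z; rewrite tE => wy0; apply/cE.
  have x m : {x | g m x = psi y m} by apply/cid/qE; rewrite -wE wy0.
  have [x' x'E] := phiS (fun m => sval (x m)); exists x'; apply: psiI.
  by apply: functional_extensionality_dep => m; rewrite gE x'E (svalP (x m)).
have tS : surjective t.
  move=> d; have y m : {y | q m y = d m} by apply/cid/qS.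
  have [y' y'E] := psiS (fun m => sval (y m)); exists (c y'); rewrite tE.
  by apply: functional_extensionality_dep => m; rewrite wE y'E (svalP (y m)).
have [t' [tK tK']] := linear_inverse tI tS.
apply: (S_reduced_cotorsion_iso (h := t')); last exact: (dprod_S_reduced_cotorsion noeth dec).
  exact: can_inj tK'.
by move=> z; exists (t z).
Qed.

Lemma reduced_cotorsion_extensions : closed_under_extensions C_R.
Proof.
move=> X Y Z f g [redX /cotorsionP cotX] [redZ /cotorsionP cotZ] /Mod_short_exact [fI gS fg].
split; last by apply/cotorsionP => F flatF; apply: ext_split_ext fI gS fg _ _; auto.
apply/S_reducedP => B sB divB b Bb.
(* The image of B in Z is S-divisible, hence zero, so B comes from X, where it is again S-divisible
   because f is injective. *)
have gB0 d : B d -> (g : linmap Y Z) d = 0.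
  move=> Bd; apply: (proj1 (S_reducedP _ _) redZ [set (g : linmap Y Z) x | x in B]).
  - exact: submodule_image.
  - move=> s _ Ss [x Bx <-]; have [x' [Bx' ->]] := divB s x Ss Bx.
    by exists ((g : linmap Y Z) x'); rewrite linmapZ; split=> //; exists x'.
  - by exists d.
have /fg [a ab] := gB0 b Bb.
suff : a = 0 by move=> a0; rewrite -ab a0 linear0.
apply: (proj1 (S_reducedP _ _) redX [set x | B ((f : linmap X Y) x)]).
- exact: submodule_preim.
- move=> s x Ss Bx; have [d [Bd fx]] := divB s _ Ss Bx.
  have /fg [x' x'd] := gB0 d Bd; exists x'; split; first by rewrite /= x'd.
  by apply: fI; rewrite linmapZ x'd.
- by rewrite /= ab.
Qed.

Lemma reduced_cotorsion_products : closed_under_products C_R.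
Proof.
move=> I X Y p cX prod_p.
have pI y : (forall i, (p i : linmap Y (X i)) y = 0) -> y = 0.
  move=> y0; have [h hE] := linmap_point (y : (Y : lmodType R)).
  have [u [_ uU]] := prod_p (R^o : lmodType R) (fun i => 0 : linmap _ _).
  have H1 : u = h.
    by apply: uU => i; apply: linmapP => r; rewrite /= hE linmapZ y0 scaler0.
  have H2 : u = (0 : linmap _ _).
    by apply: uU => i; apply: linmapP => r; rewrite /= linear0.
  by have := linmapE (etrans (esym H1) H2) 1; rewrite hE scale1r.
split.
  by apply: (S_reduced_joint (p := p)) => // i; case: (cX i).
apply/cotorsionP => F flatF; apply: (ext_split_joint (p := p)) => // [W w|i].
  by have [u [uE _]] := prod_p W w; exists u => i x; exact: linmapE (uE i) x.
by have [_ /cotorsionP] := cX i; apply.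
Qed.

Lemma abelian_reduced_cotorsion :
  abelian (full_subcat C_R) /\ exact_functor (embedding C_R).
Proof.
have cK := reduced_cotorsion_kernels; have cC := reduced_cotorsion_cokernels.
split; last exact: exact_embedding.
apply: abelian_full_subcat => //.
  (* The zero module is an empty product and a direct sum is an extension, so the closure properties
     already proved apply. *)
  pose Z : lmodType R := dprod (fun _ : False => R^o : lmodType R).
  have Z0 (z : Z) : z = 0 by apply: functional_extensionality_dep => -[].
  exists Z; split=> //.
  pose p (i : False) : linmap Z Z := match i with end.
  apply: (@reduced_cotorsion_products False (fun=> Z) Z p) => // W w.
  exists (0 : linmap _ _); split=> [[]|u _]; apply: linmapP => x.
  by rewrite [LHS]Z0 [RHS]Z0.
move=> U V cU cV.
have [a x y|i iE] := @linmap_of_linear R U (U * V)%type (fun x => (x, 0)).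
  by congr pair; rewrite /= scaler0 addr0.
have [a x y|p pE] // := @linmap_of_linear R (U * V)%type V snd.
apply: (reduced_cotorsion_extensions (f := i) (g := p) cU cV).
apply/Mod_short_exact; split=> [x y|y|[x y]].
- by rewrite !iE => -[].
- by exists (0, y); rewrite pE.
- by rewrite pE; split=> [/= ->|[x']]; [exists x|rewrite iE => -[]].
Qed.

Lemma product_functor_equivalence
  (H : forall C, C_R (product_functor (fun m : Idx => @I_contramodule R (sval m)) C)) :
  is_equivalence (corestrict H).
Proof.
apply: equivalence_of_fully_faithful.
- move=> X Y f f' ff'; apply: functional_extensionality_dep => m; apply: linmapP => a.
  have [x <-] := dprod_single (X := fun m => sval (X m)) a.
  have /(congr1 (fun z => z m)) := linmapE ff' x; exact.
- move=> X Y g.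
  have [f fE] := dprod_hom_components (X := fun m => sval (X m)) (Y := fun m => sval (Y m))
    g (fun m => svalP (X m)) (fun m => svalP (Y m)).
  exists f; apply: linmapP => x; apply: functional_extensionality_dep => m.
  by rewrite fE.
- move=> [Y cY].
  have [D [phi [cD phiI phiS]]] := S_reduced_cotorsion_decomposition noeth dec cY.
  have [phi' [phiK phiK']] := linear_inverse phiI phiS.
  exists (fun m => exist _ (D m) (cD m)), phi', phi.
  by split; apply: linmapP.
Qed.

End ReducedCotorsion.

Theorem corollary13p13 (R : comPzRingType) (P0 P1 : set (set R)) :
  noetherian R -> krull_dim_le R 1 -> spec_decomposition P0 P1 ->
  let C_R : Mod R -> Prop := S_reduced_cotorsion (mult_subset P0) in
  let contra (m : {m : set R | P1 m}) : Mod R -> Prop :=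
    I_contramodule (sval m) in
  (* (a) *)
  ([/\ closed_under_kernels C_R, closed_under_cokernels C_R,
       closed_under_extensions C_R & closed_under_products C_R] /\
   (abelian (full_subcat C_R) /\ exact_functor (embedding C_R))) /\
  (* (b) *)
  ((forall m, abelian (full_subcat (contra m))) /\
   exists prod_in_C_R : forall C, C_R (product_functor contra C),
     is_equivalence (corestrict prod_in_C_R)).
Proof.
move=> noeth _ dec C_R contra; split; split.
- split.
  + exact: reduced_cotorsion_kernels noeth dec.
  + exact: reduced_cotorsion_cokernels noeth dec.
  + exact: reduced_cotorsion_extensions.
  + exact: reduced_cotorsion_products.
- exact: abelian_reduced_cotorsion noeth dec.
- by move=> m; apply: abelian_contramodules.
have H C : C_R (product_functor contra C).
  apply: (dprod_S_reduced_cotorsion noeth dec) => m; exact: svalP (C m).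
by exists H; apply: product_functor_equivalence noeth dec H.
Qed.
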